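(* There is a deterministic algorithm which takes as input an explicit description of an $n$-variable degree-$2$ polynomial $p$ with $b$-bit integer coefficients and a value $\epsilon>0$, runs in time $\mathrm{poly}(n,b,1/\epsilon)$, and outputs a degree-$2$ polynomial $q(y)=\sum_{i=1}^K(\lambda_iy_i^2+\mu_iy_i)+C'$ with each $\lambda_i,\mu_i\in\mathbb{Z}$ and $K=\tilde{O}(1/\epsilon^4)$, such that \[ \left|\Pr_{x\sim\mathcal{N}(0,1)^n}[p(x)\ge0]-\Pr_{y\sim\mathcal{N}(0,1)^K}[q(y)\ge0]\right|\le O(\epsilon). \]
   Context: $\mathcal{N}(0,1)^m$ denotes the standard Gaussian distribution on $\mathbb{R}^m$. $\tilde{O}$ hides polylogarithmic factors; $O(\epsilon)$ means at most $c\epsilon$ for an absolute constant $c$. *)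

(* Defs.v *)
From HB Require Import structures.
From mathcomp Require Import all_boot all_order all_algebra.
From mathcomp Require Import all_classical all_reals all_analysis.
Set Implicit Arguments.
Unset Strict Implicit.
Unset Printing Implicit Defensive.
Import Order.TTheory GRing.Theory Num.Theory.
Import numFieldNormedType.Exports.
Local Open Scope classical_set_scope.
Local Open Scope ring_scope.

(* Algorithms are programs of a unit-cost random access machine whose cells,
   addressed by integers, hold unbounded integers and whose only arithmetic is
   addition and subtraction. As there is no multiplication, a command lengthens
   the integers in memory by at most O(1) bits, the constant depending only on
   the program, so polynomial time at unit cost on this machine coincides with
   polynomial time on Turing machines. *)

Definition memory := int -> int.

Definition upd (M : memory) (a v : int) : memory :=
  fun z => if z == a then v else M z.

Inductive expr : Type :=
| Const of int
| Cell of expr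
| Plus of expr & expr
| Minus of expr & expr.

Inductive program : Type :=
| Skip
| Store of expr & expr
| Seq of program & program
| IfPos of expr & program & program
| WhilePos of expr & program.

Fixpoint eval (M : memory) (e : expr) : int :=
  match e with
  | Const z => z
  | Cell e1 => M (eval M e1)
  | Plus e1 e2 => eval M e1 + eval M e2
  | Minus e1 e2 => eval M e1 - eval M e2
  end.

Fixpoint cost (e : expr) : nat :=
  match e with
  | Const _ => 1
  | Cell e1 => (cost e1).+1
  | Plus e1 e2 | Minus e1 e2 => (cost e1 + cost e2).+1
  end.

(* [exec P M t M']: started in memory M, the program P halts after t steps
   with memory M'. *)
Inductive exec : program -> memory -> nat -> memory -> Prop :=
| ExecSkip M : exec Skip M 1 M
| ExecStore a e M :
    exec (Store a e) M (cost a + cost e).+1 (upd M (eval M a) (eval M e))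
| ExecSeq P1 P2 M M1 M2 t1 t2 :
    exec P1 M t1 M1 -> exec P2 M1 t2 M2 -> exec (Seq P1 P2) M (t1 + t2) M2
| ExecIfT e P1 P2 M M1 t :
    0 < eval M e -> exec P1 M t M1 ->
    exec (IfPos e P1 P2) M (cost e + t).+1 M1
| ExecIfF e P1 P2 M M1 t :
    eval M e <= 0 -> exec P2 M t M1 ->
    exec (IfPos e P1 P2) M (cost e + t).+1 M1
| ExecWhileF e P M :
    eval M e <= 0 -> exec (WhilePos e P) M (cost e).+1 M
| ExecWhileT e P M M1 M2 t1 t2 :
    0 < eval M e -> exec P M t1 M1 -> exec (WhilePos e P) M1 t2 M2 ->
    exec (WhilePos e P) M (cost e + t1 + t2).+1 M2.

Lemma exec_deterministic P M t1 M1 t2 M2 :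
  exec P M t1 M1 -> exec P M t2 M2 -> t1 = t2 /\ M1 = M2.
Proof.
move=> H; elim: H t2 M2 => {P M t1 M1}.
- by move=> M t2 M2 H; inversion H.
- by move=> a e M t2 M2 H; inversion H.
- move=> P1 P2 M M1 M2 t1 t2 _ IH1 _ IH2 t3 M3 H; inversion H; subst.
  match goal with A : exec P1 _ _ _, B : exec P2 _ _ _ |- _ =>
    have [? ?] := IH1 _ _ A; subst; have [-> ->] := IH2 _ _ B end.
  by [].
- move=> e P1 P2 M M1 t e0 _ IH t3 M3 H; inversion H; subst; last first.
    by move: e0; rewrite ltNge => /negP[].
  by match goal with A : exec P1 _ _ _ |- _ => have [-> ->] := IH _ _ A end.
- move=> e P1 P2 M M1 t e0 _ IH t3 M3 H; inversion H; subst.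
    by move: e0; rewrite leNgt => /negP[].
  by match goal with A : exec P2 _ _ _ |- _ => have [-> ->] := IH _ _ A end.
- move=> e P M e0 t3 M3 H; inversion H; subst => //.
  by move: e0; rewrite leNgt => /negP[].
- move=> e P M M1 M2 t1 t2 e0 _ IH1 _ IH2 t3 M3 H; inversion H; subst.
    by move: e0; rewrite ltNge => /negP[].
  match goal with A : exec P _ _ _, B : exec (WhilePos e P) _ _ _ |- _ =>
    have [? ?] := IH1 _ _ A; subst; have [-> ->] := IH2 _ _ B end.
  by [].
Qed.

(* Polynomials of degree at most 2 in n variables. Only the coefficients
   [quad p i j] with i <= j are meaningful: one for each monomial x_i x_j. *)
Record quadpoly (n : nat) := QuadPoly {
  quad : 'I_n -> 'I_n -> int;
  lin : 'I_n -> int;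
  cst : int
}.

Definition qeval (R : realType) (n : nat) (p : quadpoly n) (x : n.-tuple R) : R :=
  \sum_(i < n) \sum_(j < n | (i <= j)%N)
     (quad p i j)%:~R * tnth x i * tnth x j
  + \sum_(i < n) (lin p i)%:~R * tnth x i
  + (cst p)%:~R.

Definition bits_le (b : nat) (z : int) : Prop := (`|z| < 2 ^ b)%N.

Definition quadpoly_bits_le (b n : nat) (p : quadpoly n) : Prop :=
  [/\ forall i j : 'I_n, (i <= j)%N -> bits_le b (quad p i j),
      forall i, bits_le b (lin p i)
    & bits_le b (cst p)].

(* The input occupies the cells 0, 1, 2, ...: first n, the numerator and the
   denominator of eps, and the constant term, then the linear coefficients, then
   the n x n table of the quadratic coefficients, row by row, with zeros below
   the diagonal. *)
Definition input_seq (n : nat) (p : quadpoly n) (eps : rat) : seq int :=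
  [:: n%:Z; numq eps; denq eps; cst p]
  ++ [seq lin p i | i : 'I_n]
  ++ [seq (if ((i : 'I_n) <= (j : 'I_n))%N then quad p i j else 0)
       | i <- enum 'I_n, j <- enum 'I_n].

Definition input_memory (n : nat) (p : quadpoly n) (eps : rat) : memory :=
  fun a => if a is Posz k then nth 0 (input_seq p eps) k else 0.

Record diagpoly (K : nat) := DiagPoly {
  dlam : 'I_K -> int;
  dmu : 'I_K -> int;
  dcst : rat
}.

Definition deval (R : realType) (K : nat) (q : diagpoly K) (y : K.-tuple R) : R :=
  \sum_(i < K) ((dlam q i)%:~R * tnth y i ^+ 2 + (dmu q i)%:~R * tnth y i)
  + ratr (dcst q).

(* The output is read off the cells 0, 1, 2, ...: K, then a numerator and a
   positive denominator of the constant term, then the pairs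
   lambda_i, mu_i. *)
Definition output (M : memory) (K : nat) (q : diagpoly K) : Prop :=
  [/\ M 0 = K%:Z,
      0 < M 2 /\ dcst q = (M 1)%:~R / (M 2)%:~R
    & forall i : 'I_K, M (3 + 2 * i)%N%:Z = dlam q i
                    /\ M (4 + 2 * i)%N%:Z = dmu q i].

Section gaussian.
Variable R : realType.
Local Notation T := (measurableTypeR R).

Definition cons_pair n (xt : T * n.-tuple T) : n.+1.-tuple T :=
  [tuple of xt.1 :: xt.2].

Lemma measurable_cons_pair n : measurable_fun setT (@cons_pair n).
Proof. exact: measurable_cons. Qed.

HB.instance Definition _ n :=
  isMeasurableFun.Build _ _ _ _ (@cons_pair n) (@measurable_cons_pair n).

(* The standard Gaussian distribution N(0,1)^n, as the n-fold product of
   N(0,1). *)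
Fixpoint gaussian (n : nat) : probability (n.-tuple T) R :=
  match n with
  | 0 => \d_ ([tuple] : 0.-tuple T)
  | m.+1 => distribution (normal_prob 0 1 \x gaussian m)%E (@cons_pair m)
  end.

Lemma gaussian_box n (A : 'I_n -> set T) : (forall i, measurable (A i)) ->
  gaussian n [set x | forall i, A i (tnth x i)]
  = (\prod_(i < n) normal_prob 0 1 (A i))%E.
Proof.
elim: n A => [|n IHn] A mA.
  rewrite big_ord0 /= diracE mem_set// => i; by case: i.
rewrite big_ord_recl -IHn//.
have mB : measurable [set x : n.-tuple T | forall i, A (lift ord0 i) (tnth x i)].
  rewrite (_ : [set _ | _] = \bigcap_(i in [set: 'I_n])
      ((fun x : n.-tuple T => tnth x i) @^-1` A (lift ord0 i))).
    apply: fin_bigcap_measurable => [|i _]; first exact: finite_finset.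
    by rewrite -[X in measurable X]setTI; exact: measurable_tnth.
  by apply/seteqP; split=> x /= Ax i; [move=> _|]; exact: Ax.
rewrite -product_measure1E//= /distribution /pushforward.
congr (_ _); apply/seteqP; split=> -[x y] /=.
  move=> Axy; split=> [|i]; first exact: (Axy ord0).
  by have := Axy (lift ord0 i); rewrite tnthS.
by case=> Ax Ay i; case: (unliftP ord0 i) => [j ->|->//]; rewrite tnthS.
Qed.

End gaussian.

(* Main.v *)
Require Import Defs.
From HB Require Import structures.
From mathcomp Require Import all_boot all_order all_algebra.
From mathcomp Require Import all_classical all_reals all_analysis.
From mathcomp Require Import measurable_realfun lebesgue_integral zify ring lra.
Set Implicit Arguments.
Unset Strict Implicit.
Unset Printing Implicit Defensive.
Import Order.TTheory GRing.Theory Num.Theory.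
Import numFieldNormedType.Exports.
Local Open Scope classical_set_scope.
Local Open Scope ring_scope.

(** The output needs one variable only: a deterministic program can compute the
    probability of [p >= 0] up to [O(eps)] and return [q(y) = y - theta], where
    [theta] is a quantile of N(0,1).  Let [a] be about [n + 1/eps].  The symmetric
    matrix of [p] is brought to a nearly diagonal form by Jacobi rotations with
    rational cosine [(1 - t^2)/(1 + t^2)], which preserve the Gaussian measure; the
    Frobenius norm is invariant and every step lowers the off-diagonal part by a
    fixed fraction, so polynomially many steps suffice.  For a diagonal form the
    probability is a sum over a grid of cells of width [a^-9] in the cube of side
    [2a], evaluated one variable at a time by dynamic programming on the rounded
    value of the polynomial, the weight of the cell at [x] being
    [(1 - x^2 / (2 a^7))^(a^7)], close to [exp (- x^2 / 2)].  Some coefficient of the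
    normalised form is at least [1/a], hence the form is anticoncentrated and the
    rounding errors cost [O(1/a)].  All loops have a bound polynomial in [a], and
    multiplications are only by integers of that size, done by repeated addition, so
    that the running time does not depend on the bit length. *)

(** * Invariance of the Gaussian measure under rotations *)

Import HBNNSimple.

Section normal_integral.
Variable R : realType.
Local Notation mu := (@lebesgue_measure R).
Local Notation T := (measurableTypeR R).
Local Notation N := (normal_prob (0 : R) 1).
Local Open Scope ereal_scope.

(** A product costs as many additions as the size of the factor that drives them, and this shapes
    every formula. Coefficients, weights and partial counts may be of any length, but they are only
    ever multiplied by integers bounded by a power of [a]. Hence nothing is divided out: the form is
    an integer matrix [A] over an integer scale [E], a rotation with cosine [rc / rw] multiplies [E]
    by [rw ^+ 2], and probabilities are compared after clearing the powers of [Wt]. The weight is a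
    power of a bounded integer for the same reason. The form is homogenised: index 0 stands for the
    constant 1, and rotations mix the other indices only. The constant term stays out of every norm
    and of the scale, since it may dwarf all other coefficients; anticoncentration does not see it.
    The exponents follow from one tolerance. Off-diagonal entries below [a^-9] change the form by at
    most [a^-5] on the cube, and the rounding in the dynamic program is kept below [a^-5] as well. A
    form with a coefficient at least [1/a] takes values within [a^-5] of 0 with probability
    [O(1/a)], whence the signs agree up to [O(1/a)]. *)

Lemma ge0_integral_normal_prob (f : T -> \bar R) :
  measurable_fun [set: T] f -> (forall x, 0 <= f x) ->
  \int[N]_x f x = \int[mu]_x (f x * (normal_pdf 0 1 x)%:E).
Proof.
move=> mf f0; have f0D x : [set: T] x -> 0 <= f x by []; pose f_ := nnsfun_approx measurableT mf.
have p0 x : 0 <= (normal_pdf 0 1 x : R)%:E by rewrite lee_fin normal_pdf_ge0.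
have mp : measurable_fun [set: T] (fun x => (normal_pdf 0 1 x : R)%:E).
  by apply/measurable_EFinP; exact: measurable_normal_pdf.
transitivity (limn (fun n => \int[N]_x (f_ n x)%:E)).
  rewrite -monotone_convergence//.
  - by apply: eq_integral => x _; apply/esym/cvg_lim => //; exact: (cvg_nnsfun_approx _ mf f0D).
  - by move=> n; exact/measurable_EFinP/measurable_funTS.
  - by move=> *; rewrite lee_fin.
  - by move=> x _ m n mn; rewrite lee_fin; exact/lefP/nd_nnsfun_approx.
transitivity (limn (fun n => \int[mu]_x ((f_ n x)%:E * (normal_pdf 0 1 x)%:E))); last first.
  rewrite -monotone_convergence//.
  - apply: eq_integral => x _; apply/cvg_lim => //.
    by apply: cvgeZr => //; exact: (cvg_nnsfun_approx _ mf f0D).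
  - move=> n; apply: emeasurable_funM; last exact: mp.
    by apply/measurable_EFinP.
  - by move=> k y _; rewrite mule_ge0 // lee_fin.
  - move=> x _ m n mn; apply: lee_wpmul2r => //.
    by rewrite lee_fin; exact/lefP/nd_nnsfun_approx.
congr (limn _); apply/funext => n.
under eq_integral do rewrite fimfunE// -fsumEFin//.
transitivity (\int[mu]_x \sum_(y \in range (f_ n)) ((y * \1_(f_ n @^-1` [set y]) x)%:E * (normal_pdf 0 1 x)%:E)); last first.
  apply: eq_integral => x _; rewrite [in RHS]fimfunE// -fsumEFin// ge0_mule_fsuml//.
  by move=> r; rewrite nnfun_muleindic_ge0.
rewrite ge0_integral_fsum//; last 2 first.
- by move=> r; exact/measurable_EFinP/measurableT_comp.
- by move=> r x _; rewrite nnfun_muleindic_ge0.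
rewrite ge0_integral_fsum//; last 2 first.
- move=> r; apply: emeasurable_funM => //.
  exact/measurable_EFinP/measurableT_comp.
- by move=> r x _; rewrite mule_ge0 // nnfun_muleindic_ge0.
apply: eq_fsbigr => r /set_mem [x _ fr].
under eq_integral do rewrite EFinM.
rewrite ge0_integralZl//; last 2 first.
- exact/measurable_EFinP.
- by rewrite lee_fin -fr.
under [RHS]eq_integral do rewrite EFinM -muleA.
rewrite ge0_integralZl//; last 3 first.
- apply: emeasurable_funM => //; exact/measurable_EFinP.
- by move=> y _; rewrite mule_ge0 // lee_fin.
- by rewrite lee_fin -fr.
congr (_ * _); rewrite integral_indic// setIT /normal_prob [LHS]integral_mkcond.
apply: eq_integral => y _; rewrite patchE indicE.
by case: ifP => _; rewrite ?mul1e ?mul0e.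
Qed.

(** The image of Lebesgue measure under a translation agrees with it on half-open intervals, hence
    everywhere. *)
Lemma lebesgue_integral_shift (f : T -> \bar R) (c : R) :
  measurable_fun [set: T] f -> (forall x, 0 <= f x) ->
  \int[mu]_x f (x + c)%R = \int[mu]_x f x.
Proof.
move=> mf f0.
have ms : measurable_fun [set: measurableTypeR R] (fun x : measurableTypeR R => (x + c)%R).
  exact: measurable_funD.
have := @ge0_integral_pushforward _ _ (measurableTypeR R) (measurableTypeR R) R
   (fun x => (x + c)%R) ms mu setT f measurableT mf (fun y _ => f0 y).
rewrite preimage_setT => <-.
apply: eq_measure_integral => A mA _.
(apply: lebesgue_measure_unique || apply/esym/lebesgue_measure_unique) => //= _ [[a b]] _ <-.
rewrite /pushforward /= (_ : _ @^-1` _ = [set` `]a - c, b - c]%R]); last first.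
  by apply/seteqP; split=> x /=; rewrite !in_itv /= ltrBlDr lerBrDr.
rewrite !lebesgue_measure_itv/= !lte_fin ltrD2r; case: ifP => // _.
by rewrite -!EFinB; congr (_%:E); ring.
Qed.

Lemma normal_pdf01E (x : R) : (normal_pdf 0 1 x = (Num.sqrt (pi *+ 2))^-1 * expR (- (x ^+ 2 / 2)) :> R)%R.
Proof.
rewrite normal_pdfE ?oner_neq0 // /normal_peak /normal_fun expr1n mul1r subr0.
by rewrite mulNr.
Qed.

(** The exponential is the ratio of the normal densities at [x + c] and [x]. This one identity
    serves both the shears below and the tail bound. *)
Lemma normal_integral_shift (f : T -> \bar R) (c : R) :
  measurable_fun [set: T] f -> (forall x, 0 <= f x) ->
  \int[N]_x (f (x + c)%R * (expR ((x ^+ 2 - (x + c) ^+ 2) / 2))%:E) = \int[N]_x f x.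
Proof.
move=> mf f0.
have mexp : measurable_fun [set: T] (fun x : R => expR ((x ^+ 2 - (x + c) ^+ 2) / 2)).
  apply: measurableT_comp => //; apply: measurable_funM => //; apply: measurable_funB => //.
  by apply: measurable_funX; exact: measurable_funD.
have mfc : measurable_fun [set: T] (fun x => f (x + c)%R).
  by apply: measurableT_comp => //; exact: measurable_funD.
rewrite !ge0_integral_normal_prob //; last 2 first.
- by apply: emeasurable_funM => //; exact/measurable_EFinP.
- by move=> x; rewrite mule_ge0 // lee_fin expR_ge0.
rewrite -(@lebesgue_integral_shift (fun x => f x * (normal_pdf 0 1 x)%:E) c); last 2 first.
- by apply: emeasurable_funM => //; apply/measurable_EFinP; exact: measurable_normal_pdf.
- by move=> x; rewrite mule_ge0 // lee_fin normal_pdf_ge0.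
apply: eq_integral => x _; rewrite -muleA; congr (_ * _).
rewrite -EFinM !normal_pdf01E; congr (_%:E).
by rewrite mulrCA -expRD; congr (_ * expR _)%R; lra.
Qed.

End normal_integral.

(** * Shears and plane rotations of the Gaussian measure *)

Section gaussian_integral.
Variable R : realType.
Local Notation T := (measurableTypeR R).
Local Notation N := (normal_prob (0 : R) 1).
Local Open Scope ereal_scope.

Lemma measurable_consx n (x : T) : measurable_fun setT (fun t : n.-tuple T => [tuple of x :: t]).
Proof. exact: measurable_cons. Qed.

Lemma measurable_comp_consx n d (T' : measurableType d) (f : n.+1.-tuple T -> T') x :
  measurable_fun setT f -> measurable_fun setT (fun t : n.-tuple T => f [tuple of x :: t]).
Proof. by move=> mf; apply: measurableT_comp => //; exact: measurable_consx. Qed.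

Lemma integral_gaussianS n (f : n.+1.-tuple T -> \bar R) :
  measurable_fun setT f -> (forall x, 0 <= f x) ->
  \int[gaussian R n.+1]_x f x = \int[N]_x \int[gaussian R n]_t f [tuple of x :: t].
Proof.
move=> mf f0; rewrite ge0_integral_distribution //.
apply: (etrans (@fubini_tonelli1 _ _ _ _ _ _ _ (f \o @cons_pair R n) _ _)) => //.
  by apply: measurableT_comp => //; exact: measurable_cons_pair.
by move=> x; exact: f0.
Qed.

Lemma integral_gaussianS_swap n (f : n.+1.-tuple T -> \bar R) :
  measurable_fun setT f -> (forall x, 0 <= f x) ->
  \int[gaussian R n.+1]_x f x = \int[gaussian R n]_t \int[N]_x f [tuple of x :: t].
Proof.
move=> mf f0; rewrite ge0_integral_distribution //.
apply: (etrans (@fubini_tonelli2 _ _ _ _ _ _ _ (f \o @cons_pair R n) _ _)) => //.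
  by apply: measurableT_comp => //; exact: measurable_cons_pair.
by move=> x; exact: f0.
Qed.

Definition setc n (x : n.-tuple T) (p : 'I_n) (v : T) : n.-tuple T :=
  [tuple if i == p then v else tnth x i | i < n].

Lemma tnth_setc n (x : n.-tuple T) p v i : tnth (setc x p v) i = if i == p then v else tnth x i.
Proof. by rewrite tnth_mktuple. Qed.

Lemma setc_cons0 n x (t : n.-tuple T) v : setc [tuple of x :: t] ord0 v = [tuple of v :: t].
Proof.
apply: eq_from_tnth => i; rewrite tnth_setc.
by case: (unliftP ord0 i) => [j ->|->] //; rewrite eq_sym (negbTE (neq_lift _ _)) !tnthS.
Qed.

Lemma setc_consS n x (t : n.-tuple T) p v :
  setc [tuple of x :: t] (lift ord0 p) v = [tuple of x :: setc t p v].
Proof.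
apply: eq_from_tnth => i; rewrite tnth_setc.
case: (unliftP ord0 i) => [j ->|->]; last by rewrite (negbTE (neq_lift _ _)) !tnth0.
by rewrite !tnthS tnth_setc (inj_eq (@lift_inj _ _)).
Qed.

Lemma measurable_setc n p (g : n.-tuple T -> T) : measurable_fun setT g ->
  measurable_fun setT (fun x => setc x p (g x)).
Proof.
move=> mg; apply/measurable_fun_tnthP => i.
apply: (eq_measurable_fun (fun x => if i == p then g x else tnth x i)).
  by move=> x _ /=; rewrite tnth_setc.
by have [_|_] := eqVneq i p; [exact: mg|exact: measurable_tnth].
Qed.

Definition shear n p (g : n.-tuple T -> T) (x : n.-tuple T) := setc x p (tnth x p + g x)%R.

(* A shear preserves Lebesgue measure, so it transports the Gaussian density up
   to the exponential factor. *)
Lemma gaussian_shear n p (g : n.-tuple T -> T) (f : n.-tuple T -> \bar R) :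
  measurable_fun setT g -> (forall x v, g (setc x p v) = g x) ->
  measurable_fun setT f -> (forall x, 0 <= f x) ->
  \int[gaussian R n]_x (f (shear p g x) *
     (expR ((tnth x p ^+ 2 - (tnth x p + g x) ^+ 2) / 2))%:E) =
  \int[gaussian R n]_x f x.
Proof.
elim: n p g f => [|n IHn] p g f mg gp mf f0; first by case: p gp.
have msh : measurable_fun setT (fun x : n.+1.-tuple T => (tnth x p + g x)%R).
  by apply: measurable_funD => //; exact: measurable_tnth.
have mF : measurable_fun setT (fun x => f (shear p g x) *
     (expR ((tnth x p ^+ 2 - (tnth x p + g x) ^+ 2) / 2))%:E).
  apply: emeasurable_funM.
    by apply: measurableT_comp => //; exact: measurable_setc.
  apply/measurable_EFinP/measurableT_comp => //; apply: measurable_funM => //.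
  apply: measurable_funB; last exact: measurable_funX.
  by apply: measurable_funX; exact: measurable_tnth.
have F0 x : 0 <= f (shear p g x) *
     (expR ((tnth x p ^+ 2 - (tnth x p + g x) ^+ 2) / 2))%:E.
  by rewrite mule_ge0 // lee_fin expR_ge0.
case: (unliftP ord0 p) gp msh mF F0 => [q ->|->] gp msh mF F0.
  rewrite (integral_gaussianS mF F0) (integral_gaussianS mf f0); apply: eq_integral => x _.
  refine (etrans _ (IHn q (fun t => g [tuple of x :: t]) (fun t => f [tuple of x :: t]) _ _ _ _)).
  - by apply: eq_integral => t _; rewrite /shear setc_consS tnthS.
  - exact: measurable_comp_consx.
  - by move=> t v; rewrite -(setc_consS x t q v) gp.
  - exact: measurable_comp_consx.
  - by move=> t; exact: f0.
rewrite (integral_gaussianS_swap mF F0) (integral_gaussianS_swap mf f0); apply: eq_integral => t _.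
have gE x : g [tuple of x :: t] = g [tuple of 0%R :: t].
  by rewrite -(gp [tuple of 0%R :: t] x) setc_cons0.
refine (etrans _ (@normal_integral_shift R (fun x => f [tuple of x :: t]) (g [tuple of 0%R :: t]) _ _)).
- by apply: eq_integral => x _; rewrite /shear setc_cons0 tnth0 gE.
- apply: measurableT_comp => //.
  by apply: (@measurable_cons _ _ _ _ (fun x : T => x) n (fun=> t)).
- by move=> x; exact: f0.
Qed.

Definition rotate n (p q : 'I_n) (c s : R) (x : n.-tuple T) : n.-tuple T :=
  setc (setc x p (c * tnth x p - s * tnth x q)%R) q (s * tnth x p + c * tnth x q)%R.

(** A plane rotation is a product of three shears with parameters [-t], [s], [-t], where
    [t = s / (1 + c)] is the tangent of the half angle; this is the origin of [1 + c != 0]. Only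
    one-dimensional changes of variables are then required. *)
Lemma gaussian_rotate n (p q : 'I_n) (c s : R) (B : set (n.-tuple T)) :
  p != q -> (c ^+ 2 + s ^+ 2 = 1)%R -> (1 + c != 0)%R -> measurable B ->
  gaussian R n (rotate p q c s @^-1` B) = gaussian R n B.
Proof.
move=> pq cs1 c1 mB.
pose t := (s / (1 + c))%R.
pose gx (x : n.-tuple T) : T := (- t * tnth x q)%R.
pose gy (x : n.-tuple T) : T := (s * tnth x p)%R.
have mgx : measurable_fun setT gx by apply: measurable_funM => //; exact: measurable_tnth.
have mgy : measurable_fun setT gy by apply: measurable_funM => //; exact: measurable_tnth.
have gxp x v : gx (setc x p v) = gx x by rewrite /gx tnth_setc eq_sym (negbTE pq).
have gyq x v : gy (setc x q v) = gy x by rewrite /gy tnth_setc (negbTE pq).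
have rotE x : rotate p q c s x = shear p gx (shear q gy (shear p gx x)).
  have e1 : (s ^+ 2 = (1 - c) * (1 + c))%R by rewrite -[LHS](addKr (c ^+ 2)%R) cs1; ring.
  have e2 : (s * t = 1 - c)%R by rewrite /t mulrA -expr2 e1 mulfK.
  have e3 : (t * (1 + c) = s)%R by rewrite /t divfK.
  apply: eq_from_tnth => i; rewrite /rotate /shear /gx /gy !tnth_setc !eqxx.
  rewrite (negbTE pq) (eq_sym q p) (negbTE pq).
  have [->|ip] := eqVneq i p; last first.
    have [_|//] := eqVneq i q.
    transitivity ((s * tnth x p + (1 - s * t) * tnth x q)%R); last by ring.
    by rewrite e2; ring.
  rewrite (negbTE pq).
  transitivity ((1 - s * t) * tnth x p - t * (1 + (1 - s * t)) * tnth x q)%R; last by ring.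
  by rewrite e2 (_ : 1 + (1 - (1 - c)) = 1 + c)%R ?e3; ring.
pose w p0 (g : n.-tuple T -> T) (x : n.-tuple T) : R :=
  expR ((tnth x p0 ^+ 2 - (tnth x p0 + g x) ^+ 2) / 2).
have msh p0 g : measurable_fun setT g -> measurable_fun setT (shear p0 g).
  move=> mg; apply: measurable_setc; apply: measurable_funD => //; exact: measurable_tnth.
have mw p0 g : measurable_fun setT g -> measurable_fun setT (fun x => (w p0 g x)%:E).
  move=> mg; apply/measurable_EFinP/measurableT_comp => //; apply: measurable_funM => //.
  apply: measurable_funB; apply: measurable_funX; first exact: measurable_tnth.
  by apply: measurable_funD => //; exact: measurable_tnth.
have w0 p0 g x : 0 <= (w p0 g x)%:E by rewrite lee_fin expR_ge0.
pose f0 (x : n.-tuple T) : \bar R := (\1_B x)%:E.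
have mf0 : measurable_fun setT f0 by exact/measurable_EFinP.
have f00 x : 0 <= f0 x by rewrite lee_fin.
pose f1 x := f0 (shear p gx x) * (w p gx x)%:E.
have mf1 : measurable_fun setT f1.
  by apply: emeasurable_funM; [apply: measurableT_comp => //; exact: msh|exact: mw].
have f10 x : 0 <= f1 x by rewrite mule_ge0.
pose f2 x := f1 (shear q gy x) * (w q gy x)%:E.
have mf2 : measurable_fun setT f2.
  by apply: emeasurable_funM; [apply: measurableT_comp => //; exact: msh|exact: mw].
have f20 x : 0 <= f2 x by rewrite mule_ge0.
have mrot : measurable_fun setT (rotate p q c s).
  rewrite (_ : rotate p q c s = shear p gx \o (shear q gy \o shear p gx)).
    by apply: measurableT_comp; [exact: msh|apply: measurableT_comp; exact: msh].
  by apply/funext => x; rewrite rotE.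
have mrB : measurable (rotate p q c s @^-1` B) by rewrite -[X in measurable X]setTI; exact: mrot.
have i0 : \int[gaussian R n]_x f0 x = gaussian R n B by rewrite integral_indic // setIT.
rewrite -i0 -(gaussian_shear mgx gxp mf0 f00) -/f1.
rewrite -(gaussian_shear mgy gyq mf1 f10) -/f2.
rewrite -(gaussian_shear mgx gxp mf2 f20).
transitivity (\int[gaussian R n]_x (\1_(rotate p q c s @^-1` B) x)%:E).
  by rewrite integral_indic // setIT.
apply: eq_integral => x _; rewrite /f2 /f1 /f0 -!muleA -!EFinM /w -!expRD.
(* The three density ratios telescope to the exponential of half the difference of the squared norms
   before and after the rotation, which is 0. *)
rewrite (_ : expR _ = 1)%R; last first.
  rewrite -[RHS]expR0; congr expR.
  have E y : [tuple tnth y i | i < n] = y by apply: eq_from_tnth => i; rewrite tnth_mktuple.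
  have rp : (tnth (rotate p q c s x) p = c * tnth x p - s * tnth x q)%R.
    by rewrite !tnth_setc (negbTE pq) eqxx.
  have rq : (tnth (rotate p q c s x) q = s * tnth x p + c * tnth x q)%R.
    by rewrite !tnth_setc eqxx.
  move: rp rq; rewrite rotE /shear !tnth_setc !eqxx (negbTE pq) (eq_sym q p) (negbTE pq).
  set g1 := gx x; set x1 := setc _ _ _; set g2 := gy x1; set x2 := setc _ _ _.
  move=> -> ->.
  suff : (tnth x p ^+ 2 + tnth x q ^+ 2 =
    (c * tnth x p - s * tnth x q) ^+ 2 + (s * tnth x p + c * tnth x q) ^+ 2)%R by lra.
  transitivity ((c ^+ 2 + s ^+ 2) * (tnth x p ^+ 2 + tnth x q ^+ 2))%R; last by ring.
  by rewrite cs1 mul1r.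
by rewrite mulr1 -rotE !indicE.
Qed.

End gaussian_integral.

(** * One-dimensional estimates *)

Section normal_bounds.
Variable R : realType.
Local Notation mu := (@lebesgue_measure R).
Local Notation T := (measurableTypeR R).
Local Notation N := (normal_prob (0 : R) 1).

Definition Z2pi : R := Num.sqrt (pi *+ 2).

Lemma Z2pi_ge2 : 2 <= Z2pi.
Proof.
rewrite /Z2pi -[leLHS]ger0_norm // -sqrtr_sqr ler_wsqrtr // -mulr_natl.
by have := @pi_ge2 R; lra.
Qed.

Lemma Z2pi_le3 : Z2pi <= 3.
Proof.
rewrite /Z2pi -[leRHS]ger0_norm // -[leRHS]sqrtr_sqr ler_wsqrtr // -mulr_natl.
by have := pihalf_lt2 R; lra.
Qed.

Lemma Z2pi_gt0 : 0 < Z2pi. Proof. by have := Z2pi_ge2; lra. Qed.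

Lemma pdfE (x : R) : normal_pdf 0 1 x = Z2pi^-1 * expR (- (x ^+ 2 / 2)).
Proof. exact: normal_pdf01E. Qed.

Lemma expRN_le1 (x : R) : 0 <= x -> expR (- x) <= 1.
Proof. by move=> x0; rewrite -expR0 ler_expR; lra. Qed.

Lemma pdf_le1 (x : R) : normal_pdf 0 1 x <= 1.
Proof.
rewrite pdfE mulrC ler_pdivrMr ?Z2pi_gt0 // mul1r.
apply: le_trans (_ : 1 <= _); last by have := Z2pi_ge2; lra.
by apply: expRN_le1; rewrite divr_ge0 // sqr_ge0.
Qed.

Lemma measurable_pdf : measurable_fun [set: T] (fun x : T => (normal_pdf 0 1 x : R)%:E).
Proof. by apply/measurable_EFinP; exact: measurable_normal_pdf. Qed.

Lemma normal_le_lebesgue (A : set T) : measurable A -> (N A <= mu A)%E.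
Proof.
move=> mA; rewrite /normal_prob; apply: (@le_trans _ _ (\int[mu]_(x in A) (cst 1%E x))%E).
  apply: ge0_le_integral => //=.
  - by move=> x _; rewrite lee_fin normal_pdf_ge0.
  - exact: (measurable_funS measurableT (@subsetT _ _) measurable_pdf).
  - by move=> x _; rewrite lee_fin pdf_le1.
by rewrite integral_cst // mul1e.
Qed.

Lemma normal_itv (x y : R) : x <= y -> (N `[x, y]%classic <= (y - x)%:E)%E.
Proof.
move=> xy; apply: le_trans (normal_le_lebesgue _) _ => //.
rewrite lebesgue_measure_itv /= lte_fin; case: ifP => _ //.
by rewrite lee_fin subr_ge0.
Qed.

Definition prN (A : set T) : R := fine (N A).

Lemma prNE (A : set T) : measurable A -> (prN A)%:E = N A.
Proof. by move=> mA; rewrite /prN fineK // fin_num_measure. Qed.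

Lemma prN_ge0 A : 0 <= prN A. Proof. exact: fine_ge0. Qed.

(** Markov's inequality for the density ratio of the shift by [c]: its integral is 1, and on [A] it
    is at least [expR (B ^+ 2 / 2)], hence at least [B ^+ 2 / 2]. *)
Lemma normal_tail (c B : R) (A : set T) : measurable A -> 0 < B -> `|c| = B ->
  (forall x, A x -> c * x <= - B ^+ 2) -> prN A <= 2 / B ^+ 2.
Proof.
move=> mA B0 cB Ac.
have c2 : c ^+ 2 = B ^+ 2 by rewrite -cB -normrX ger0_norm ?sqr_ge0.
have B2 : 0 < B ^+ 2 by rewrite exprn_gt0.
have h := @normal_integral_shift R (fun=> 1%E) c (@measurable_cst _ _ _ _ _ _) (fun _ => lee01).
have NT : N [set: T] = 1%E by exact: probability_setT.
have I1 : (\int[N]_x 1 = 1)%E by apply: (etrans (integral_cst _ _ _)) => //; rewrite mul1e; exact: NT.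
rewrite I1 in h.
have mexp : measurable_fun [set: T] (fun x : T => (expR ((x ^+ 2 - (x + c) ^+ 2) / 2))%:E).
  apply/measurable_EFinP; apply: measurableT_comp => //; apply: measurable_funM => //.
  by apply: measurable_funB => //; apply: measurable_funX; exact: measurable_funD.
have : ((B ^+ 2 / 2)%:E * N A <= 1)%E.
  have iA : (\int[N]_x (\1_A x)%:E = N A)%E by rewrite integral_indic // setIT.
  rewrite -h -iA -ge0_integralZl //; last 2 first.
  - exact/measurable_EFinP.
  - by rewrite lee_fin divr_ge0 // ltW.
  - apply: ge0_le_integral => //.
    + by move=> x _; rewrite mule_ge0 // lee_fin divr_ge0 // ltW.
    + by apply: emeasurable_funM => //; exact/measurable_EFinP.
    + apply: (eq_measurable_fun (fun x : T => (expR ((x ^+ 2 - (x + c) ^+ 2) / 2))%:E)) => //.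
      by move=> x _; rewrite mul1e.
    move=> x _; rewrite mul1e -EFinM lee_fin indicE; case: (boolP (x \in A)) => xA; last first.
      by rewrite mulr0 expR_ge0.
    rewrite mulr1; apply: le_trans (_ : expR (B ^+ 2 / 2) <= _).
      by have := expR_ge1Dx (B ^+ 2 / 2); lra.
    rewrite ler_expR; have := Ac x (set_mem xA).
    have -> : x ^+ 2 - (x + c) ^+ 2 = - (2 * (c * x)) - B ^+ 2 by rewrite -c2; ring.
    lra.
rewrite -prNE // -EFinM lee_fin => h1.
rewrite ler_pdivlMr // mulrC; lra.
Qed.

Lemma expR_lip (u v : R) : 0 <= u -> 0 <= v -> `|expR (- u) - expR (- v)| <= `|u - v|.
Proof.
wlog uv : u v / u <= v.
  by move=> h u0 v0; case: (leP u v) => [|/ltW] le; [exact: h|rewrite distrC (distrC u); exact: h].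
move=> u0 v0; rewrite ger0_norm ?subr_ge0 ?ler_expR ?lerN2 // (distrC u) ger0_norm ?subr_ge0 //.
have -> : expR (- v) = expR (- u) * expR (- (v - u)) by rewrite -expRD; congr expR; lra.
have e1 := expR_ge1Dx (- (v - u)).
have e2 : expR (- (v - u)) <= 1 by apply: expRN_le1; lra.
have e3 : 0 <= expR (- u) <= 1 by rewrite expR_ge0 expRN_le1.
nra.
Qed.

(** With [v = u / m], both bases lie in [0, 1] and differ by at most [v ^+ 2], so their [m]-th
    powers differ by at most [m * v ^+ 2], by telescoping. *)
Lemma expR_pow_approx (u : R) (m : nat) : (0 < m)%N -> 0 <= u -> u <= m%:R ->
  `|expR (- u) - (1 - u / m%:R) ^+ m| <= u ^+ 2 / m%:R.
Proof.
move=> m0 u0 um; have m0' : 0 < m%:R :> R by rewrite ltr0n.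
pose v := u / m%:R; have v0 : 0 <= v by rewrite divr_ge0.
have v1 : v <= 1 by rewrite ler_pdivrMr // mul1r.
have ev : expR (- u) = expR (- v) ^+ m.
  rewrite -expRM_natl; congr expR; rewrite /v; field; by rewrite gt_eqF.
have e1 : 1 - v <= expR (- v) by have := expR_ge1Dx (- v); lra.
have e2 : expR (- v) <= 1 - v + v ^+ 2.
  have h : 1 + v <= expR v by exact: expR_ge1Dx.
  have hp : 0 < expR v by exact: expR_gt0.
  rewrite expRN -(ler_pM2r hp) mulVf ?gt_eqF //.
  have : 0 <= 1 - v + v ^+ 2 by nra.
  nra.
have e3 : expR (- v) <= 1 by exact: expRN_le1.
have w0 : 0 <= 1 - v by rewrite subr_ge0.
have tel k : 0 <= expR (- v) ^+ k - (1 - v) ^+ k <= k%:R * v ^+ 2.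
  elim: k => [|k /andP[IH1 IH2]]; first by rewrite !expr0 subrr mul0r lexx.
  have a1 : 0 <= (1 - v) ^+ k <= 1 by rewrite exprn_ge0 // exprn_ile1 //; lra.
  have ev0 : 0 <= expR (- v) by exact: expR_ge0.
  have -> : expR (- v) ^+ k.+1 - (1 - v) ^+ k.+1 =
    expR (- v) * (expR (- v) ^+ k - (1 - v) ^+ k) + (expR (- v) - (1 - v)) * (1 - v) ^+ k.
    by rewrite !exprS; ring.
  have b1 : 0 <= expR (- v) * (expR (- v) ^+ k - (1 - v) ^+ k) by rewrite mulr_ge0.
  have b2 : expR (- v) * (expR (- v) ^+ k - (1 - v) ^+ k) <= expR (- v) ^+ k - (1 - v) ^+ k.
    by rewrite ler_piMl.
  have b3 : 0 <= (expR (- v) - (1 - v)) * (1 - v) ^+ k <= v ^+ 2.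
    move: a1 => /andP[a1 a2]; rewrite mulr_ge0 ?subr_ge0 //=.
    apply: le_trans (_ : expR (- v) - (1 - v) <= _); last by lra.
    by rewrite ler_piMr // subr_ge0.
  rewrite -natr1; lra.
rewrite ev -/v ger0_norm; last by case/andP: (tel m).
case/andP: (tel m) => _ h; apply: le_trans h _.
have -> : m%:R * v ^+ 2 = u ^+ 2 / m%:R by rewrite /v; field; rewrite gt_eqF.
exact: lexx.
Qed.

(** Completing the square turns the condition into [|(y - y0)^2 - e| <= r^2], which confines [y] to
    two intervals of half-width [r] around [y0 + w] and [y0 - w], where [w] is the square root of
    [e]; the normal density is at most 1. *)
Lemma quad_anticonc (l m c d : R) : l != 0 -> 0 <= d ->
  prN [set y : T | `|l * y ^+ 2 + m * y + c| <= d] <= 4 * Num.sqrt (d / `|l|).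
Proof.
move=> l0 d0; pose r := Num.sqrt (d / `|l|).
have l1 : 0 < `|l| by rewrite normr_gt0.
have dl0 : 0 <= d / `|l| by rewrite divr_ge0.
have r0 : 0 <= r by exact: sqrtr_ge0.
pose y0 := - (m / (2 * l)); pose e := y0 ^+ 2 - c / l; pose w := Num.sqrt e.
have w0 : 0 <= w by exact: sqrtr_ge0.
have sub : [set y : T | `|l * y ^+ 2 + m * y + c| <= d] `<=`
    `[y0 + w - r, y0 + w + r]%classic `|` `[y0 - w - r, y0 - w + r]%classic.
  move=> y /= yd.
  have ye : l * y ^+ 2 + m * y + c = l * ((y - y0) ^+ 2 - e) by rewrite /e /y0; field.
  have {}yd : `|(y - y0) ^+ 2 - e| <= r ^+ 2.
    by rewrite /r sqr_sqrtr // ler_pdivlMr // mulrC -normrM -ye.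
  have yw : `|(`|y - y0| - w)| <= r.
    have u0 : 0 <= `|y - y0| by [].
    have : `|(`|y - y0| ^+ 2 - w ^+ 2)| <= r ^+ 2.
      rewrite -normrX (ger0_norm (sqr_ge0 _)); case: (leP 0 e) => e0.
        by rewrite /w sqr_sqrtr.
      (* [Num.sqrt] is 0 on negative numbers, so the two intervals coincide when [e < 0]. *)
      rewrite /w (ler0_sqrtr (ltW e0)) expr0n /= subr0 ger0_norm ?sqr_ge0 //.
      by move: yd; rewrite ler_norml => /andP[_]; lra.
    move: (`|y - y0|) u0 w r w0 r0 {ye yd} => u u0 w r w0 r0; rewrite !ler_norml => /andP[h1 h2].
    apply/andP; split; rewrite leNgt; apply/negP => h.
      have : 0 < (w - u - r) * (w + u) by rewrite mulr_gt0; lra.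
      have : 0 <= r * (w + u - r) by rewrite mulr_ge0; lra.
      by move: h1; lra.
    have : 0 < (u - w - r) * (w + u) by rewrite mulr_gt0; lra.
    have : 0 <= r * (w + u - r) by rewrite mulr_ge0; lra.
    by move: h2; lra.
  move: yw; rewrite /= !in_itv /=; case: (ger0P (y - y0)) => h; rewrite ler_norml => /andP[h1 h2].
    by left; apply/andP; split; lra.
  by right; apply/andP; split; lra.
have mset : measurable [set y : T | `|l * y ^+ 2 + m * y + c| <= d].
  rewrite -[X in measurable X]setTI.
  apply: (@measurable_fun_le _ _ _ setT (fun y : T => `|l * y ^+ 2 + m * y + c|) (cst d)) => //.
  apply: measurableT_comp => //; apply: continuous_measurable_fun => y.
  by apply: cvgD; [apply: cvgD; (apply: cvgM; [exact: cvg_cst|])|exact: cvg_cst]; [exact: exprn_continuous|exact: cvg_id].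
rewrite -lee_fin prNE //.
apply: le_trans (le_measure _ _ _ sub) _; rewrite ?inE //; first exact: measurableU.
apply: le_trans (measureU2 _ _ _) _ => //.
have i1 : (N `[(y0 + w - r)%R, (y0 + w + r)%R]%classic <= (r + r)%:E)%E.
  by apply: le_trans (normal_itv _) _; rewrite ?lee_fin; lra.
have i2 : (N `[(y0 - w - r)%R, (y0 - w + r)%R]%classic <= (r + r)%:E)%E.
  by apply: le_trans (normal_itv _) _; rewrite ?lee_fin; lra.
by apply: le_trans (leeD i1 i2) _; rewrite -EFinD lee_fin -/r; lra.
Qed.

Lemma lin_anticonc (s : R) (A : set T) : measurable A -> 0 <= s -> 
  (forall y z, A y -> A z -> `|y - z| <= s) -> prN A <= 2 * s.
Proof.
move=> mA s0 Ad; case: (pselect (exists y, A y)) => [[y Ay]|nA]; last first.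
  rewrite (_ : A = set0) /prN ?measure0 /= ?mulr_ge0 //.
  by apply/seteqP; split=> // y Ay; case: nA; exists y.
rewrite -lee_fin prNE //; apply: (@le_trans _ _ (N `[y - s, y + s]%classic)).
  apply: le_measure; rewrite ?inE // => z Az /=; rewrite in_itv /=.
  by have := Ad z y Az Ay; rewrite ler_norml => /andP[h1 h2]; apply/andP; split; lra.
apply: le_trans (normal_itv _) _; first lra.
rewrite lee_fin; lra.
Qed.

End normal_bounds.

(** * Structured programs on the random access machine *)

(** [HG] reads a cell of a virtual array, while [HI] reads a raw machine address; only the latter
    reaches the input. *)
Inductive hexp : Type :=
| HC of int
| HG of nat & hexp
| HI of hexp
| HAdd of hexp & hexp
| HSub of hexp & hexp.

Inductive cmd : Type :=
| CSkip
| CSet of nat & hexp & hexp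
| CSeq of cmd & cmd
| CIf of hexp & cmd & cmd
| CLoop of nat & cmd.

Definition state := nat -> int -> int.

Definition put (s : state) (k : nat) (i v : int) : state :=
  fun k' => if k' == k then (fun j => if j == i then v else s k j) else s k'.

(* Cell [i] of array [k < 64] lives at address [- (64 i + k + 1)]; this is a
   bijection between [0, 64) x Z and Z, so that arrays never overlap. *)
Definition addr (k : nat) (i : int) : int := - (64 * i + k%:Z + 1).
Definition cls (a : int) : nat := `|((- a - 1) %% 64)%Z|%N.
Definition idx (a : int) : int := ((- a - 1) %/ 64)%Z.

(** Array cells of nonnegative index lie at negative addresses. The input and output cells, at
    addresses 0, 1, 2, ..., are therefore array cells of negative index, which the computations
    never write. *)
Definition mem_of (s : state) : memory := fun z => s (cls z) (idx z).

Fixpoint heval (s : state) (e : hexp) : int :=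
  match e with
  | HC z => z
  | HG k e1 => s k (heval s e1)
  | HI e1 => mem_of s (heval s e1)
  | HAdd e1 e2 => heval s e1 + heval s e2
  | HSub e1 e2 => heval s e1 - heval s e2
  end.

(** Every loop runs exactly [X] rounds, where [X] is kept in register [XR]. The semantics is thus a
    total function, and the time bound requires no knowledge of what the program computes. *)
Fixpoint sem (X : nat) (c : cmd) (s : state) : state :=
  match c with
  | CSkip => s
  | CSet k i e => put s k (heval s i) (heval s e)
  | CSeq c1 c2 => sem X c2 (sem X c1 s)
  | CIf e c1 c2 => if 0 < heval s e then sem X c1 s else sem X c2 s
  | CLoop k c1 =>
      iteri X (fun i s' => put (sem X c1 s') k 0 i.+1%:Z) (put s k 0 0)
  end.

Fixpoint writes (c : cmd) : seq nat :=
  match c with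
  | CSkip => [::]
  | CSet k _ _ => [:: k]
  | CSeq c1 c2 | CIf _ c1 c2 => writes c1 ++ writes c2
  | CLoop k c1 => k :: writes c1
  end.

Notation XR := 0%N.

Fixpoint hok (e : hexp) : bool :=
  match e with
  | HC _ => true
  | HG k e1 => (k < 64)%N && hok e1
  | HI e1 => hok e1
  | HAdd e1 e2 | HSub e1 e2 => hok e1 && hok e2
  end.

(** These conditions make the while loops agree with [sem]: array 0, which holds the bound, is never
    written, and a loop body leaves its counter alone. *)
Fixpoint wf (c : cmd) : bool :=
  match c with
  | CSkip => true
  | CSet k i e => [&& (0 < k < 64)%N, hok i & hok e]
  | CSeq c1 c2 => wf c1 && wf c2
  | CIf e c1 c2 => [&& hok e, wf c1 & wf c2]
  | CLoop k c1 => [&& (0 < k < 64)%N, k \notin writes c1 & wf c1]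
  end.

Definition dbl (e : expr) := Plus e e.
Definition addrE (k : nat) (e : expr) : expr :=
  Minus (Const (- (k%:Z + 1))) (dbl (dbl (dbl (dbl (dbl (dbl e)))))).

Fixpoint cexp (e : hexp) : expr :=
  match e with
  | HC z => Const z
  | HG k e1 => Cell (addrE k (cexp e1))
  | HI e1 => Cell (cexp e1)
  | HAdd e1 e2 => Plus (cexp e1) (cexp e2)
  | HSub e1 e2 => Minus (cexp e1) (cexp e2)
  end.

Definition Reg (k : nat) : expr := Cell (addrE k (Const 0)).

Fixpoint compile (c : cmd) : program :=
  match c with
  | CSkip => Skip
  | CSet k i e => Store (addrE k (cexp i)) (cexp e)
  | CSeq c1 c2 => Seq (compile c1) (compile c2)
  | CIf e c1 c2 => IfPos (cexp e) (compile c1) (compile c2)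
  | CLoop k c1 =>
      Seq (Store (addrE k (Const 0)) (Const 0))
        (WhilePos (Minus (Reg XR) (Reg k))
           (Seq (compile c1)
              (Store (addrE k (Const 0)) (Plus (Reg k) (Const 1)))))
  end.

(** An upper bound: both branches of a test are charged. The constant 2000 generously covers the
    bookkeeping of a round, whose addresses unfold into 64 copies of an index through six
    doublings. *)
Fixpoint steps (X : nat) (c : cmd) : nat :=
  match c with
  | CSkip => 1
  | CSet k i e => (cost (addrE k (cexp i)) + cost (cexp e)).+1
  | CSeq c1 c2 => steps X c1 + steps X c2
  | CIf e c1 c2 => (cost (cexp e) + (steps X c1 + steps X c2)).+1
  | CLoop k c1 => X * (steps X c1 + 2000) + 2000
  end.

(** * Correctness and running time of the compiled programs *)

Lemma cls_addr k i : (k < 64)%N -> cls (addr k i) = k.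
Proof. by rewrite /cls /addr => k64; lia. Qed.

Lemma idx_addr k i : (k < 64)%N -> idx (addr k i) = i.
Proof. by rewrite /idx /addr => k64; lia. Qed.

Lemma cls_lt z : (cls z < 64)%N.
Proof. by rewrite /cls; lia. Qed.

Lemma addr_cls_idx z : addr (cls z) (idx z) = z.
Proof. by rewrite /addr /cls /idx; lia. Qed.

Lemma mem_ofE s k i : (k < 64)%N -> mem_of s (addr k i) = s k i.
Proof. by move=> k64; rewrite /mem_of cls_addr // idx_addr. Qed.

Lemma upd_mem_of s k i v : (k < 64)%N ->
  upd (mem_of s) (addr k i) v = mem_of (put s k i v).
Proof.
move=> k64; apply/funext => z; rewrite /upd /mem_of /put.
case: (eqVneq z (addr k i)) => [->|zN].
  by rewrite cls_addr // idx_addr // !eqxx.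
case: eqP => // ck; case: eqP => [ik|_]; last by rewrite ck.
by move: zN; rewrite -ck -ik addr_cls_idx eqxx.
Qed.

Lemma eval_addrE M k e : Defs.eval M (addrE k e) = addr k (Defs.eval M e).
Proof. by rewrite /addrE /dbl /= /addr; lia. Qed.

Lemma eval_Cell M e : Defs.eval M (Cell e) = M (Defs.eval M e).
Proof. by []. Qed.

Lemma eval_get s k e : (k < 64)%N ->
  Defs.eval (mem_of s) (Cell (addrE k e)) = s k (Defs.eval (mem_of s) e).
Proof. by move=> k64; rewrite eval_Cell eval_addrE mem_ofE. Qed.

Lemma eval_Reg s k : (k < 64)%N -> Defs.eval (mem_of s) (Reg k) = s k 0.
Proof. by move=> k64; rewrite /Reg eval_get. Qed.

Lemma eval_cexp s e : hok e -> Defs.eval (mem_of s) (cexp e) = heval s e.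
Proof.
elim: e => //.
- by move=> k e IH /andP[k64 /IH {}IH]; rewrite [cexp _]/= eval_get // IH.
- by move=> e IH /IH /= ->.
- by move=> e1 IH1 e2 IH2 /andP[/IH1 h1 /IH2 h2]; rewrite /= h1 h2.
- by move=> e1 IH1 e2 IH2 /andP[/IH1 h1 /IH2 h2]; rewrite /= h1 h2.
Qed.

Lemma put_same s k i v : put s k i v k i = v.
Proof. by rewrite /put !eqxx. Qed.

Lemma put_neq s k i v k' : k' != k -> put s k i v k' = s k'.
Proof. by rewrite /put => /negbTE ->. Qed.

Ltac sput := with_strategy opaque [put] (repeat match goal with
  |- context [put ?s ?k ?i ?v ?k' ?j] =>
    let b := eval vm_compute in (eqn k' k) in
    lazymatch b with
    | false => rewrite (@put_neq s k i v k' isT)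
    | true => constr_eq i j; rewrite (@put_same s k i v)
    end
  end).

Lemma put_idx s k i v j : j != i -> put s k i v k j = s k j.
Proof. by rewrite /put eqxx => /negbTE ->. Qed.

Lemma put_out s k i v k' j : j != i -> put s k i v k' j = s k' j.
Proof. by move=> ji; rewrite /put; case: eqP => // ->; rewrite (negbTE ji). Qed.

Lemma frame X c s k : k \notin writes c -> sem X c s k = s k.
Proof.
elim: c s k => //=.
- by move=> k0 i e s k; rewrite inE => kk0; rewrite put_neq.
- move=> c1 IH1 c2 IH2 s k; rewrite mem_cat negb_or => /andP[k1 k2].
  by rewrite IH2 // IH1.
- move=> e c1 IH1 c2 IH2 s k; rewrite mem_cat negb_or => /andP[k1 k2].
  by case: ifP => _; [exact: IH1|exact: IH2].
- move=> k0 c IH s k; rewrite inE negb_or => /andP[kk0 kc].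
  suff : forall m, iteri m (fun i s' => put (sem X c s') k0 0 i.+1%:Z)
    (put s k0 0 0) k = s k by apply.
  by elim=> [|m IHm] /=; rewrite put_neq // IH.
Qed.

Lemma writes_gt0 c : wf c -> 0%N \notin writes c.
Proof.
elim: c => //=.
- by move=> k i e /and3P[/andP[k0 _] _ _]; rewrite inE; lia.
- by move=> c1 IH1 c2 IH2 /andP[/IH1 h1 /IH2 h2]; rewrite mem_cat negb_or h1.
- by move=> e c1 IH1 c2 IH2 /and3P[_ /IH1 h1 /IH2 h2]; rewrite mem_cat negb_or h1.
- by move=> k c IH /and3P[/andP[k0 _] _ /IH h]; rewrite inE negb_or h andbT; lia.
Qed.

Lemma compile_exec X c s : wf c -> s XR 0 = X%:Z ->
  exists2 t, exec (compile c) (mem_of s) t (mem_of (sem X c s)) & (t <= steps X c)%N.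
Proof.
elim: c s => [|k i e|c1 IH1 c2 IH2|e c1 IH1 c2 IH2|k c IH] s /=.
- by exists 1%N => //; constructor.
- move=> /and3P[/andP[_ k64] hi he] sX.
  eexists; last by apply: leqnn.
  have := ExecStore (addrE k (cexp i)) (cexp e) (mem_of s).
  by rewrite eval_addrE !eval_cexp // upd_mem_of.
- move=> /andP[w1 w2] sX.
  have [t1 e1 l1] := IH1 s w1 sX.
  have [|t2 e2 l2] := IH2 (sem X c1 s) w2; first by rewrite frame ?writes_gt0.
  by exists (t1 + t2)%N; [apply: ExecSeq e1 e2|lia].
- move=> /and3P[he w1 w2] sX.
  have [t1 e1 l1] := IH1 s w1 sX.
  have [t2 e2 l2] := IH2 s w2 sX.
  case: ifP => h.
    exists (cost (cexp e) + t1).+1; last lia.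
    by apply: ExecIfT e1; rewrite eval_cexp.
  exists (cost (cexp e) + t2).+1; last lia.
  by apply: ExecIfF e2; rewrite eval_cexp // leNgt h.
- move=> /and3P[/andP[k0 k64] kc wc] sX.
  pose f i s' := put (sem X c s') k 0 i.+1%:Z.
  set s0 := put s k 0 0.
  have k00 : (0 == k)%N = false by lia.
  have fX j : iteri j f s0 XR 0 = X%:Z.
    elim: j => [|j IHj] /=; rewrite /f /s0 /put k00 //.
    by rewrite frame ?writes_gt0.
  have fk j : iteri j f s0 k 0 = j%:Z.
    by case: j => [|j] /=; rewrite /f /s0 put_same.
  set W := WhilePos _ _.
  (* Induction on the number [m] of rounds still to come, so that the while loop is unfolded from
     its current state up to the end. *)
  have loop m : (m <= X)%N -> exists2 t,
      exec W (mem_of (iteri (X - m) f s0)) t (mem_of (iteri X f s0))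
      & (t <= m * (steps X c + 1500) + 1000)%N.
    elim: m => [|m IHm] mX.
      rewrite subn0; eexists; last first.
        apply: leq_trans (leq_addl _ _); shelve.
      apply: ExecWhileF.
      by rewrite -[Defs.eval _ _]/(Defs.eval _ (Reg XR) - Defs.eval _ (Reg k)) !eval_Reg // fX fk subrr.
    have [|t2 e2 l2] := IHm; first lia.
    have XmS : (X - m = (X - m.+1).+1)%N by lia.
    set s1 := iteri (X - m.+1) f s0.
    have s1X : s1 XR 0 = X%:Z by exact: fX.
    have s1k : s1 k 0 = (X - m.+1)%N%:Z by exact: fk.
    have [t1 e1 l1] := IH s1 wc s1X.
    have st1 := ExecStore (addrE k (Const 0)) (Plus (Reg k) (Const 1)) (mem_of (sem X c s1)).
    move: st1; rewrite eval_addrE.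
    rewrite -[Defs.eval _ (Plus _ _)]/(Defs.eval (mem_of (sem X c s1)) (Reg k) + 1) eval_Reg //.
    rewrite [Defs.eval _ (Const _)]/= upd_mem_of //.
    rewrite (frame _ _ kc) s1k.
    have -> : (X - m.+1)%N%:Z + 1 = (X - m.+1).+1%:Z by lia.
    rewrite -/(f (X - m.+1)%N s1) -/(iteri (X - m.+1).+1 f s0) -XmS => st1.
    eexists.
      apply: (@ExecWhileT _ _ _ _ _ _ _ _ (ExecSeq e1 st1) e2).
      rewrite -[Defs.eval _ _]/(Defs.eval (mem_of s1) (Reg XR) - Defs.eval (mem_of s1) (Reg k)) !eval_Reg // s1X s1k; lia.
    rewrite /=; lia.
  have [|t e l] := loop X; first exact: leqnn.
  rewrite subnn /= in e.
  have := ExecStore (addrE k (Const 0)) (Const 0) (mem_of s).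
  rewrite eval_addrE [Defs.eval _ (Const _)]/= upd_mem_of // => st.
  eexists; first exact: ExecSeq st e.
  rewrite /=; lia.
  Unshelve. rewrite /=; lia.
Qed.

Lemma steps_poly c : exists C d : nat, forall X, (steps X c <= C * X.+1 ^ d)%N.
Proof.
elim: c => [|k i e|c1 [C1 [d1 H1]] c2 [C2 [d2 H2]]|e c1 [C1 [d1 H1]] c2 [C2 [d2 H2]]|k c [C [d H]]].
- by exists 1%N, 0%N => X.
- by exists (steps 0 (CSet k i e)), 0%N => X; rewrite expn0 muln1.
- exists (C1 + C2)%N, (d1 + d2)%N => X /=.
  have p1 : (0 < X.+1 ^ d1)%N by rewrite expn_gt0.
  have p2 : (0 < X.+1 ^ d2)%N by rewrite expn_gt0.
  have := H1 X; have := H2 X; rewrite expnD; nia.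
- exists (C1 + C2 + (cost (cexp e)).+1)%N, (d1 + d2)%N => X /=.
  have p1 : (0 < X.+1 ^ d1)%N by rewrite expn_gt0.
  have p2 : (0 < X.+1 ^ d2)%N by rewrite expn_gt0.
  have := H1 X; have := H2 X; rewrite expnD; nia.
- exists (C + 4000)%N, d.+1 => X /=.
  have p1 : (0 < X.+1 ^ d)%N by rewrite expn_gt0.
  have := H X; rewrite expnS; nia.
Qed.

(** [writes] bounds the arrays that a command may change; this bounds the indices. It serves to show
    that scratch work spares the rest of an array, and in particular the input at negative
    indices. *)
Fixpoint const_idx (P : pred int) (c : cmd) : bool :=
  match c with
  | CSkip => true
  | CSet _ (HC i) _ => P i
  | CSet _ _ _ => false
  | CSeq c1 c2 | CIf _ c1 c2 => const_idx P c1 && const_idx P c2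
  | CLoop _ c1 => P 0 && const_idx P c1
  end.

Lemma frame_idx X P c s k j : const_idx P c -> ~~ P j -> sem X c s k j = s k j.
Proof.
move=> + Pj; have putP s' k0 i v : P i -> put s' k0 i v k j = s' k j.
  move=> Pi; rewrite /put; case: eqP => // ->; case: eqP => // ji.
  by rewrite ji Pi in Pj.
elim: c s => //=.
- by move=> k0 [] // z e s Pz; exact: putP.
- by move=> c1 IH1 c2 IH2 s /andP[h1 h2]; rewrite IH2 // IH1.
- by move=> e c1 IH1 c2 IH2 s /andP[h1 h2]; case: ifP => _; [exact: IH1|exact: IH2].
- move=> k0 c IH s /andP[P0 h].
  suff : forall m, iteri m (fun i s' => put (sem X c s') k0 0 i.+1%:Z)
    (put s k0 0 0) k j = s k j by apply.
  by elim=> [|m IHm] /=; rewrite putP // IH.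
Qed.

(** * Rules for loops, arithmetic, tabulation and sums *)

Section rules.
Variable X : nat.

Definition CFor (k : nat) (e : hexp) (c : cmd) : cmd :=
  CLoop k (CIf (HSub e (HG k (HC 0))) c CSkip).

Lemma loopP k c s (I : nat -> state -> Prop) : k \notin writes c ->
  (forall i s' v, I i s' -> I i (put s' k 0 v)) ->
  I 0%N s ->
  (forall i s', (i < X)%N -> (forall k', k' \notin k :: writes c -> s' k' = s k') ->
     s' k 0 = i%:Z -> I i s' -> I i.+1 (sem X c s')) ->
  I X (sem X (CLoop k c) s).
Proof.
move=> kc Ik I0 IS /=.
pose f i s' := put (sem X c s') k 0 i.+1%:Z.
set s0 := put s k 0 0.
have fk j : iteri j f s0 k 0 = j%:Z by case: j => [|j] /=; rewrite /f /s0 put_same.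
have fr j k' : k' \notin k :: writes c -> iteri j f s0 k' = s k'.
  rewrite inE negb_or => /andP[k1 k2].
  by elim: j => [|j IHj] /=; rewrite ?/f ?/s0 put_neq // frame.
suff : forall j, (j <= X)%N -> I j (iteri j f s0) by apply.
elim=> [|j IHj] jX /=; first exact: Ik.
apply: (Ik); apply: (IS j _ jX (fr j) (fk j)); apply: IHj; lia.
Qed.

Lemma loop_reg k c s : sem X (CLoop k c) s k 0 = X%:Z.
Proof. by rewrite /=; case: {1 3}X => [|m] /=; rewrite put_same. Qed.

Lemma forP k e c s n (I : nat -> state -> Prop) : (n <= X)%N -> k \notin writes c ->
  (forall s', (forall k', k' \notin k :: writes c -> s' k' = s k') -> heval s' e = n%:Z) ->
  (forall i s' v, I i s' -> I i (put s' k 0 v)) ->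
  I 0%N s ->
  (forall i s', (i < n)%N -> (forall k', k' \notin k :: writes c -> s' k' = s k') ->
     s' k 0 = i%:Z -> I i s' -> I i.+1 (sem X c s')) ->
  I n (sem X (CFor k e c) s).
Proof.
move=> nX kc en Ik I0 IS.
(* The loop still makes all [X] rounds and idles once the counter has reached [n], so round [i]
   carries the invariant of [minn i n]. *)
have := @loopP k (CIf (HSub e (HG k (HC 0))) c CSkip) s (fun i => I (minn i n)).
rewrite (minn_idPr nX) => H; apply: H => //=; rewrite ?cats0 //.
- by move=> i s' v; exact: Ik.
- by rewrite min0n.
move=> i s' iX fr ki; rewrite en // ki.
case: ltnP => [h|h]; case: ltrP => h' //; try lia.
- move=> Ii; have -> : minn i.+1 n = i.+1 by lia.
  exact: IS.
- move=> Ii; have -> : minn i.+1 n = n by lia.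
  exact: Ii.
Qed.


Definition V (k : nat) : hexp := HG k (HC 0).
Definition setr (k : nat) (e : hexp) : cmd := CSet k (HC 0) e.

(** Signed repeated addition, driven by [z] alone: [z] has to be bounded by [X], while [y] may be
    arbitrarily large. As [z] is read after [y] has been stored in register 1, it is evaluated in
    the modified state. *)
Definition mul (kd : nat) (y z : hexp) : cmd :=
  CSeq (setr 1 y) (CSeq (setr 2 z) (CSeq (setr 4 (HC 0)) (CSeq
    (CLoop 3 (CIf (HSub (V 2) (V 3)) (setr 4 (HAdd (V 4) (V 1)))
      (CIf (HSub (HSub (HC 0) (V 2)) (V 3)) (setr 4 (HSub (V 4) (V 1))) CSkip)))
    (setr kd (V 4))))).

Lemma mulP kd y z s : (`|heval (put s 1 0 (heval s y)) z| <= X)%N ->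
  sem X (mul kd y z) s kd 0 = heval s y * heval (put s 1 0 (heval s y)) z.
Proof.
rewrite /mul; set vz := heval _ z; set vy := heval s y => vzX /=.
rewrite put_same -/vz -/vy.
pose s0 := put (put (put s 1 0 vy) 2 0 vz) 4 0 0.
pose I i (s' : state) := [/\ s' 1%N 0 = vy, s' 2%N 0 = vz &
  s' 4%N 0 = vy * (if 0 <= vz then (minn i `|vz|)%:Z else - (minn i `|vz|)%:Z)].
have := @loopP 3%N (CIf (HSub (V 2) (V 3)) (setr 4 (HAdd (V 4) (V 1)))
      (CIf (HSub (HSub (HC 0) (V 2)) (V 3)) (setr 4 (HSub (V 4) (V 1))) CSkip)) s0 I
  isT.
case=> //.
- by split=> //; rewrite min0n; case: ifP => _; rewrite ?oppr0 mulr0.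
- move=> i s' iX fr s3 [I1 I2 I4] /=; rewrite !I2 !s3.
  case: ifP => h; [|case: ifP => h'].
  + split=> //=; rewrite put_same I1 I4 !ifT; [|lia|lia].
    have -> : minn i.+1 `|vz| = (minn i `|vz|).+1 by lia.
    by rewrite -addn1 PoszD mulrDr mulr1.
  + split=> //=; rewrite put_same I1 I4 !ifF; [|lia|lia].
    have -> : minn i.+1 `|vz| = (minn i `|vz|).+1 by lia.
    by rewrite -addn1 PoszD opprD mulrDr mulrN1.
  + split=> //; rewrite I4.
    by have -> : minn i.+1 `|vz| = minn i `|vz| by lia.
- move=> _ _ h; apply: (etrans h); congr (_ * _).
  by rewrite (minn_idPr vzX); case: ifP; lia.
Qed.

Lemma writes_mul kd y z : writes (mul kd y z) = [:: 1; 2; 4; 3; 4; 4; kd]%N.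
Proof. by []. Qed.

Lemma mulE kd y z s (vy := heval s y) (vz := heval (put s 1 0 vy) z) :
  (4 < kd)%N -> (`|vz| <= X)%N ->
  sem X (mul kd y z) s =
  put (put (put (put (put s 1 0 vy) 2 0 vz) 3 0 X%:Z) 4 0 (vy * vz)) kd 0 (vy * vz).
Proof.
move=> kd4 vzX; apply/funext => k; apply/funext => j.
have [kd_k|kk] := eqVneq k kd.
  have [->|j0] := eqVneq j 0; first by rewrite kd_k mulP // put_same.
  rewrite (@frame_idx X (pred1 0)) //.
  by rewrite kd_k put_idx // !put_neq //; lia.
rewrite (put_neq _ _ _ kk).
have [k5|] := boolP ((k == 0) || (5 <= k))%N.
  rewrite !put_neq //; try lia.
  by rewrite frame // writes_mul !inE; lia.
rewrite negb_or -ltnNge => /andP[k0 k5].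
have [j0|j0] := eqVneq j 0; last first.
  rewrite (@frame_idx X (pred1 0)) //.
  by rewrite !put_out.
rewrite j0 {j j0}; have h := @mulP 5 y z s vzX.
have [vs1 vs2 vs3 vs4] : [/\ sem X (mul kd y z) s 1%N 0 = vy, sem X (mul kd y z) s 2%N 0 = vz,
  sem X (mul kd y z) s 3%N 0 = X%:Z & sem X (mul kd y z) s 4%N 0 = vy * vz].
  pose L := CLoop 3 (CIf (HSub (V 2) (V 3)) (setr 4 (HAdd (V 4) (V 1)))
      (CIf (HSub (HSub (HC 0) (V 2)) (V 3)) (setr 4 (HSub (V 4) (V 1))) CSkip)).
  pose s0 := put (put (put s 1 0 vy) 2 0 vz) 4 0 0.
  have mulL k' : sem X (mul k' y z) s = put (sem X L s0) k' 0 (sem X L s0 4%N 0) by [].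
  have h4 : sem X L s0 4%N 0 = vy * vz by rewrite /vy /vz -[RHS]h mulL put_same.
  rewrite mulL !put_neq ?h4 ?loop_reg //; try lia.
  by rewrite !(@frame _ L).
by move: k0 k5; case: k kk => [|[|[|[|[|]]]]].
Qed.

(** A power may be far larger than [X] and thus unfit to drive a multiplication; it is applied one
    factor [u] at a time. *)
Definition mulpow (kd : nat) (y u e : hexp) : cmd :=
  CSeq (setr kd y) (CFor 5 e (mul kd (V kd) u)).

Lemma mulpowP kd y u e s n vu : (5 < kd)%N -> (n <= X)%N ->
  (forall s', (forall k, k \notin [:: 1; 2; 3; 4; 5; kd] -> s' k = s k) -> heval s' e = n%:Z) ->
  (forall s', (forall k, k \notin [:: 1; 2; 3; 4; 5; kd] -> s' k = s k) -> heval s' u = vu) ->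
  (`|vu| <= X)%N ->
  sem X (mulpow kd y u e) s kd 0 = heval s y * vu ^+ n.
Proof.
move=> kd5 nX en uv vuX; pose s0 := put s kd 0 (heval s y).
have s0f k : k != kd -> s0 k = s k by move=> kk; rewrite /s0 put_neq.
pose I i (s' : state) := s' kd 0 = heval s y * vu ^+ i.
suff : I n (sem X (CFor 5 e (mul kd (V kd) u)) s0) by [].
apply: forP => //.
- by rewrite writes_mul !inE; lia.
- move=> s' fr; apply: en => k; rewrite !inE => kn; rewrite fr ?s0f //.
    by lia.
  by rewrite writes_mul !inE; lia.
- by move=> i s' v; rewrite /I put_neq // ; lia.
- by rewrite /I /s0 put_same expr0 mulr1.
- move=> i s' _ fr _ Ii.
  have ue : heval (put s' 1 0 (heval s' (V kd))) u = vu.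
    apply: uv => k; rewrite !inE => kn; rewrite put_neq; last lia.
    rewrite fr ?s0f //; first lia.
    by rewrite writes_mul !inE; lia.
  by rewrite /I mulP ue // /= Ii exprSr mulrA.
Qed.

(** Repeated subtraction: numerator and denominator may be long, only the quotient has to stay below
    [X]. *)
Definition hdiv (kd : nat) (y z : hexp) : cmd :=
  CSeq (setr 7 y) (CSeq (setr 8 z) (CSeq (setr 9 (HC 0)) (CSeq
    (CLoop 6 (CIf (HAdd (HSub (V 7) (V 8)) (HC 1))
       (CSeq (setr 7 (HSub (V 7) (V 8))) (setr 9 (HAdd (V 9) (HC 1)))) CSkip))
    (setr kd (V 9))))).

Lemma hdivP kd y z s (vz := heval (put s 7 0 (heval s y)) z) :
  0 < vz -> 0 <= heval s y -> heval s y < vz * X%:Z ->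
  sem X (hdiv kd y z) s kd 0 = (heval s y %/ vz)%Z.
Proof.
move=> vz0; rewrite /hdiv; set vy := heval s y => vy0 vyX /=.
rewrite put_same -/vz -/vy.
pose s0 := put (put (put s 7 0 vy) 8 0 vz) 9 0 0.
have d0 : 0 <= (vy %/ vz)%Z by rewrite divz_ge0.
have dm := divz_eq vy vz.
have m0 : 0 <= (vy %% vz)%Z by rewrite modz_ge0 // gt_eqF.
have m1 : (vy %% vz)%Z < vz by rewrite ltz_pmod.
pose I i (s' : state) := [/\ s' 8%N 0 = vz, s' 9%N 0 = (minn i `|(vy %/ vz)%Z|)%:Z
  & s' 7%N 0 = vy - vz * (minn i `|(vy %/ vz)%Z|)%:Z].
have := @loopP 6%N (CIf (HAdd (HSub (V 7) (V 8)) (HC 1))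
       (CSeq (setr 7 (HSub (V 7) (V 8))) (setr 9 (HAdd (V 9) (HC 1)))) CSkip) s0 I
  isT.
case=> //.
- by split=> //; rewrite ?min0n ?mulr0 ?subr0.
- move=> i s' iX fr s3 [I1 I2 I4] /=; rewrite !I1 !I4.
  set d := (vy %/ vz)%Z in dm d0 I2 I4 *.
  case: ifP => h.
  + have le : (i < `|d|)%N by case: ltnP => // le; move: h; rewrite (minn_idPr le); nia.
    have e1 : minn i `|d| = i by lia.
    have e2 : minn i.+1 `|d| = i.+1 by lia.
    rewrite /I -/d e2; split=> //=.
      rewrite put_same put_neq // I2 e1; lia.
    rewrite put_neq // put_same e1; lia.
  + have le : (`|d| <= i)%N.
      case: leqP => // le; move: h; have -> : minn i `|d| = i by lia.
      nia.
    have e1 : minn i `|d| = `|d|%N by lia.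
    have e2 : minn i.+1 `|d| = `|d|%N by lia.
    by rewrite /I -/d e2; split; rewrite // ?I2 ?I4 e1.
- move=> _ h _; apply: (etrans h).
  have : (vy %/ vz)%Z < X%:Z by rewrite ltz_divLR // mulrC.
  lia.
Qed.

Definition fill (k : nat) (base : hexp) (kc : nat) (n : hexp) (body : cmd) (kv : nat) :=
  CFor kc n (CSeq body (CSet k (HAdd base (V kc)) (V kv))).

(** The relational form lets [P] say nothing about some entries. The tables of the dynamic program
    require this, as the end of a row refers to values beyond the previous row. *)
Lemma fillR k base kc ne body kv s n b (P : nat -> int -> Prop) :
  (n <= X)%N -> kc != k -> k \notin writes body -> kc \notin writes body ->
  (forall s', (forall k', k' \notin k :: kc :: writes body -> s' k' = s k') ->
     heval s' ne = n%:Z /\ heval s' base = b) ->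
  (forall i s', (i < n)%N ->
     (forall k', k' \notin k :: kc :: writes body -> s' k' = s k') ->
     (forall j, (j < b) || (b + n%:Z <= j) -> s' k j = s k j) ->
     s' kc 0 = i%:Z -> P i (sem X body s' kv 0)) ->
  let s1 := sem X (fill k base kc ne body kv) s in
  (forall i, (i < n)%N -> P i (s1 k (b + i%:Z))) /\
  (forall j, (j < b) || (b + n%:Z <= j) -> s1 k j = s k j).
Proof.
move=> nX kck kb kcb ne_b st /=.
suff : (forall i, (i < n)%N -> P i (sem X (fill k base kc ne body kv) s k (b + i%:Z))) /\
  (forall j, (j < b) || (b + n%:Z <= j) -> sem X (fill k base kc ne body kv) s k j = s k j) by [].
rewrite /fill.
have frw (s' : state) : (forall k', k' \notin kc :: writes
    (CSeq body (CSet k (HAdd base (V kc)) (V kv))) -> s' k' = s k') ->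
    (forall k', k' \notin k :: kc :: writes body -> s' k' = s k').
  move=> h k' h'; apply: h; move: h'; rewrite /= !inE mem_cat !inE !negb_or.
  by move=> /and3P[-> -> ->].
pose I i (s' : state) := (forall i', (i' < i)%N -> P i' (s' k (b + i'%:Z))) /\
  (forall j, (j < b) || (b + n%:Z <= j) -> s' k j = s k j).
suff : I n (sem X (CFor kc ne (CSeq body (CSet k (HAdd base (V kc)) (V kv)))) s) by [].
apply: forP => //.
- by rewrite /= mem_cat inE negb_or kcb.
- by move=> s' /frw/ne_b[].
- by move=> i s' vv [I1 I2]; rewrite /I put_neq // eq_sym.
- move=> i s' iN /frw fr ki [I1 I2]; rewrite /I /=.
  have Pv := st i s' iN fr I2 ki.
  rewrite (frame X s' kcb) ki.
  have -> : heval (sem X body s') base = b.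
    apply: (ne_b _ _).2 => k' h.
    rewrite frame ?fr //; by move: h; rewrite !inE !negb_or => /and3P[].
  rewrite (_ : put _ k _ _ k = fun j => if j == b + i%:Z then sem X body s' kv 0 else sem X body s' k j);
    last by rewrite /put eqxx.
  rewrite (frame X s' kb); split=> [i'|j jb].
    rewrite ltnS leq_eqVlt => /orP[/eqP->|i'i]; first by rewrite eqxx.
    by rewrite ifF; [exact: I1|lia].
  by rewrite ifF ?I2 //; lia.
Qed.

Lemma fillP k base kc ne body kv s n b (v : nat -> int) :
  (n <= X)%N -> kc != k -> k \notin writes body -> kc \notin writes body ->
  (forall s', (forall k', k' \notin k :: kc :: writes body -> s' k' = s k') ->
     heval s' ne = n%:Z /\ heval s' base = b) ->
  (forall i s', (i < n)%N ->
     (forall k', k' \notin k :: kc :: writes body -> s' k' = s k') ->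
     (forall j, (j < b) || (b + n%:Z <= j) -> s' k j = s k j) ->
     s' kc 0 = i%:Z -> sem X body s' kv 0 = v i) ->
  let s1 := sem X (fill k base kc ne body kv) s in
  (forall i, (i < n)%N -> s1 k (b + i%:Z) = v i) /\
  (forall j, (j < b) || (b + n%:Z <= j) -> s1 k j = s k j).
Proof. by move=> *; apply: (@fillR k base kc ne body kv s n b (fun i x => x = v i)). Qed.

Definition hsum (kd kc : nat) (n : hexp) (body : cmd) (kv : nat) : cmd :=
  CSeq (setr kd (HC 0)) (CFor kc n (CSeq body (setr kd (HAdd (V kd) (V kv))))).

Lemma hsumP kd kc ne body kv s n (v : nat -> int) :
  (n <= X)%N -> kd != kc -> kc \notin writes body -> kd \notin writes body ->
  (forall s', (forall k', k' \notin kd :: kc :: writes body -> s' k' = s k') ->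
     heval s' ne = n%:Z) ->
  (forall i s', (i < n)%N ->
     (forall k', k' \notin kd :: kc :: writes body -> s' k' = s k') ->
     s' kc 0 = i%:Z -> sem X body s' kv 0 = v i) ->
  sem X (hsum kd kc ne body kv) s kd 0 = \sum_(i < n) v i.
Proof.
move=> nX kdc kcb kdb en st; rewrite /hsum.
have frw (s' : state) : (forall k', k' \notin kc :: writes
    (CSeq body (setr kd (HAdd (V kd) (V kv)))) -> s' k' = put s kd 0 0 k') ->
    (forall k', k' \notin kd :: kc :: writes body -> s' k' = s k').
  move=> h k' h'; rewrite h.
    by rewrite put_neq //; move: h'; rewrite inE negb_or => /andP[].
  by move: h'; rewrite /= !inE mem_cat !inE !negb_or => /and3P[-> -> ->].
pose I i (s' : state) := s' kd 0 = \sum_(i' < i) v i'.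
suff : I n (sem X (CFor kc ne (CSeq body (setr kd (HAdd (V kd) (V kv))))) (put s kd 0 0)) by [].
apply: forP => //.
- by rewrite /= mem_cat inE negb_or kcb eq_sym.
- by move=> s' /frw/en.
- by move=> i s' vv; rewrite /I put_neq.
- by rewrite /I put_same big_ord0.
- move=> i s' iN /frw fr ki Ii; rewrite /I /=.
  by rewrite put_same frame // Ii (st i) // big_ord_recr.
Qed.

End rules.

Section expressions.
Variable X : nat.

Definition absr (k : nat) : cmd :=
  CIf (HSub (HC 0) (V k)) (setr k (HSub (HC 0) (V k))) (setr k (V k)).

Lemma absrE k s : sem X (absr k) s = put s k 0 `|s k 0|.
Proof. by rewrite /absr /=; case: ifP => h; congr put; lia. Qed.

Lemma sem_seq c1 c2 s : sem X (CSeq c1 c2) s = sem X c2 (sem X c1 s).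
Proof. by []. Qed.

Lemma sem_setr k e s : sem X (setr k e) s = put s k 0 (heval s e).
Proof. by []. Qed.

Lemma sem_if e c1 c2 s :
  sem X (CIf e c1 c2) s = if 0 < heval s e then sem X c1 s else sem X c2 s.
Proof. by []. Qed.

Lemma sem_skip s : sem X CSkip s = s.
Proof. by []. Qed.

Lemma hevalC s z : heval s (HC z) = z. Proof. by []. Qed.
Lemma hevalV s k : heval s (V k) = s k 0. Proof. by []. Qed.
Lemma hevalG s k e : heval s (HG k e) = s k (heval s e). Proof. by []. Qed.
Lemma hevalD s e1 e2 : heval s (HAdd e1 e2) = heval s e1 + heval s e2.
Proof. by []. Qed.
Lemma hevalB s e1 e2 : heval s (HSub e1 e2) = heval s e1 - heval s e2.
Proof. by []. Qed.

Lemma mulV kd i j s u v : s i 0 = u -> s j 0 = v -> j != 1%N -> (`|v| <= X)%N ->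
  sem X (mul kd (V i) (V j)) s kd 0 = u * v.
Proof. by move=> <- <- j1 h; rewrite mulP /= ?put_neq. Qed.

Lemma setrV k e s : sem X (setr k e) s k 0 = heval s e.
Proof. exact: put_same. Qed.

Lemma absrV k s u : s k 0 = u -> sem X (absr k) s k 0 = `|u|.
Proof. by rewrite absrE put_same => ->. Qed.

Definition hevalE := (hevalC, hevalV, hevalG, hevalD, hevalB).

End expressions.

(* [adv H], where [H : sem X c s k 0 = v], replaces the state [sem X c s] by a
   fresh variable, keeping [H] and every known register of [s] that [c] does
   not write. *)
Ltac transfer fr s s' := repeat match goal with
  | H : s ?k ?i = ?v |- _ =>
    first [ let H' := fresh in assert (H' : s' k i = v) by (rewrite (fr k isT); exact H);
            clear H; rename H' into H
          | clear H ]
  end.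
Ltac adv H :=
  lazymatch type of H with sem ?X ?c ?s ?kd _ = _ =>
    let fr := fresh "fr" in let s' := fresh "s" in
    assert (fr : forall k, k \notin writes c -> sem X c s k = s k);
      [move=> ? ?; apply: frame; assumption|];
    move: (sem X c s) H fr => s' H fr; transfer fr s s'; clear fr; try clear s
  end.
Ltac bmul tac :=
  lazymatch goal with |- context [sem ?X (mul ?kd (V ?i) (V ?j)) ?s] =>
    match goal with Hi : s i 0 = ?u |- _ =>
      match goal with Hj : s j 0 = ?v |- _ =>
        let H := fresh "v" in
        assert (H : sem X (mul kd (V i) (V j)) s kd 0 = u * v);
          [apply: (mulV kd Hi Hj); [done|tac] | adv H]
      end
    end
  end.
Ltac bset :=
  lazymatch goal with |- context [sem ?X (setr ?k ?e) ?s] =>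
    let H := fresh "v" in
    have H := setrV X k e s; rewrite ?hevalE in H;
    repeat match goal with Hi : s ?i ?j = ?u |- _ => rewrite {1}Hi in H end;
    adv H
  end.
Ltac babs :=
  lazymatch goal with |- context [sem ?X (absr ?k) ?s] =>
    match goal with Hi : s k 0 = ?u |- _ =>
      let H := fresh "v" in have H := absrV X Hi; adv H end
  end.

(* Powers with large literal exponents are very slow in [lia]: hide them. *)
Ltac hidepow := repeat match goal with
  | |- context [expn ?b ?k] =>
    let Q := fresh "Q" in let e := fresh "e" in remember (expn b k) as Q eqn:e in *; clear e
  | H : context [expn ?b ?k] |- _ =>
    let Q := fresh "Q" in let e := fresh "e" in remember (expn b k) as Q eqn:e in *; clear e
  end.
Ltac plia := lazymatch goal with
  | H : forall i : nat, is_true (i < _)%N -> is_true (_ * _ <= _)%N |- _ => clear H; hidepow; lia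
  | _ => hidepow; lia end.
Ltac pnia := lazymatch goal with
  | H : forall i : nat, is_true (i < _)%N -> is_true (_ * _ <= _)%N |- _ => clear H; hidepow; nia
  | _ => hidepow; nia end.

Notation "c1 ;; c2" := (CSeq c1 c2) (at level 60, right associativity).
Notation kPW := 10%N.
Notation rN1 := 11%N.
Notation rN := 12%N.
Notation kIN := 13%N.
Notation kROW := 14%N.
Notation kRN := 15%N.
Notation kA := 16%N.
Notation kT := 17%N.
Notation kQ := 18%N.
Notation rE := 19%N.
Notation rI := 20%N.
Notation rJ := 21%N.
Notation rK := 22%N.
Notation rVAL := 23%N.
Notation rV2 := 24%N.
Notation rP := 25%N.
Notation rQ := 26%N.
Notation rFLAG := 27%N.
Notation rR := 28%N.
Notation rBEST := 29%N.
Notation rC := 31%N.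
Notation rW := 33%N.
Notation rS := 34%N.
Notation rAPQ := 40%N.
Notation rDQP := 41%N.

Definition PW (k : nat) : hexp := HG kPW (HC k%:Z).
Definition MX (k : nat) (i j : hexp) : hexp := HG k (HAdd (HG kROW i) j).
Definition fill2 (k : nat) (ne : hexp) (body : cmd) : cmd :=
  CFor rI ne (fill k (HG kROW (V rI)) rJ ne body rVAL).
Definition ceq (e1 e2 : hexp) (c1 c2 : cmd) : cmd :=
  CIf (HSub e1 e2) c2 (CIf (HSub e2 e1) c2 c1).

Lemma ceqP X e1 e2 c1 c2 s : sem X (ceq e1 e2 c1 c2) s =
  if heval s e1 == heval s e2 then sem X c1 s else sem X c2 s.
Proof.
rewrite /ceq /=; case: eqP => [->|h]; first by rewrite subrr ltxx.
by case: ifP => // h1; case: ifP => // h2; lia.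
Qed.

(** * Matrices in memory and the initial form *)

Section general.
Variable X : nat.

Lemma for2P ki kj ne c s n (I : nat -> nat -> state -> Prop) :
  (n <= X)%N -> ki != kj -> ki \notin writes c -> kj \notin writes c ->
  (forall s', (forall k', k' \notin [:: ki, kj & writes c] -> s' k' = s k') ->
    heval s' ne = n%:Z) ->
  (forall i j s' v, I i j s' -> I i j (put s' ki 0 v)) ->
  (forall i j s' v, I i j s' -> I i j (put s' kj 0 v)) ->
  I 0%N 0%N s ->
  (forall i s', I i n s' -> I i.+1 0%N s') ->
  (forall i j s', (i < n)%N -> (j < n)%N ->
    (forall k', k' \notin [:: ki, kj & writes c] -> s' k' = s k') ->
     s' ki 0 = i%:Z -> s' kj 0 = j%:Z -> I i j s' -> I i j.+1 (sem X c s')) ->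
  I n 0%N (sem X (CFor ki ne (CFor kj ne c)) s).
Proof.
move=> nX kij kic kjc en Ii Ij I0 In IS.
have wsub k' : k' \notin [:: ki, kj & writes c] -> k' \notin ki :: writes (CFor kj ne c).
  by rewrite /= cats0.
apply: (@forP X ki ne (CFor kj ne c) s n (fun i => I i 0%N)) => //.
- by rewrite /= cats0 inE negb_or kij.
- by move=> s' fr; apply: en => k' /wsub/fr.
- by move=> i s' v; exact: Ii.
move=> i s' iN fr si I1; apply: In.
apply: (@forP X kj ne c s' n (I i)) => //.
- move=> s'' fr'; apply: en => k' kn; rewrite fr' ?fr //; first exact: wsub.
  by move: kn; rewrite inE negb_or => /andP[].
- by move=> j s'' v; exact: Ij.
- move=> j s'' jn fr' sj I2; apply: IS => //.
  + move=> k' kn; rewrite fr' ?fr //; first exact: wsub.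
    by move: kn; rewrite inE negb_or => /andP[].
  + by rewrite fr' // inE negb_or kij.
Qed.

(** Row offsets are tabulated once, since an address expression cannot contain a product; all
    matrices have row stride [X]. *)
Definition rows (s : state) := forall i, (i < X)%N -> s kROW i%:Z = (i * X)%N%:Z.
Definition matrep (s : state) k n (A : nat -> nat -> int) :=
  forall i j, (i < n)%N -> (j < n)%N -> s k (i * X + j)%N%:Z = A i j.

Lemma MXE (s : state) k n A ei ej i j : rows s -> matrep s k n A -> (n <= X)%N ->
  (i < n)%N -> (j < n)%N -> heval s ei = i%:Z -> heval s ej = j%:Z ->
  heval s (MX k ei ej) = A i j.
Proof. by move=> rs As nX iN jN /= -> ->; rewrite rs ?As; lia. Qed.

Lemma fill2P k ne body s n (v : nat -> nat -> int) :
  (n <= X)%N -> (30 < k)%N || (15 < k < 19)%N || (k == 45)%N -> k \notin writes body ->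
  rI \notin writes body -> rJ \notin writes body -> kROW \notin writes body ->
  rows s ->
  (forall s', (forall k', k' \notin [:: k, rI, rJ & writes body] -> s' k' = s k') ->
    heval s' ne = n%:Z) ->
  (forall i j s', (i < n)%N -> (j < n)%N ->
    (forall k', k' \notin [:: k, rI, rJ & writes body] -> s' k' = s k') ->
     s' rI 0 = i%:Z -> s' rJ 0 = j%:Z -> sem X body s' rVAL 0 = v i j) ->
  matrep (sem X (fill2 k ne body) s) k n v.
Proof.
move=> nX kk kb bI bJ bR rs en st.
have frw k' : k' \notin [:: k, rI, rJ & writes body] ->
    k' \notin rI :: writes (fill k (HG kROW (V rI)) rJ ne body rVAL).
  rewrite /= !inE mem_cat mem_cat !negb_or !inE.
  by move=> /and4P[-> -> -> ->].
have kROWn : kROW \notin [:: k, rI, rJ & writes body].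
  by rewrite !inE (negbTE bR); lia.
pose I i (s' : state) := forall i' j, (i' < i)%N -> (j < n)%N -> s' k (i' * X + j)%N%:Z = v i' j.
suff : I n (sem X (fill2 k ne body) s) by [].
apply: (@forP X rI ne _ s n I) => //.
- by rewrite /= !inE mem_cat mem_cat !negb_or !inE bI; lia.
- by move=> s' fr; apply: en => k' /frw/fr.
- by move=> i s' w Ii i' j i'i jn; rewrite put_neq ?Ii //; lia.
move=> i s' iN fr sI Ii.
have [||||||F1 F2] := @fillP X k (HG kROW (V rI)) rJ ne body rVAL s' n (i * X)%N%:Z (v i) => //.
- lia.
- move=> s'' fr'; have frb k' : k' \notin [:: k, rI, rJ & writes body] -> s'' k' = s k'.
    move=> kn; rewrite fr' ?fr //; first exact: frw.
    by move: kn; rewrite !inE !negb_or => /and4P[-> _ -> ->].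
  split; first exact: en.
  rewrite /= frb // fr' ?sI ?rs //; first lia.
  by rewrite !inE (negbTE bI); lia.
- move=> j s'' jn fr' _ sJ; apply: st => //.
    move=> k' kn; rewrite fr' ?fr //; first exact: frw.
    by move: kn; rewrite !inE !negb_or => /and4P[-> _ -> ->].
  by rewrite fr' ?sI // !inE (negbTE bI); lia.
move=> i' j; rewrite ltnS leq_eqVlt => /orP[/eqP->|i'i] jn.
  by rewrite PoszD F1.
rewrite F2 ?Ii //; nia.
Qed.

Definition copy : cmd := CLoop rI (CSet kIN (V rI) (HI (V rI))).

Lemma copyP s (inp : nat -> int) :
  (forall i : nat, mem_of s i = inp i) ->
  forall i, (i < X)%N -> sem X copy s kIN i%:Z = inp i.
Proof.
move=> sin.
pose I i (s' : state) := (forall k j, j < 0 -> s' k j = s k j) /\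
  (forall i', (i' < i)%N -> s' kIN i'%:Z = inp i').
suff : I X (sem X copy s) by case.
apply: loopP => //.
- move=> i s' v [I1 I2]; split=> // k j j0; rewrite put_out ?I1 //; lia.
move=> i s' iX fr si [I1 I2]; rewrite /I [sem _ _ _]/= si; split.
  move=> k j j0; rewrite put_out ?I1 //; lia.
have -> : mem_of s' i = inp i.
  rewrite -sin /mem_of I1 //; rewrite /idx; lia.
move=> i'; rewrite ltnS leq_eqVlt => /orP[/eqP->|i'i]; first by rewrite put_same.
rewrite put_idx ?I2 //; lia.
Qed.

Definition rowinit k (e : hexp) : cmd := fill k (HC 0) rI (V XR) (mul rVAL e (V rI)) rVAL.

Lemma rowinitP s k r m : s XR 0 = X%:Z -> r \notin [:: k; rI; 1; 2; 3; 4; rVAL]%N ->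
  (23 < k)%N || (10 < k < 16)%N -> s r 0 = m%:Z ->
  forall i, (i < X)%N -> sem X (rowinit k (V r)) s k i%:Z = (i * m)%N%:Z.
Proof.
move=> sX rn kb sr; rewrite !inE in rn.
have [||||||F1 F2] := @fillP X k (HC 0) rI (V XR) (mul rVAL (V r) (V rI)) rVAL s X 0
  (fun i => (i * m)%N%:Z) => //.
- lia.
- by rewrite writes_mul !inE; lia.
- move=> s' fr; split=> //=; rewrite fr // ?writes_mul !inE; lia.
- move=> i s' iX fr _ si; rewrite mulP /= ?put_neq ?si //; last lia.
  rewrite fr ?sr; last by rewrite ?writes_mul !inE; lia.
  by rewrite mulnC PoszM.
Qed.

Definition Tin (i j : hexp) : hexp := HG kIN (HAdd (HAdd (HC 4) (V rN)) (HAdd (HG kRN i) j)).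
Definition pred_ (e : hexp) : hexp := HSub e (HC 1).
Definition bodyA : cmd :=
  CIf (V rI)
    (CIf (V rJ) (setr rVAL (HAdd (Tin (pred_ (V rI)) (pred_ (V rJ))) (Tin (pred_ (V rJ)) (pred_ (V rI)))))
                (setr rVAL (HG kIN (HAdd (V rI) (HC 3)))))
    (CIf (V rJ) (setr rVAL (HG kIN (HAdd (V rJ) (HC 3))))
                (setr rVAL (HAdd (HG kIN (HC 3)) (HG kIN (HC 3))))).

(** The symmetric matrix of twice the homogenised polynomial; the factor 2 avoids halving the linear
    and mixed coefficients. *)
Definition G0 (n : nat) (inp : nat -> int) (i j : nat) : int :=
  match i, j with
  | 0, 0 => inp 3%N + inp 3%N
  | 0, j'.+1 => inp (4 + j')%N
  | i'.+1, 0 => inp (4 + i')%N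
  | i'.+1, j'.+1 => inp (4 + n + i' * n + j')%N + inp (4 + n + j' * n + i')%N
  end.

Lemma fillAP s n inp : (4 + n + n * n < X)%N -> rows s ->
  (forall i, (i < X)%N -> s kIN i%:Z = inp i) ->
  (forall i, (i < X)%N -> s kRN i%:Z = (i * n)%N%:Z) ->
  s rN 0 = n%:Z -> s rN1 0 = n.+1%:Z ->
  matrep (sem X (fill2 kA (V rN1) bodyA) s) kA n.+1 (G0 n inp).
Proof.
move=> nX rs sin srn sn sn1; apply: fill2P => //; first nia.
  by move=> s' fr /=; rewrite fr.
move=> i j s' iN jN fr si sj.
rewrite /bodyA /= si sj.
have T i' j' : (i' < n)%N -> (j' < n)%N ->
    s' kIN (4 + s' rN 0 + (s' kRN i'%:Z + j'%:Z)) = inp (4 + n + i' * n + j')%N.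
  move=> h1 h2; rewrite !fr // sn srn ?ltnS; last nia.
  rewrite -sin; last nia.
  by congr (s kIN _); lia.
case: i iN si => [|i] iN si; case: j jN sj => [|j] jN sj; rewrite ?ltxx /=.
- by rewrite put_same fr // sin //; nia.
- rewrite put_same fr // -sin; last by nia.
  by congr (s kIN _); lia.
- rewrite put_same fr // -sin; last by nia.
  by congr (s kIN _); lia.
- by rewrite put_same -!predn_int //= !T.
Qed.

Definition findE : cmd := setr rE (HC 0) ;;
  CFor rI (V rN1) (CFor rJ (V rN1) (CIf (HAdd (V rI) (V rJ))
    (setr rVAL (MX kA (V rI) (V rJ)) ;; CIf (HSub (V rVAL) (V rE)) (setr rE (V rVAL))
      (CIf (HSub (HSub (HC 0) (V rVAL)) (V rE)) (setr rE (HSub (HC 0) (V rVAL))) CSkip)) CSkip)).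

(** The entry (0,0), the constant term, is excluded. [E] serves as the scale of the form, and it
    vanishes exactly when the polynomial is constant. *)
Definition is_max n (A : nat -> nat -> int) (E : int) :=
  [/\ 0 <= E,
     (forall i j, (i < n)%N -> (j < n)%N -> (0 < i + j)%N -> `|A i j| <= E) &
     E = 0 \/ exists i j, [/\ (i < n)%N, (j < n)%N, (0 < i + j)%N & `|A i j| = E] ].

Lemma findEP s n A : (n < X)%N -> rows s -> matrep s kA n.+1 A -> s rN1 0 = n.+1%:Z ->
  is_max n.+1 A (sem X findE s rE 0).
Proof.
move=> nX rs As sn1.
pose I i j (s' : state) := [/\ 0 <= s' rE 0,
     (forall i' j', ((i' < i) && (j' < n.+1) || (i' == i) && (j' < j))%N ->
        (0 < i' + j')%N -> `|A i' j'| <= s' rE 0) &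
     s' rE 0 = 0 \/ exists i j, [/\ (i < n.+1)%N, (j < n.+1)%N, (0 < i + j)%N & `|A i j| = s' rE 0] ].
have : I n.+1 0%N (sem X findE s).
  pose c := CIf (HAdd (V rI) (V rJ))
    (setr rVAL (MX kA (V rI) (V rJ)) ;; CIf (HSub (V rVAL) (V rE)) (setr rE (V rVAL))
      (CIf (HSub (HSub (HC 0) (V rVAL)) (V rE)) (setr rE (HSub (HC 0) (V rVAL))) CSkip)) CSkip.
  apply: (@for2P rI rJ (V rN1) c (put s rE 0 0) n.+1 I) => //.
  - by move=> s' fr /=; rewrite fr.
  - by split=> //; [move=> i' j'; rewrite !ltn0 andbF|left].
  - move=> i s' [I1 I2 I3]; split=> // i' j' h; apply: I2; lia.
  move=> i j s' iN jN fr si sj [I1 I2 I3] /=; rewrite si sj.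
  have Aij : heval s' (MX kA (V rI) (V rJ)) = A i j.
    apply: (MXE (n := n.+1)) => //.
    + by move=> i' h; rewrite fr //; exact: rs.
    + by move=> i' j' h h'; rewrite fr //; exact: As.
  rewrite /= si sj in Aij.
  case: ifP => h0; last first.
    split=> // i' j' h1 h2; apply: I2 => //; move: h1 => /orP[->//|/andP[/eqP e1 h1]]; subst i'.
    apply/orP; right; rewrite eqxx /=; lia.
  have Ij i' j' E : s' rE 0 <= E -> `|A i j| <= E ->
      ((i' < i) && (j' < n.+1) || (i' == i) && (j' < j.+1))%N ->
      (0 < i' + j')%N -> `|A i' j'| <= E.
    move=> h1 h2 h3 h4; have [/andP[/eqP-> /eqP->]//|h5] := boolP ((i' == i) && (j' == j)).
    by apply: le_trans h1; apply: I2 => //; move: h3 h5; lia.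
  rewrite /=; sput; rewrite Aij.
  case: ifP => h1; [|rewrite /=; sput; rewrite ?Aij; case: ifP => h2]; rewrite /I /=; sput; rewrite ?Aij.
  + split; [lia| |right; exists i, j; split=> //; lia].
    by move=> i' j'; apply: Ij; lia.
  + split; [lia| |right; exists i, j; split=> //; lia].
    by move=> i' j'; apply: Ij; lia.
  + by split=> // i' j'; apply: Ij; lia.
case=> I1 I2 I3; split=> // i j iN jN; apply: I2; lia.
Qed.

End general.

(** * The Jacobi iteration *)

Ltac sval := with_strategy opaque [put heval] (rewrite ?hevalE); sput.
Ltac smul := rewrite sem_seq mulE; [sval|done|sval].
Ltac sset := rewrite sem_seq sem_setr; sval.
Ltac sabs := rewrite sem_seq absrE; sput.

Section jacobi_program.
Variables (X a n : nat).
Hypothesis a8 : (8 <= a)%N.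
Hypothesis powX : forall i, (i < 60)%N -> (8 * a ^ i <= X)%N.
Hypothesis na : (n + 4 < a)%N.
Local Notation n1 := n.+1.

Lemma nX : (n1 < X)%N. Proof. have := @powX 1 isT; rewrite expn1; plia. Qed.

Definition PWs (s : state) := forall k, (k <= 60)%N -> s kPW k%:Z = (a ^ k)%N%:Z.

(** With half-angle tangent [t = k / a^12], the cosine is [rc / rw] and the sine [rs / rw]; all
    three are integers of polynomial size. *)
Definition rc (k : nat) : int := (a ^ 24)%N%:Z - (k * k)%N%:Z.
Definition rw (k : nat) : int := (a ^ 24)%N%:Z + (k * k)%N%:Z.
Definition rs (k : nat) : int := (a ^ 12)%N%:Z * k%:Z + (a ^ 12)%N%:Z * k%:Z.

Lemma rot_bounds k : (k <= a ^ 12)%N ->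
  [/\ `|rc k| <= (a ^ 24)%N%:Z, `|rw k| <= 2 * (a ^ 24)%N%:Z & `|rs k| <= 2 * (a ^ 24)%N%:Z].
Proof.
move=> h; have e : (a ^ 24 = a ^ 12 * a ^ 12)%N by rewrite -expnD.
by rewrite /rc /rw /rs e; split; pnia.
Qed.

Lemma rot_bounds2 k : (k <= a ^ 12)%N ->
  [/\ (absz (rc k) <= X)%N, (absz (rw k) <= X)%N & (absz (rs k) <= X)%N] /\
  [/\ (absz (rc k * rc k - rs k * rs k)%R <= X)%N, (absz (rc k * rs k)%R <= X)%N &
     (absz (rw k * rw k)%R <= X)%N].
Proof.
move=> h; have e : (a ^ 48 = a ^ 24 * a ^ 24)%N by rewrite -expnD.
have h24 := @powX 24 isT; have h48 := @powX 48 isT; rewrite e in h48.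
have [b1 b2 b3] := rot_bounds h.
have q0 : (0 < a ^ 24)%N by rewrite expn_gt0; plia.
move: (a ^ 24)%N q0 h24 h48 b1 b2 b3 {e} => Q q0 h24 h48 b1 b2 b3.
have Xq : (8 * Q%:Z * Q%:Z <= X%:Z) by rewrite -mulrA -!PoszM lez_nat.
have m (x y u v : int) : `|x| <= u -> `|y| <= v -> `|x * y| <= u * v.
  by move=> h1 h2; rewrite normrM ler_pM.
have c2 := m _ _ _ _ b1 b1; have s2 := m _ _ _ _ b3 b3.
have cs := m _ _ _ _ b1 b3; have w2 := m _ _ _ _ b2 b2.
split; split; plia.
Qed.

Definition csw (kk : nat) : cmd :=
  mul 35 (V kk) (V kk) ;; setr rC (HSub (PW 24) (V 35)) ;; setr rW (HAdd (PW 24) (V 35)) ;;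
  mul rS (PW 12) (V kk) ;; setr rS (HAdd (V rS) (V rS)).

Lemma cswP kk s k : (kk == rK) || (kk == rBEST) -> PWs s -> (k <= a ^ 12)%N -> s kk 0 = k%:Z ->
  let s1 := sem X (csw kk) s in [/\ s1 rC 0 = rc k, s1 rW 0 = rw k & s1 rS 0 = rs k].
Proof.
move=> kb Ps ka sk.
have kX : (`|k%:Z| <= X)%N by have := @powX 12 isT; plia.
have p24 : s kPW 24%N%:Z = (a ^ 24)%N by apply: Ps.
have p12 : s kPW 12%N%:Z = (a ^ 12)%N by apply: Ps.
case/orP: kb sk => /eqP -> sk; rewrite /csw; cbv zeta;
  (smul; [|by rewrite sk]); rewrite sk; sset; sset; (smul; [|by rewrite sk]);
  rewrite sem_setr; sval; rewrite sk ?p12 ?p24; split; by rewrite /rc /rw /rs ?PoszM.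
Qed.

(** The left side is twice the entry (p,q) after the rotation, and [rw * rw] is the factor acquired
    by the scale: relative to it, the entry is at least halved. *)
Definition okk (A : nat -> nat -> int) p q k : bool :=
  `|((rc k * rc k - rs k * rs k) * A p q + rc k * rs k * (A q q - A p p)) * 2| <=
  `|rw k * rw k * A p q|.

Definition testk : cmd :=
  csw rK ;; mul 35 (V rC) (V rC) ;; mul 36 (V rS) (V rS) ;; setr 35 (HSub (V 35) (V 36)) ;;
  mul 36 (V rC) (V rS) ;; mul 37 (V rW) (V rW) ;; mul 38 (V rAPQ) (V 35) ;;
  mul 39 (V rDQP) (V 36) ;; setr 38 (HAdd (V 38) (V 39)) ;; setr 38 (HAdd (V 38) (V 38)) ;;
  absr 38 ;; mul 39 (V rAPQ) (V 37) ;; absr 39 ;;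
  CIf (HAdd (HSub (V 39) (V 38)) (HC 1)) (setr rBEST (V rK)) CSkip.

Lemma testkP s A p q k : PWs s -> (k <= a ^ 12)%N -> s rK 0 = k%:Z ->
  s rAPQ 0 = A p q -> s rDQP 0 = A q q - A p p ->
  sem X testk s rBEST 0 = if okk A p q k then k%:Z else s rBEST 0.
Proof.
move=> Ps ka sk sa sd; rewrite /testk sem_seq.
have [c1 c2 c3] := cswP (isT : (rK == rK) || (rK == rBEST)) Ps ka sk.
have e1 : sem X (csw rK) s rAPQ 0 = A p q by rewrite frame.
have e2 : sem X (csw rK) s rDQP 0 = A q q - A p p by rewrite frame.
have e3 : sem X (csw rK) s rK 0 = k%:Z by rewrite frame.
have e4 : sem X (csw rK) s rBEST 0 = s rBEST 0 by rewrite frame.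
have [[b1 b2 b3] [b4 b5 b6]] := rot_bounds2 ka.
move: (sem X (csw rK) s) c1 c2 c3 e1 e2 e3 e4 => {Ps sk sa sd} s1 c1 c2 c3 e1 e2 e3 e4.
rewrite sem_seq; bmul ltac:(exact: b1).
rewrite sem_seq; bmul ltac:(exact: b3).
rewrite sem_seq; bset.
rewrite sem_seq; bmul ltac:(exact: b3).
rewrite sem_seq; bmul ltac:(exact: b2).
rewrite sem_seq; bmul ltac:(exact: b4).
rewrite sem_seq; bmul ltac:(exact: b5).
rewrite sem_seq; bset.
rewrite sem_seq; bset.
rewrite sem_seq; babs.
rewrite sem_seq; bmul ltac:(exact: b6).
rewrite sem_seq; babs.
rewrite sem_if !hevalE v3 v4 /okk.
set uu := `|_ + _|; set vv := `|A p q * _|.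
have -> : `|((rc k * rc k - rs k * rs k) * A p q + rc k * rs k * (A q q - A p p)) * 2| = uu.
  by rewrite /uu; congr (`|_|); ring.
have -> : `|rw k * rw k * A p q| = vv by rewrite /vv mulrC.
have -> : (0 < vv - uu + 1) = (uu <= vv) by plia.
by case: ifP => _; [rewrite sem_setr put_same hevalV|rewrite sem_skip].
Qed.

(** Index 0 is barred from being rotated, so the linear coefficients stay in row 0 and the constant
    term is only rescaled. *)
Definition bad (A : nat -> nat -> int) (E : int) p q : bool :=
  [&& (0 < p)%N, (p < q)%N, (q < n1)%N & E < `|A p q| * (a ^ 9)%N%:Z].

Definition pairbody : cmd :=
  CIf (V rI) (CIf (HSub (V rJ) (V rI)) (mul rVAL (MX kA (V rI) (V rJ)) (PW 9) ;; absr rVAL ;;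
    CIf (HSub (V rVAL) (V rE)) (setr rP (V rI) ;; setr rQ (V rJ) ;; setr rFLAG (HC 1)) CSkip)
    CSkip) CSkip.
Definition findpair : cmd :=
  setr rFLAG (HC 0) ;; CFor rI (V rN1) (CFor rJ (V rN1) pairbody).

Lemma findpairP s A E : PWs s -> rows X s -> matrep X s kA n1 A -> s rN1 0 = n1%:Z -> s rE 0 = E ->
  let s1 := sem X findpair s in
  (s1 rFLAG 0 = 0 /\ forall p q, ~~ bad A E p q) \/
  (s1 rFLAG 0 = 1 /\ exists p q, [/\ s1 rP 0 = p%:Z, s1 rQ 0 = q%:Z & bad A E p q]).
Proof.
move=> Ps rows_s As sn sE /=.
pose I i j (s' : state) :=
  (s' rFLAG 0 = 0 /\ forall p q, ((p < i) && (q < n.+1) || (p == i) && (q < j))%N -> ~~ bad A E p q) \/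
  (s' rFLAG 0 = 1 /\ exists p q, [/\ s' rP 0 = p%:Z, s' rQ 0 = q%:Z & bad A E p q]).
suff : I n1 0%N (sem X findpair s).
  case=> [[h1 h2]|h]; [left; split=> // p q|by right].
  have [/andP[h3 h4]|h3] := boolP ((p < n.+1) && (q < n.+1))%N; first by apply: h2; rewrite h3 h4.
  by rewrite /bad; plia.
apply: (@for2P X rI rJ (V rN1) pairbody (put s rFLAG 0 0) n1 I) => //.
- by have := nX; plia.
- by move=> s' fr; rewrite hevalV fr.
- by left; split=> // p q; rewrite !ltn0 andbF.
- move=> i s' [[h1 h2]|h]; [left; split=> // p q h; apply: h2; plia|by right].
move=> i j s' iN jN fr si sj Is'.
have Aij : heval s' (MX kA (V rI) (V rJ)) = A i j.
  apply: (MXE (X := X) (n := n1)) => //.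
  + by move=> i' h; rewrite fr //; exact: rows_s.
  + by move=> i' j' h h'; rewrite fr //; exact: As.
  + by have := nX; plia.
have p9 : s' kPW 9%N%:Z = (a ^ 9)%N by rewrite fr //; exact: Ps.
have sE' : s' rE 0 = E by rewrite fr.
have skip : ~~ bad A E i j -> I i j.+1 s'.
  move=> nb; case: Is' => [[h1 h2]|h]; [left; split=> // p q h|by right].
  have [/andP[/eqP-> /eqP->]//|h5] := boolP ((p == i) && (q == j)).
  by apply: h2; move: h h5; plia.
rewrite /pairbody sem_if hevalV si; case: ifP => h0; last by apply: skip; rewrite /bad; plia.
rewrite sem_if hevalE !hevalV si sj; case: ifP => h1; last by apply: skip; rewrite /bad; plia.
have X9 := @powX 9 isT.
smul; last by rewrite p9; plia.
have Aij' : s' kA (s' kROW (s' rI 0) + s' rJ 0) = A i j := Aij.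
rewrite Aij'; sabs; rewrite sem_if; sval; rewrite p9 sE'.
have eb : bad A E i j = (0 < `|A i j * (a ^ 9)%N| - E).
  by rewrite normrM /bad subr_gt0; plia.
case: ifP => h2; last first.
  rewrite sem_skip; have := skip; rewrite eb h2 => /(_ isT) [[h3 h4]|[h3 h4]]; [left|right]; split=> //.
rewrite sem_seq sem_setr sem_seq !sem_setr; sval; right; split => //; exists i, j; split=> //; sput => //.
by rewrite eb.
Qed.

Definition mm (dst src : nat) : cmd := fill2 dst (V rN1)
  (hsum rVAL rK (V rN1) (mul rV2 (MX src (V rJ) (V rK)) (MX kQ (V rK) (V rI))) rV2).

(** The transpose of the product [A B]. Applied twice with the same [B] it yields the congruence of
    [A] by [B], so one routine suffices. The bounded factor [B] drives the multiplications. *)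
Definition mmT (A B : nat -> nat -> int) (i j : nat) : int := \sum_(l < n1) A j l * B l i.

Lemma mmP (b : bool) s A B (dst := if b then kT else kA) (src := if b then kA else kT) :
  rows X s -> matrep X s src n1 A -> matrep X s kQ n1 B -> s rN1 0 = n1%:Z ->
  (forall i j, (i < n1)%N -> (j < n1)%N -> (`|B i j| <= X)%N) ->
  matrep X (sem X (mm dst src) s) dst n1 (mmT A B).
Proof.
have := nX; rewrite {}/dst {}/src; case: b => n1X rows_s As Bs sn BX;
  (apply: fill2P => //; [by plia | by move=> s' fr; rewrite hevalV fr | ];
  move=> i j s' iN jN fr si sj;
  apply: (@hsumP X rVAL rK (V rN1) _ rV2 s' n1 (fun l => A j l * B l i)) => //;
    [by plia | by move=> s'' fr'; rewrite hevalV fr' // fr | ];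
  move=> l s'' lN fr' sl).
- have Asl : heval s'' (MX kA (V rJ) (V rK)) = A j l.
    apply: (MXE (X := X) (n := n1)); rewrite ?hevalV ?sl // ?fr' //; try plia.
    + by move=> i' h; rewrite fr' // fr //; exact: rows_s.
    + by move=> i' j' h h'; rewrite fr' // fr //; exact: As.
  have Bsl : heval (put s'' 1 0 (A j l)) (MX kQ (V rK) (V rI)) = B l i.
    apply: (MXE (X := X) (n := n1)); rewrite ?hevalV; sput; rewrite ?sl // ?fr' //; try plia.
    + by move=> i' h; rewrite put_neq // fr' // fr //; exact: rows_s.
    + by move=> i' j' h h'; rewrite put_neq // fr' // fr //; exact: Bs.
  by rewrite mulP Asl Bsl //; exact: BX.
- have Asl : heval s'' (MX kT (V rJ) (V rK)) = A j l.
    apply: (MXE (X := X) (n := n1)); rewrite ?hevalV ?sl // ?fr' //; try plia.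
    + by move=> i' h; rewrite fr' // fr //; exact: rows_s.
    + by move=> i' j' h h'; rewrite fr' // fr //; exact: As.
  have Bsl : heval (put s'' 1 0 (A j l)) (MX kQ (V rK) (V rI)) = B l i.
    apply: (MXE (X := X) (n := n1)); rewrite ?hevalV; sput; rewrite ?sl // ?fr' //; try plia.
    + by move=> i' h; rewrite put_neq // fr' // fr //; exact: rows_s.
    + by move=> i' j' h h'; rewrite put_neq // fr' // fr //; exact: Bs.
  by rewrite mulP Asl Bsl //; exact: BX.
Qed.

Definition rotQ p q k (i j : nat) : int :=
  if i == p then (if j == p then rc k else if j == q then - rs k else 0)
  else if i == q then (if j == p then rs k else if j == q then rc k else 0)
  else if i == j then rw k else 0.

Definition setv e := setr rVAL e.
Definition bodyQ : cmd :=
  ceq (V rI) (V rP)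
   (ceq (V rJ) (V rP) (setv (V rC)) (ceq (V rJ) (V rQ) (setv (HSub (HC 0) (V rS))) (setv (HC 0))))
   (ceq (V rI) (V rQ)
     (ceq (V rJ) (V rP) (setv (V rS)) (ceq (V rJ) (V rQ) (setv (V rC)) (setv (HC 0))))
     (ceq (V rI) (V rJ) (setv (V rW)) (setv (HC 0)))).

Lemma fillQP s p q k : rows X s -> s rN1 0 = n1%:Z -> s rP 0 = p%:Z -> s rQ 0 = q%:Z ->
  s rC 0 = rc k -> s rW 0 = rw k -> s rS 0 = rs k ->
  matrep X (sem X (fill2 kQ (V rN1) bodyQ) s) kQ n1 (rotQ p q k).
Proof.
move=> rows_s sn sp sq sc sw ss; apply: fill2P => //; first by have := nX; plia.
  by move=> s' fr; rewrite hevalV fr.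
move=> i j s' iN jN fr si sj.
have fp : s' rP 0 = p%:Z by rewrite fr.
have fq : s' rQ 0 = q%:Z by rewrite fr.
have fc : s' rC 0 = rc k by rewrite fr.
have fw : s' rW 0 = rw k by rewrite fr.
have fs : s' rS 0 = rs k by rewrite fr.
rewrite /bodyQ !ceqP !hevalV si sj fp fq !eqz_nat /rotQ.
by do ![case: ifP => _]; rewrite /setv sem_setr; sval; rewrite ?sub0r ?fc ?fs ?fw.
Qed.

Lemma rotQ_bound p q k i j : (k <= a ^ 12)%N -> (`|rotQ p q k i j| <= X)%N.
Proof.
by move=> /rot_bounds2[[b1 b2 b3] _]; rewrite /rotQ; do ![case: ifP => _]; rewrite ?abszN.
Qed.

Definition rot A p q k := mmT (mmT A (rotQ p q k)) (rotQ p q k).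

Definition rotcmd : cmd :=
  setr rAPQ (MX kA (V rP) (V rQ)) ;;
  setr rDQP (HSub (MX kA (V rQ) (V rQ)) (MX kA (V rP) (V rP))) ;;
  setr rBEST (HC 0) ;; CFor rK (HAdd (PW 12) (HC 1)) testk ;; csw rBEST ;;
  fill2 kQ (V rN1) bodyQ ;; mm kT kA ;; mm kA kT ;;
  mul rE (V rE) (V rW) ;; mul rE (V rE) (V rW).

(** The program tries every angle and keeps the last one that passes. That some angle passes depends
    on the size of the entries and is proved separately, whence the implication. *)
Definition goodk A p q k := (k <= a ^ 12)%N /\
  ((exists2 k', (k' <= a ^ 12)%N & okk A p q k') -> okk A p q k).

Lemma rotcmdP s A E p q : PWs s -> rows X s -> matrep X s kA n1 A -> s rN1 0 = n1%:Z ->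
  s rE 0 = E -> s rP 0 = p%:Z -> s rQ 0 = q%:Z -> (p < n1)%N -> (q < n1)%N ->
  exists2 k, goodk A p q k & let s1 := sem X rotcmd s in
    matrep X s1 kA n1 (rot A p q k) /\ s1 rE 0 = E * rw k * rw k.
Proof.
move=> Ps rows_s As sn sE sp sq pN qN; have nX' := nX.
rewrite /rotcmd; do 10! rewrite sem_seq; rewrite !sem_setr.
pose s1 := put s rAPQ 0 (A p q).
pose s2 := put s1 rDQP 0 (A q q - A p p).
have e1 : heval s (MX kA (V rP) (V rQ)) = A p q by apply: (MXE (X := X) (n := n1)) => //; plia.
rewrite e1 -/s1.
have e2 : heval s1 (HSub (MX kA (V rQ) (V rQ)) (MX kA (V rP) (V rP))) = A q q - A p p.
  by rewrite hevalB; congr (_ - _); apply: (MXE (X := X) (n := n1)) => //; plia.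
rewrite e2 -/s2 hevalC; pose s3 := put s2 rBEST 0 0; rewrite -/s3.
pose I i (s' : state) := exists k, [/\ s' rBEST 0 = k%:Z, (k <= a ^ 12)%N &
  (exists2 k', (k' < i)%N & okk A p q k') -> okk A p q k].
have := @forP X rK (HAdd (PW 12) (HC 1)) testk s3 (a ^ 12).+1 I.
have X12 := @powX 12 isT.
have P' (s' : state) : (forall k', k' \notin rK :: writes testk -> s' k' = s3 k') -> PWs s'.
  by move=> fr k hk; rewrite fr //; exact: Ps.
case=> //.
- by have : (0 < a ^ 12)%N by [rewrite expn_gt0; plia]; plia.
- by move=> s' /P' Ps'; rewrite hevalD hevalG hevalC Ps' // hevalC; plia.
- by exists 0%N; split=> // -[].
- move=> i s' iN fr sk [k [I1 I2 I3]].
  have sA : s' rAPQ 0 = A p q by rewrite fr.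
  have sD : s' rDQP 0 = A q q - A p p by rewrite fr.
  rewrite /I (testkP (P' _ fr) iN sk sA sD); case: ifP => ok; first by exists i; split.
  exists k; split=> // -[k' k'i okk']; apply: I3; exists k' => //.
  have : k' != i by apply: contraFneq ok => <-.
  plia.
move=> k [k1 k2 k3]; exists k.
  split=> // -[k' k'1 k'2]; apply: k3; exists k' => //; plia.
pose s4 := sem X (CFor rK (HAdd (PW 12) (HC 1)) testk) s3; rewrite -/s4 in k1 *.
have Ps4 : PWs s4 by move=> k' hk'; rewrite /s4 frame //; exact: Ps.
have [c1 c2 c3] := cswP (isT : (rBEST == rK) || (rBEST == rBEST)) Ps4 k2 k1.
pose s5 := sem X (csw rBEST) s4; rewrite -/s5 in c1 c2 c3 *.
have fr5 k' : k' \notin writes (csw rBEST) -> k' \notin writes (CFor rK (HAdd (PW 12) (HC 1)) testk) -> k' \notin [:: rAPQ; rDQP; rBEST] ->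
    s5 k' = s k'.
  move=> h1 h2 h3; rewrite /s5 frame // /s4 frame //.
  by move: h3; rewrite !inE !negb_or => /and3P[m1 m2 m3]; rewrite /s3 /s2 /s1 !put_neq.
have rows5 : rows X s5 by move=> i h; rewrite fr5 //; exact: rows_s.
have A5 : matrep X s5 kA n1 A by move=> i j h h'; rewrite fr5 //; exact: As.
have n5 : s5 rN1 0 = n1%:Z by rewrite fr5.
have p5 : s5 rP 0 = p%:Z by rewrite fr5.
have q5 : s5 rQ 0 = q%:Z by rewrite fr5.
have E5 : s5 rE 0 = E by rewrite fr5.
have Q6 := fillQP rows5 n5 p5 q5 c1 c2 c3.
pose s6 := sem X (fill2 kQ (V rN1) bodyQ) s5; rewrite -/s6 in Q6 *.
have rows6 : rows X s6 by move=> i h; rewrite /s6 frame //; exact: rows5.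
have A6 : matrep X s6 kA n1 A by move=> i j h h'; rewrite /s6 frame //; exact: A5.
have n6 : s6 rN1 0 = n1%:Z by rewrite /s6 frame.
have QX i j : (i < n1)%N -> (j < n1)%N -> (`|rotQ p q k i j| <= X)%N by move=> _ _; exact: rotQ_bound.
have T7 := @mmP true s6 A (rotQ p q k) rows6 A6 Q6 n6 QX.
pose s7 := sem X (mm kT kA) s6; rewrite -/s7 in T7 *.
have rows7 : rows X s7 by move=> i h; rewrite /s7 frame //; exact: rows6.
have Q7 : matrep X s7 kQ n1 (rotQ p q k) by move=> i j h h'; rewrite /s7 frame //; exact: Q6.
have n7 : s7 rN1 0 = n1%:Z by rewrite /s7 frame.
have A8 := @mmP false s7 _ (rotQ p q k) rows7 T7 Q7 n7 QX.
pose s8 := sem X (mm kA kT) s7; rewrite -/s8 in A8 *.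
have W8 : s8 rW 0 = rw k by rewrite /s8 frame // /s7 frame // /s6 frame.
have E8 : s8 rE 0 = E by rewrite /s8 frame // /s7 frame // /s6 frame.
have [[_ wX _] _] := rot_bounds2 k2.
pose s9 := sem X (mul rE (V rE) (V rW)) s8.
have E9 : s9 rE 0 = E * rw k by exact: (mulV rE E8 W8).
have W9 : s9 rW 0 = rw k by rewrite /s9 frame.
have E10 : sem X (mul rE (V rE) (V rW)) s9 rE 0 = E * rw k * rw k by exact: (mulV rE E9 W9).
have A10 : matrep X (sem X (mul rE (V rE) (V rW)) s9) kA n1 (rot A p q k).
  by move=> i j h h'; rewrite frame // /s9 frame //; exact: A8.
exact: (conj A10 E10).
Qed.

Definition jstep : cmd := findpair ;; CIf (V rFLAG) rotcmd CSkip.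

(* [jac A0 E0 r A E]: [r] iterations of the Jacobi loop may lead from the
   quadratic form A0 / E0 to A / E. *)
Inductive jac (A0 : nat -> nat -> int) (E0 : int) : nat -> (nat -> nat -> int) -> int -> Prop :=
| Jac0 : jac A0 E0 0 A0 E0
| JacStop r A E : jac A0 E0 r A E -> (forall p q, ~~ bad A E p q) -> jac A0 E0 r.+1 A E
| JacRot r A E p q k : jac A0 E0 r A E -> bad A E p q -> goodk A p q k ->
    jac A0 E0 r.+1 (rot A p q k) (E * rw k * rw k).

Lemma jacobiP s A0 E0 : PWs s -> rows X s -> matrep X s kA n1 A0 -> s rN1 0 = n1%:Z ->
  s rE 0 = E0 -> let s1 := sem X (CLoop rR jstep) s in
  exists A E, [/\ jac A0 E0 X A E, matrep X s1 kA n1 A & s1 rE 0 = E].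
Proof.
move=> Ps rows_s As sn sE.
apply: (@loopP X rR jstep s (fun r s1 =>
  exists A E, [/\ jac A0 E0 r A E, matrep X s1 kA n1 A & s1 rE 0 = E])) => //.
- by exists A0, E0; split; [exact: Jac0| |].
move=> r s' rX fr _ [A [E [jA mA sE']]].
have Ps' : PWs s' by move=> k hk; rewrite fr //; exact: Ps.
have rows' : rows X s' by move=> i h; rewrite fr //; exact: rows_s.
have n' : s' rN1 0 = n1%:Z by rewrite fr.
rewrite /jstep sem_seq sem_if hevalV.
have [[f0 nb]|[f1 [p [q [sp sq bpq]]]]] := findpairP Ps' rows' mA n' sE'.
  rewrite f0 ltxx sem_skip; exists A, E; split; first exact: JacStop.
    by move=> i j h h'; rewrite frame //; exact: mA.
  by rewrite frame.
rewrite f1 ltr01; pose s2 := sem X findpair s'; rewrite -/s2 in sp sq *.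
have /and4P[p0 pq qn _] := bpq.
have [||||||k gk [m1 m2]] := @rotcmdP s2 A E p q _ _ _ _ _ sp sq _ qn.
- by move=> k hk; rewrite /s2 frame //; exact: Ps'.
- by move=> i h; rewrite /s2 frame //; exact: rows'.
- by move=> i j h h'; rewrite /s2 frame //; exact: mA.
- by rewrite /s2 frame.
- by rewrite /s2 frame.
- by plia.
by exists (rot A p q k), (E * rw k * rw k); split=> //; exact: JacRot.
Qed.

End jacobi_program.

(** * The dynamic program *)

Notation rL := 43%N.
Notation rVI := 44%N.
Notation kU := 45%N.
Notation kV := 46%N.
Notation kUJ := 47%N.
Notation rSS := 48%N.
Notation rLAM := 49%N.
Notation rMU := 50%N.
Notation rDEN := 52%N.
Notation rK3 := 56%N.
Notation rCNT := 57%N.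
Notation rTOT := 58%N.
Notation rC2 := 59%N.
Notation rACC := 60%N.
Notation rTH := 61%N.
Notation rJJ := 62%N.

Section dp_program.
Variables (X a n : nat) (A : nat -> nat -> int) (E : int) (VM : nat).
Hypothesis a8 : (8 <= a)%N.
Hypothesis powX : forall i, (i < 60)%N -> (8 * a ^ i <= X)%N.
Hypothesis na : (n + 4 < a)%N.
Local Notation n1 := n.+1.
Local Notation J := (a ^ 10)%N.

(** The grid point is [tt j / a^9]; for [j < J + J] the grid covers the interval from [-a] to
    [a]. *)
Definition tt (j : nat) : int := j%:Z - J%:Z.
(** This is [2 a^25 (1 - x^2 / (2 a^7))] at [x = tt j / a^9]. The common factor cancels on
    normalising the weights. *)
Definition ut (j : nat) : int := (a ^ 25)%N%:Z + (a ^ 25)%N%:Z - tt j * tt j.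
Definition wt (j : nat) : int := ut j ^+ (a ^ 7)%N.
(** Divided by [den] this is [a^7 (lambda x^2 + mu x + a^4)], with [lambda = A i i / E] and
    [mu = 2 A 0 i / E]. The shift [a^4] makes it nonnegative on the grid, so that partial sums can
    index a table, and [a^7] is the precision of the rounding. *)
Definition numv (i j : nat) : int :=
  (A i i * (tt j * tt j) + (A 0%N i * tt j * (a ^ 9)%N%:Z + A 0%N i * tt j * (a ^ 9)%N%:Z)
   + E * (a ^ 22)%N%:Z) * (a ^ 7)%N%:Z.
Definition den : int := E * (a ^ 18)%N%:Z.
Definition Vv (i j : nat) : int := (numv i j %/ den)%Z.
(** The constant term at the scale of the rounded sums, less the [n] shifts by [a^4 * a^7]. *)
Definition K3 : int := A 0%N 0%N * (a ^ 7)%N%:Z - E * (a ^ 11)%N%:Z * n%:Z.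
Definition dcond (s : nat) : int := if 0 < E * s%:Z + K3 + 1 then 1 else 0.
(** The weighted number of grid points for the last [l] variables that bring the partial sum [s] to
    a nonnegative value of the form; [Uf n 0 / Wt ^ n] approximates the wanted probability. *)
Fixpoint Uf (l s : nat) : int :=
  if l is l'.+1 then \sum_(j < J + J) Uf l' (s + `|Vv (n - l') j|) * wt j else dcond s.
Definition Wt : int := \sum_(j < J + J) wt j.
Definition TW (k : nat) : int := \sum_(k <= j < J + J) wt j.

Hypothesis numv_bound : forall i j, (0 < i <= n)%N -> (j < J + J)%N ->
  0 <= numv i j /\ numv i j < den * (VM.+1)%:Z.
Hypothesis E0 : 0 < E.
Hypothesis VMX : (n.+1 * VM.+1 < X)%N.

Lemma JX : (J + J < X)%N.
Proof. have := @powX 10 isT; have : (0 < J)%N by [rewrite expn_gt0; plia]; plia. Qed.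

Lemma den_gt0 : 0 < den.
Proof. by have : (0 < a ^ 18)%N by [rewrite expn_gt0; plia]; rewrite /den; pnia. Qed.

Lemma tt_bound j : (j < J + J)%N -> `|tt j| <= J%:Z.
Proof. rewrite /tt; plia. Qed.

Lemma ttX j : (j < J + J)%N -> (absz (tt j) <= X)%N.
Proof. move=> /tt_bound; have := JX; plia. Qed.

Lemma tt2_bound j : (j < J + J)%N -> 0 <= tt j * tt j <= (a ^ 20)%N%:Z.
Proof.
move=> /tt_bound h; rewrite -expr2 sqr_ge0 /= -[leLHS]ger0_norm ?sqr_ge0 // normrX.
by rewrite (_ : 20 = 10 * 2)%N // expnM -[X in _ <= X]/((J ^ 2)%N%:Z) -mulnn PoszM expr2 ler_pM.
Qed.

Lemma tt2X j : (j < J + J)%N -> (absz (tt j * tt j)%R <= X)%N.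
Proof. move=> /tt2_bound; have := @powX 20 isT; plia. Qed.

Lemma ut_bound j : (j < J + J)%N -> (a ^ 25)%N%:Z <= ut j <= 2 * (a ^ 25)%N%:Z.
Proof.
move=> /tt2_bound; rewrite /ut.
have : (a ^ 20 <= a ^ 25)%N by rewrite leq_pexp2l //; plia.
plia.
Qed.

Lemma ut_gt0 j : (j < J + J)%N -> 0 < ut j.
Proof. by move=> /ut_bound; have : (0 < a ^ 25)%N by [rewrite expn_gt0; plia]; plia. Qed.

Lemma utX j : (j < J + J)%N -> (absz (ut j) <= X)%N.
Proof. move=> h; have := ut_bound h; have := @powX 25 isT; plia. Qed.

Lemma wt_gt0 j : (j < J + J)%N -> 0 < wt j.
Proof. by move=> h; rewrite exprn_gt0 // ut_gt0. Qed.

Lemma Vv_bound i j : (0 < i <= n)%N -> (j < J + J)%N -> 0 <= Vv i j <= VM%:Z.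
Proof.
move=> h1 h2; have [b1 b2] := numv_bound h1 h2; have d0 := den_gt0.
rewrite /Vv divz_ge0 // b1 /=.
have : (numv i j %/ den)%Z < (VM.+1)%:Z by rewrite ltz_divLR // mulrC.
plia.
Qed.

Definition J2 : hexp := HAdd (PW 10) (PW 10).

Definition bodyUJ : cmd := setr 53 (HSub (V rJ) (PW 10)) ;; mul 54 (V 53) (V 53) ;;
  setr rVAL (HSub (HAdd (PW 25) (PW 25)) (V 54)).

Lemma bodyUJP s j : PWs a s -> (j < J + J)%N -> s rJ 0 = j%:Z -> sem X bodyUJ s rVAL 0 = ut j.
Proof.
move=> Ps jJ sj; have p10 : s kPW 10%N%:Z = J%:Z by apply: Ps.
have p25 : s kPW 25%N%:Z = (a ^ 25)%N%:Z by apply: Ps.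
rewrite /bodyUJ sem_seq; bset; rewrite sem_seq; bmul ltac:(exact: ttX).
by rewrite setrV !hevalE v0 p25.
Qed.

Definition bodyC : cmd := mul 53 (V rE) (V rSS) ;; setr 53 (HAdd (V 53) (V rK3)) ;;
  CIf (HAdd (V 53) (HC 1)) (setr rVAL (HC 1)) (setr rVAL (HC 0)).

Lemma bodyCP s k : (k < X)%N -> s rE 0 = E -> s rK3 0 = K3 -> s rSS 0 = k%:Z ->
  sem X bodyC s rVAL 0 = dcond k.
Proof.
move=> kX sE sK sS; rewrite /bodyC sem_seq; bmul ltac:(by rewrite absz_nat ltnW).
by rewrite sem_seq; bset; rewrite sem_if !hevalE v0 /dcond; case: ifP.
Qed.

Definition bodyV : cmd := setr 53 (HSub (V rJ) (PW 10)) ;; mul 54 (V 53) (V 53) ;;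
  mul 54 (V rLAM) (V 54) ;; mul 55 (V rMU) (V 53) ;; setr 63 (PW 9) ;; mul 55 (V 55) (V 63) ;;
  setr 55 (HAdd (V 55) (V 55)) ;; setr 63 (PW 22) ;; mul 63 (V rE) (V 63) ;;
  setr 54 (HAdd (V 54) (V 55)) ;; setr 54 (HAdd (V 54) (V 63)) ;; setr 63 (PW 7) ;;
  mul 54 (V 54) (V 63) ;; hdiv rVAL (V 54) (V rDEN).

Lemma bodyVP s i j : PWs a s -> (0 < i <= n)%N -> (j < J + J)%N -> s rJ 0 = j%:Z ->
  s rLAM 0 = A i i -> s rMU 0 = A 0%N i -> s rE 0 = E -> s rDEN 0 = den ->
  sem X bodyV s rVAL 0 = Vv i j.
Proof.
move=> Ps iN jJ sj sl sm sE sD.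
have p10 : s kPW 10%N%:Z = J%:Z by apply: Ps.
have p9 : s kPW 9%N%:Z = (a ^ 9)%N%:Z by apply: Ps.
have p22 : s kPW 22%N%:Z = (a ^ 22)%N%:Z by apply: Ps.
have p7 : s kPW 7%N%:Z = (a ^ 7)%N%:Z by apply: Ps.
have X9 := @powX 9 isT; have X22 := @powX 22 isT; have X7 := @powX 7 isT.
clear Ps; rewrite /bodyV.
rewrite sem_seq; bset; rewrite sem_seq; bmul ltac:(exact: ttX).
rewrite sem_seq; bmul ltac:(exact: tt2X); rewrite sem_seq; bmul ltac:(exact: ttX).
rewrite sem_seq; bset; rewrite sem_seq; bmul ltac:(by plia).
rewrite sem_seq; bset; rewrite sem_seq; bset; rewrite sem_seq; bmul ltac:(by plia).
rewrite sem_seq; bset; rewrite sem_seq; bset; rewrite sem_seq; bset.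
rewrite sem_seq; bmul ltac:(by plia).
have [b1 b2] := numv_bound iN jJ.
match goal with |- sem X _ ?s' _ _ = _ => have nv : s' 54%N 0 = numv i j by assumption end.
have VX : (VM.+1 <= X)%N by pnia.
have d0 := den_gt0.
rewrite hdivP ?hevalV ?put_neq ?nv ?sD //.
by apply: lt_le_trans b2 _; rewrite ler_pM2l // lez_nat.
Qed.

Definition powJ (e u : hexp) : cmd := mulpow rV2 e u (PW 7).

Lemma powJP s y u vy j : PWs a s -> (j < J + J)%N -> heval s y = vy ->
  (forall s', (forall k, k \notin [:: 1; 2; 3; 4; 5; rV2]%N -> s' k = s k) -> heval s' u = ut j) ->
  sem X (powJ y u) s rV2 0 = vy * wt j.
Proof.
move=> Ps jJ <- hu; rewrite (@mulpowP _ _ _ _ _ _ (a ^ 7)%N (ut j)) //.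
- by have := @powX 7 isT; plia.
- by move=> s' fr; rewrite hevalG hevalC fr // Ps.
- exact: utX.
Qed.

Definition bodyU : cmd := hsum rVAL rJ J2
  (powJ (HG kU (HAdd (HAdd (HG kROW (V rL)) (V rSS)) (HG kV (V rJ)))) (HG kUJ (V rJ))) rV2.
Definition level : cmd :=
  setr rVI (HSub (V rN) (V rL)) ;; setr rLAM (MX kA (V rVI) (V rVI)) ;;
  setr rMU (HG kA (V rVI)) ;; fill kV (HC 0) rJ J2 bodyV rVAL ;;
  fill kU (HG kROW (HAdd (V rL) (HC 1))) rSS (V XR) bodyU rVAL.

Record dpctx (s : state) : Prop := DpCtx {
  dXR : s XR 0 = X%:Z; dPW : PWs a s; drows : rows X s; dA : matrep X s kA n1 A;
  dN : s rN 0 = n%:Z; dE : s rE 0 = E; dDEN : s rDEN 0 = den;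
  dUJ : forall j, (j < J + J)%N -> s kUJ j%:Z = ut j }.

Lemma dpctx_frame s s' : dpctx s ->
  (forall k, k \in [:: XR; kPW; kROW; kA; rN; rE; rDEN; kUJ] -> s' k = s k) -> dpctx s'.
Proof.
move=> [h1 h2 h3 h4 h5 h6 h7 h8] fr; split.
- by rewrite fr.
- by move=> k hk; rewrite fr //; exact: h2.
- by move=> i hi; rewrite fr //; exact: h3.
- by move=> i j hi hj; rewrite fr //; exact: h4.
- by rewrite fr.
- by rewrite fr.
- by rewrite fr.
- by move=> j hj; rewrite fr //; exact: h8.
Qed.

Lemma J2P s : PWs a s -> heval s J2 = (J + J)%N%:Z.
Proof. by move=> Ps; rewrite hevalD hevalG hevalC !Ps. Qed.

(** Each level adds at most [VM] to the index, so the correct part of a row shrinks by [VM] per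
    level. The final lookup is at index 0 of row [n], and [n * VM < X]. *)
Lemma levelP s l : dpctx s -> (l < n)%N -> s rL 0 = l%:Z ->
  (forall k, (k + l * VM < X)%N -> s kU (l * X + k)%N%:Z = Uf l k) ->
  let s1 := sem X level s in
  forall k, (k + l.+1 * VM < X)%N -> s1 kU (l.+1 * X + k)%N%:Z = Uf l.+1 k.
Proof.
move=> ctx lN sL Ul; cbv zeta; rewrite /level.
have [h1 h2 h3 h4 h5 h6 h7 h8] := ctx.
have iN : (0 < n - l <= n)%N by plia.
have nX : (n1 < X)%N by have := @powX 1 isT; rewrite expn1; plia.
pose s2 := put s rVI 0 (n - l)%N%:Z.
have e1 : heval s (HSub (V rN) (V rL)) = (n - l)%N%:Z by rewrite !hevalE h5 sL; plia.
rewrite sem_seq sem_setr e1 -/s2.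
have e2 : heval s2 (MX kA (V rVI) (V rVI)) = A (n - l)%N (n - l)%N.
  by apply: (MXE (X := X) (n := n1)) => //; plia.
pose s3 := put s2 rLAM 0 (A (n - l)%N (n - l)%N).
rewrite sem_seq sem_setr e2 -/s3.
have e3 : heval s3 (HG kA (V rVI)) = A 0%N (n - l)%N.
  have := h4 0%N (n - l)%N isT; rewrite mul0n add0n => <- //; plia.
pose s4 := put s3 rMU 0 (A 0%N (n - l)%N).
rewrite sem_seq sem_setr e3 -/s4.
have ctx4 : dpctx s4.
  apply: dpctx_frame ctx _ => k; rewrite !inE => kk; rewrite /s4 /s3 /s2 !put_neq //; plia.
rewrite sem_seq.
pose s5 := sem X (fill kV (HC 0) rJ J2 bodyV rVAL) s4; rewrite -/s5.
have [||||||V5 _] := @fillP X kV (HC 0) rJ J2 bodyV rVAL s4 (J + J) 0 (fun j => Vv (n - l) j) => //.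
- by have := JX; plia.
- move=> s' fr; split => //; apply: J2P => k hk; rewrite fr //; exact: (dPW ctx4).
- move=> j s' jJ fr _ sj.
  have cs' : dpctx s'.
    apply: dpctx_frame ctx4 _ => k; rewrite !inE => kk; apply: fr.
    by do ![case/orP: kk => [/eqP->//|kk]]; move/eqP: kk => ->.
  by apply: (bodyVP (dPW cs') iN jJ sj); rewrite ?(dE cs') ?(dDEN cs') ?fr.
have V5' j : (j < J + J)%N -> s5 kV j%:Z = Vv (n - l) j by move=> hj; have := V5 j hj.
have ctx5 : dpctx s5.
  apply: dpctx_frame ctx4 _ => k; rewrite !inE => kk; rewrite /s5 frame //.
  by do ![case/orP: kk => [/eqP->//|kk]]; move/eqP: kk => ->.
have L5 : s5 rL 0 = l%:Z by rewrite /s5 frame.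
have U5 k : (k + l * VM < X)%N -> s5 kU (l * X + k)%N%:Z = Uf l k.
  by move=> hk; rewrite /s5 frame //; exact: Ul.
have [||||||U6 _] := @fillR X kU (HG kROW (HAdd (V rL) (HC 1))) rSS (V XR) bodyU rVAL s5 X
   (l.+1 * X)%N%:Z (fun k x => (k + l.+1 * VM < X)%N -> x = Uf l.+1 k) => //.
- move=> s' fr; split; first by rewrite hevalV fr // (dXR ctx5).
  rewrite !hevalE !fr // L5 (_ : l%:Z + 1 = l.+1%:Z) ?(drows ctx5) //; plia.
- move=> k s' kX fr frU sk kl.
  have Ps' : PWs a s' by move=> k' hk; rewrite fr //; exact: (dPW ctx5).
  apply: (@hsumP X rVAL rJ J2 _ rV2 s' (J + J) (fun j => Uf l (k + `|Vv (n - l) j|)%N * wt j)) => //.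
  + by have := JX; plia.
  + by move=> s'' fr'; apply: J2P => k' hk; rewrite fr' //; exact: Ps'.
  move=> j s'' jJ fr' sj.
  have /andP[v0 v1] := Vv_bound iN jJ.
  have eV : s'' kV j%:Z = Vv (n - l) j by rewrite fr' // fr // V5'.
  apply: powJP => //.
  * by move=> k' hk; rewrite fr' //; exact: Ps'.
  * change (s'' kU (s'' kROW (s'' rL 0) + s'' rSS 0 + s'' kV (s'' rJ 0)) = Uf l (k + `|Vv (n - l) j|)%N).
    have f1 : s'' kROW (s'' rL 0) = (l * X)%N%:Z.
      by rewrite fr' // fr' // fr // fr // L5 (drows ctx5) //; plia.
    have f2 : s'' rSS 0 = k%:Z by rewrite fr'.
    have f3 : s'' kU = s' kU by rewrite fr'.
    rewrite f1 f2 f3 sj eV.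
    have -> : (l * X)%N%:Z + k%:Z + Vv (n - l) j = (l * X + (k + `|Vv (n - l) j|))%N%:Z by plia.
    have kV' : (k + `|Vv (n - l) j| + l * VM < X)%N by move: kl; rewrite mulSn; plia.
    rewrite frU; first exact: U5.
    apply/orP; left; rewrite ltz_nat mulSn; plia.
  * move=> s3' fr3; change (s3' kUJ (s3' rJ 0) = ut j).
    by rewrite (fr3 rJ) // sj fr3 // fr' // fr //; exact: (dUJ ctx5).
move=> k hk; rewrite PoszD; apply: U6 => //; plia.
Qed.

Lemma Uf_loop s : dpctx s -> (forall k, (k < X)%N -> s kU k%:Z = dcond k) ->
  let s1 := sem X (CFor rL (V rN) level) s in
  forall k, (k + n * VM < X)%N -> s1 kU (n * X + k)%N%:Z = Uf n k.
Proof.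
move=> ctx U0.
pose I l (s' : state) := forall k, (k + l * VM < X)%N -> s' kU (l * X + k)%N%:Z = Uf l k.
suff : I n (sem X (CFor rL (V rN) level) s) by [].
apply: (@forP X rL (V rN) level s n I) => //.
- by have := @powX 1 isT; rewrite expn1; plia.
- by move=> s' fr; rewrite hevalV fr // (dN ctx).
- by move=> k hk; rewrite mul0n add0n; apply: U0; plia.
move=> l s' lN fr sL Il; apply: levelP => //.
apply: dpctx_frame ctx _ => k; rewrite !inE => kk; apply: fr.
by do ![case/orP: kk => [/eqP->//|kk]]; move/eqP: kk => ->.
Qed.

Definition setK3 : cmd := setr 53 (HG kA (HC 0)) ;; setr 63 (PW 7) ;; mul 53 (V 53) (V 63) ;;
  setr 63 (PW 11) ;; mul 54 (V rE) (V 63) ;; mul 54 (V 54) (V rN) ;; setr rK3 (HSub (V 53) (V 54)) ;;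
  setr 63 (PW 18) ;; mul rDEN (V rE) (V 63).

Lemma setK3P s : PWs a s -> s kA 0 = A 0%N 0%N -> s rN 0 = n%:Z -> s rE 0 = E ->
  let s1 := sem X setK3 s in s1 rK3 0 = K3 /\ s1 rDEN 0 = den.
Proof.
move=> Ps sA sN sE; cbv zeta; rewrite /setK3.
have p11 : s kPW 11%N%:Z = (a ^ 11)%N%:Z by apply: Ps.
have p18 : s kPW 18%N%:Z = (a ^ 18)%N%:Z by apply: Ps.
have p7 : s kPW 7%N%:Z = (a ^ 7)%N%:Z by apply: Ps.
have X11 := @powX 11 isT; have X18 := @powX 18 isT; have X7 := @powX 7 isT.
have X1 := @powX 1 isT; rewrite expn1 in X1.
clear Ps.
rewrite sem_seq; bset; rewrite sem_seq; bset; rewrite sem_seq; bmul ltac:(by plia).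
rewrite sem_seq; bset; rewrite sem_seq; bmul ltac:(by plia); rewrite sem_seq; bmul ltac:(by plia).
rewrite sem_seq; bset; rewrite sem_seq; bset.
split; first by rewrite frame.
match goal with |- sem X _ ?s' _ _ = _ =>
  match goal with H1 : s' rE 0 = _ |- _ => match goal with H2 : s' 63%N 0 = _ |- _ =>
    by rewrite (mulV rDEN H1 H2) //; plia end end end.
Qed.

(** [Wt] has no polynomial bound and cannot drive a multiplication: a product with [Wt] is computed
    as the sum of the products with the single weights, each by [a ^ 7] multiplications by
    [ut j]. *)
Definition totals : cmd := setr rTOT (HC 1) ;;
  CFor rL (V rN) (hsum rVAL rJ J2 (powJ (V rTOT) (HG kUJ (V rJ))) rV2 ;; setr rTOT (V rVAL)).

Lemma totalsP s : dpctx s -> sem X totals s rTOT 0 = Wt ^+ n.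
Proof.
move=> ctx.
pose c := hsum rVAL rJ J2 (powJ (V rTOT) (HG kUJ (V rJ))) rV2 ;; setr rTOT (V rVAL).
apply: (@forP X rL (V rN) c (put s rTOT 0 1) n (fun l s' => s' rTOT 0 = Wt ^+ l)) => //.
- by have := @powX 1 isT; rewrite expn1; plia.
- by move=> s' fr; rewrite hevalV fr //; exact: (dN ctx).
move=> l s' lN fr sL Il; rewrite /c sem_seq setrV hevalV.
have Ps' : PWs a s' by move=> k' hk; rewrite fr //; exact: (dPW ctx).
rewrite (@hsumP X rVAL rJ J2 _ rV2 s' (J + J) (fun j => Wt ^+ l * wt j)) => //.
- by rewrite -mulr_sumr exprSr.
- by have := JX; plia.
- by move=> s'' fr'; apply: J2P => k' hk; rewrite fr' //; exact: Ps'.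
move=> j s'' jJ fr' sj; apply: powJP => //.
- by move=> k' hk; rewrite fr' //; exact: Ps'.
- by rewrite hevalV fr'.
- move=> s3 fr3; change (s3 kUJ (s3 rJ 0) = ut j).
  by rewrite (fr3 rJ) // sj fr3 // fr' // fr //; exact: (dUJ ctx).
Qed.

Definition calcC2 : cmd := hsum rC2 rJ J2 (powJ (V rCNT) (HG kUJ (V rJ))) rV2.

Lemma calcC2P s cnt : dpctx s -> s rCNT 0 = cnt -> sem X calcC2 s rC2 0 = cnt * Wt.
Proof.
move=> ctx sc; rewrite (@hsumP X rC2 rJ J2 _ rV2 s (J + J) (fun j => cnt * wt j)) => //.
- by rewrite -mulr_sumr.
- by have := JX; plia.
- by move=> s'' fr'; apply: J2P => k' hk; rewrite fr' //; exact: (dPW ctx).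
move=> j s'' jJ fr' sj; apply: powJP => //.
- by move=> k' hk; rewrite fr' //; exact: (dPW ctx).
- by rewrite hevalV fr'.
- move=> s3 fr3; change (s3 kUJ (s3 rJ 0) = ut j).
  by rewrite (fr3 rJ) // sj fr3 // fr' //; exact: (dUJ ctx).
Qed.

(** The scan runs from the right end of the grid and accumulates the tail times [tot]. Comparing it
    with [Uf * Wt] is the comparison of [TW / Wt] with [Uf / Wt ^ n] without denominators. *)
Definition thbody : cmd := setr rJJ (HSub (HSub J2 (HC 1)) (V rJ)) ;;
  powJ (V rTOT) (HG kUJ (V rJJ)) ;; setr rACC (HAdd (V rACC) (V rV2)) ;;
  CIf (HAdd (HSub (V rC2) (V rACC)) (HC 1)) (setr rTH (V rJJ)) CSkip.
Definition theta : cmd := setr rACC (HC 0) ;; setr rTH J2 ;; CFor rJ J2 thbody.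

Lemma TW_gt0 k : (k < J + J)%N -> TW k = wt k + TW k.+1.
Proof. by move=> h; rewrite /TW big_ltn. Qed.

Lemma thetaP s tot c2 : dpctx s -> s rTOT 0 = tot -> s rC2 0 = c2 -> 0 < tot -> 0 <= c2 ->
  exists th, [/\ sem X theta s rTH 0 = th%:Z, (th <= J + J)%N, tot * TW th <= c2 &
    th = 0%N \/ c2 < tot * TW th.-1].
Proof.
move=> ctx st sc t0 c0.
pose I i (s' : state) := s' rACC 0 = tot * TW (J + J - i) /\
  exists th, [/\ s' rTH 0 = th%:Z, (J + J - i <= th <= J + J)%N, tot * TW th <= c2 &
    th = (J + J - i)%N \/ c2 < tot * TW th.-1 /\ (J + J - i < th)%N].
have JJX : (J + J <= X)%N by have := JX; plia.
pose s1 := put s rACC 0 0; pose s2 := put s1 rTH 0 (J + J)%N%:Z.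
have e0 : sem X theta s = sem X (CFor rJ J2 thbody) s2.
  rewrite /theta sem_seq sem_setr hevalC sem_seq sem_setr -/s1 J2P //.
  by move=> k hk; exact: (dPW ctx).
have : I (J + J)%N (sem X theta s); last first.
  rewrite e0; move=> [_ [th [h1 /andP[_ h2] h3 h4]]]; exists th; split=> //.
  by move: h4; rewrite subnn; case=> [|[]]; [left|right].
rewrite e0; apply: (@forP X rJ J2 thbody s2 (J + J)%N I) => //.
- by move=> s' fr; apply: J2P => k hk; rewrite fr //; exact: (dPW ctx).
- have TWe : TW (J + J)%N = 0 by rewrite /TW big_geq.
  rewrite /I subn0 TWe mulr0; split=> //; exists (J + J)%N; split; [by []|by rewrite leqnn|by rewrite TWe mulr0|by left].
move=> i s' iJ fr sj [I1 [th [I2 I3 I4 I5]]]; rewrite /thbody.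
have Ps' : PWs a s' by move=> k' hk; rewrite fr //; exact: (dPW ctx).
have t' : s' rTOT 0 = tot by rewrite fr.
have c' : s' rC2 0 = c2 by rewrite fr.
have u' j : (j < J + J)%N -> s' kUJ j%:Z = ut j by move=> h; rewrite fr //; exact: (dUJ ctx).
pose jj := (J + J - i.+1)%N.
have jjJ : (jj < J + J)%N by rewrite /jj; plia.
have ejj : heval s' (HSub (HSub J2 (HC 1)) (V rJ)) = jj%:Z.
  by rewrite !hevalB J2P // hevalC hevalV sj /jj; plia.
rewrite sem_seq sem_setr ejj.
pose s3 := put s' rJJ 0 jj%:Z; rewrite -/s3.
have p3 : sem X (powJ (V rTOT) (HG kUJ (V rJJ))) s3 rV2 0 = tot * wt jj.
  apply: powJP => //.
  move=> s4 fr4; change (s4 kUJ (s4 rJJ 0) = ut jj).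
  by rewrite (fr4 rJJ) // fr4 //; exact: u'.
have q1 : s3 rACC 0 = tot * TW (J + J - i) by [].
have q2 : s3 rTH 0 = th%:Z by [].
have q3 : s3 rC2 0 = c2 by [].
have q4 : s3 rJJ 0 = jj%:Z by [].
rewrite sem_seq; move: (s3) p3 q1 q2 q3 q4 => {s3} s3 p3 q1 q2 q3 q4.
adv p3; rewrite sem_seq; bset.
have TWjj : TW (J + J - i)%N + wt jj = TW jj.
  rewrite (TW_gt0 jjJ) addrC; congr (_ + TW _); rewrite /jj; plia.
rewrite -mulrDr TWjj in v.
have wj : 0 < wt jj by exact: wt_gt0.
rewrite /I sem_if !hevalE q3 v -/jj; case: ifP => h.
  rewrite sem_setr hevalV q4; split; first by rewrite put_neq.
  exists jj; split; [exact: put_same|by rewrite leqnn ltnW|plia|by left].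
rewrite sem_skip; split=> //; exists th; split=> //.
  by move: I3; rewrite /jj; plia.
right; case: I5 => [eth|[h1 h2]]; split=> //; rewrite /jj; try plia.
have -> : th.-1 = jj by rewrite eth /jj; plia.
plia.
Qed.

End dp_program.

(** * Convergence of the Jacobi iteration *)

Section rotation_sums.
Variables (K : comPzRingType) (n1 p q : nat) (c s w : K).
Hypotheses (pn : (p < n1)%N) (qn : (q < n1)%N) (pq : p != q).

(** Taken over an arbitrary commutative ring, so that the same computation serves the integer
    matrices of the program and their images in the reals. *)
Definition rotG (i j : nat) : K :=
  if i == p then (if j == p then c else if j == q then - s else 0)
  else if i == q then (if j == p then s else if j == q then c else 0)
  else if i == j then w else 0.

Let sum2 (F : nat -> K) : (forall i, i != p -> i != q -> F i = 0) ->
  \sum_(i < n1) F i = F p + F q.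
Proof.
move=> F0; rewrite (bigD1 (Ordinal pn)) //= (bigD1 (Ordinal qn)) /=; last first.
  by rewrite -val_eqE /= eq_sym.
rewrite big1 ?addr0 // => i /andP[ip iq]; exact: F0.
Qed.

Let sum1 (F : nat -> K) j : (j < n1)%N -> (forall i, i != j -> F i = 0) ->
  \sum_(i < n1) F i = F j.
Proof.
move=> jn F0; rewrite (bigD1 (Ordinal jn)) //= big1 ?addr0 // => i ij; exact: F0.
Qed.

Lemma rotG_col (v : nat -> K) j : (j < n1)%N -> \sum_(l < n1) v l * rotG l j =
  if j == p then v p * c + v q * s else if j == q then v q * c - v p * s else v j * w.
Proof.
have qp : (q == p) = false by rewrite eq_sym (negbTE pq).
have pq' := negbTE pq.
move=> jn; case: (eqVneq j p) => [->|jp].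
  rewrite (@sum2 (fun l => v l * rotG l p)); first by rewrite /rotG qp !eqxx.
  by move=> i ip iq; rewrite /rotG (negbTE ip) (negbTE iq) mulr0.
case: (eqVneq j q) => [->|jq].
  rewrite (@sum2 (fun l => v l * rotG l q)); first by rewrite /rotG qp !eqxx; ring.
  by move=> i ip iq; rewrite /rotG (negbTE ip) (negbTE iq) mulr0.
rewrite (@sum1 (fun l => v l * rotG l j) _ jn).
  by rewrite /rotG (negbTE jp) (negbTE jq) eqxx.
by move=> i ij; rewrite /rotG (negbTE jp) (negbTE jq) (negbTE ij) !if_same mulr0.
Qed.

Lemma rotG_row (v : nat -> K) i : (i < n1)%N -> \sum_(l < n1) rotG i l * v l =
  if i == p then c * v p - s * v q else if i == q then s * v p + c * v q else w * v i.
Proof.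
have qp : (q == p) = false by rewrite eq_sym (negbTE pq).
have pq' := negbTE pq.
move=> i_n; case: (eqVneq i p) => [->|ip].
  rewrite (@sum2 (fun l => rotG p l * v l)); first by rewrite /rotG qp !eqxx; ring.
  by move=> l lp lq; rewrite /rotG eqxx (negbTE lp) (negbTE lq) mul0r.
case: (eqVneq i q) => [->|iq].
  rewrite (@sum2 (fun l => rotG q l * v l)); first by rewrite /rotG qp !eqxx.
  by move=> l lp lq; rewrite /rotG qp eqxx (negbTE lp) (negbTE lq) mul0r.
rewrite (@sum1 (fun l => rotG i l * v l) _ i_n).
  by rewrite /rotG (negbTE ip) (negbTE iq) eqxx.
by move=> l li; rewrite /rotG (negbTE ip) (negbTE iq) eq_sym (negbTE li) mul0r.
Qed.

Lemma rotG_norm (v : nat -> K) : c ^+ 2 + s ^+ 2 = w ^+ 2 ->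
  \sum_(j < n1) (\sum_(l < n1) v l * rotG l j) ^+ 2 = w ^+ 2 * \sum_(j < n1) v j ^+ 2.
Proof.
move=> csw.
have qp : (q == p) = false by rewrite eq_sym (negbTE pq).
pose F1 j := (if j == p then v p * c + v q * s else if j == q then v q * c - v p * s else v j * w) ^+ 2.
pose F2 j := v j ^+ 2.
have -> : \sum_(j < n1) (\sum_(l < n1) v l * rotG l j) ^+ 2 = \sum_(j < n1) F1 j.
  by apply: eq_bigr => j _; rewrite rotG_col.
have -> : \sum_(j < n1) v j ^+ 2 = \sum_(j < n1) F2 j by [].
have E (F : nat -> K) : \sum_(j < n1) F j = F p + (F q + \sum_(j < n1 | (j != p :> nat) && (j != q :> nat)) F j).
  rewrite (bigD1 (Ordinal pn)) //= (bigD1 (Ordinal qn)) /=; last by rewrite -val_eqE /= eq_sym.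
  by congr (_ + (_ + _)); apply: eq_bigl => i; rewrite -!val_eqE.
rewrite (E F1) (E F2) {1 2}/F1.
rewrite qp !eqxx !mulrDr mulr_sumr !addrA; congr (_ + _).
  rewrite -csw /F2; ring.
by apply: eq_bigr => j /andP[/negbTE jp /negbTE jq]; rewrite /F1 /F2 jp jq exprMn mulrC.
Qed.

End rotation_sums.

Section quadratic_forms.
Variables (R : comPzRingType) (n1 : nat).

Definition qform (A : nat -> nat -> int) (z : nat -> R) : R :=
  \sum_(i < n1) \sum_(j < n1) (A i j)%:~R * z i * z j.

Lemma eq_qform A z z' : (forall i, (i < n1)%N -> z i = z' i) -> qform A z = qform A z'.
Proof.
by move=> zz; apply: eq_bigr => i _; apply: eq_bigr => j _; rewrite !zz.
Qed.

Lemma qform_scale (A : nat -> nat -> int) z (w : R) : qform A (fun i => w * z i) = w ^+ 2 * qform A z.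
Proof.
rewrite mulr_sumr; apply: eq_bigr => i _; rewrite mulr_sumr; apply: eq_bigr => j _; ring.
Qed.

Lemma qform_mm (A B : nat -> nat -> int) z :
  qform (fun i j => \sum_(l < n1) (\sum_(m < n1) A l m * B m j) * B l i) z =
  qform A (fun l => \sum_(i < n1) (B l i)%:~R * z i).
Proof.
rewrite /qform; transitivity (\sum_(i < n1) \sum_(j < n1) \sum_(l < n1) \sum_(m < n1)
  (A l m)%:~R * (B m j)%:~R * (B l i)%:~R * z i * z j).
  apply: eq_bigr => i _; apply: eq_bigr => j _.
  rewrite rmorph_sum !mulr_suml; apply: eq_bigr => l _.
  by rewrite rmorphM rmorph_sum !mulr_suml; apply: eq_bigr => m _; rewrite rmorphM.
transitivity (\sum_(l < n1) \sum_(m < n1) \sum_(i < n1) \sum_(j < n1)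
  (A l m)%:~R * (B m j)%:~R * (B l i)%:~R * z i * z j).
  under eq_bigr do rewrite exchange_big /=; under eq_bigr do under eq_bigr do rewrite exchange_big /=.
  rewrite exchange_big /=; apply: eq_bigr => l _; rewrite exchange_big //.
apply: eq_bigr => l _; apply: eq_bigr => m _.
rewrite -mulrA mulr_suml mulr_sumr; apply: eq_bigr => i _.
rewrite mulr_sumr mulr_sumr; apply: eq_bigr => j _; ring.
Qed.

End quadratic_forms.

Section jacobi_math.
Variables (a n : nat).
Hypothesis a8 : (8 <= a)%N.
Hypothesis na : (n + 4 < a)%N.
Local Notation n1 := n.+1.
Local Notation rc := (rc a).
Local Notation rs := (rs a).
Local Notation rw := (rw a).

Lemma rot_csw k : rc k ^+ 2 + rs k ^+ 2 = rw k ^+ 2.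
Proof. by rewrite /rc /rs /rw PoszM (_ : 24 = 12 + 12)%N // expnD PoszM; ring. Qed.

Lemma rw_gt0 k : 0 < rw k.
Proof. by have : (0 < a ^ 24)%N by [rewrite expn_gt0; plia]; rewrite /rw; plia. Qed.

Definition symA (A : nat -> nat -> int) := forall i j, A i j = A j i.

Definition frob (A : nat -> nat -> int) : int := \sum_(i < n1) \sum_(j < n1) A i j ^+ 2.
Definition diagsq (A : nat -> nat -> int) : int := \sum_(i < n1) A i i ^+ 2.

Section one_rotation.
Variables (A : nat -> nat -> int) (p q k : nat).
Hypotheses (pn : (p < n1)%N) (qn : (q < n1)%N) (pq : (p < q)%N) (As : symA A).
Local Notation A' := (rot a n A p q k).

Let pq' : p != q. Proof. by plia. Qed.
Let rotQE i j : rotQ a p q k i j = rotG p q (rc k) (rs k) (rw k) i j. Proof. by []. Qed.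

Lemma rot_sym : symA A'.
Proof.
move=> i j; rewrite /rot /mmT.
transitivity (\sum_(l < n1) \sum_(m < n1) A l m * rotQ a p q k m j * rotQ a p q k l i).
  by apply: eq_bigr => l _; rewrite mulr_suml.
rewrite exchange_big /=; apply: eq_bigr => l _; rewrite mulr_suml.
by apply: eq_bigr => m _; rewrite (As m l); ring.
Qed.

Lemma frob_rot : frob A' = rw k ^+ 4 * frob A.
Proof.
have F B : frob (mmT n B (rotQ a p q k)) = rw k ^+ 2 * frob B.
  rewrite /frob exchange_big /= mulr_sumr; apply: eq_bigr => j _.
  rewrite -(rotG_norm pn qn pq' (B j) (rot_csw k)).
  by apply: eq_bigr => i _.
by rewrite /rot !F mulrA -exprD.
Qed.

Let rot_entry i j : (i < n1)%N -> (j < n1)%N -> A' i j =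
  let u l := if j == p then A l p * rc k + A l q * rs k
    else if j == q then A l q * rc k - A l p * rs k else A l j * rw k in
  if i == p then u p * rc k + u q * rs k else if i == q then u q * rc k - u p * rs k
  else u i * rw k.
Proof.
move=> iN jN /=; rewrite /rot /mmT.
transitivity (\sum_(l < n1) (fun l => if j == p then A l p * rc k + A l q * rs k
    else if j == q then A l q * rc k - A l p * rs k else A l j * rw k) l * rotG p q (rc k) (rs k) (rw k) l i).
  by apply: eq_bigr => l _; rewrite -(rotG_col (rc k) (rs k) (rw k) pn qn pq' (A l) jN).
exact: (rotG_col (rc k) (rs k) (rw k) pn qn pq' (fun l : nat => if j == p then A l p * rc k + A l q * rs k
    else if j == q then A l q * rc k - A l p * rs k else A l j * rw k) iN).
Qed.

Lemma rot00 : (0 < p)%N -> A' 0%N 0%N = A 0%N 0%N * rw k ^+ 2.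
Proof.
move=> p0; rewrite rot_entry //= ; by rewrite !ifF; plia.
Qed.

(** The Frobenius norm of the 2 x 2 block at [p], [q] is preserved up to the scale, so the diagonal
    gains exactly what the two symmetric off-diagonal entries lose. *)
Lemma diagsq_rot : diagsq A' =
  rw k ^+ 4 * (diagsq A + 2 * A p q ^+ 2) -
  2 * ((rc k * rc k - rs k * rs k) * A p q + rc k * rs k * (A q q - A p p)) ^+ 2.
Proof.
have qp : (q == p) = false by plia.
have E (F : nat -> int) : \sum_(j < n1) F j = F p + (F q + \sum_(j < n1 | (j != p :> nat) && (j != q :> nat)) F j).
  rewrite (bigD1 (Ordinal pn)) //= (bigD1 (Ordinal qn)) /=; last by rewrite -val_eqE /= eq_sym.
  by congr (_ + (_ + _)); apply: eq_bigl => i; rewrite -!val_eqE.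
pose F1 i := A' i i ^+ 2; pose F2 i := A i i ^+ 2.
rewrite (_ : diagsq A' = \sum_(i < n1) F1 i) // (_ : diagsq A = \sum_(i < n1) F2 i) //.
rewrite (E F1) (E F2) {}/F1 {}/F2.
have -> : \sum_(j < n1 | (j != p :> nat) && (j != q :> nat)) A' j j ^+ 2 =
  rw k ^+ 4 * \sum_(j < n1 | (j != p :> nat) && (j != q :> nat)) A j j ^+ 2.
  rewrite mulr_sumr; apply: eq_bigr => j /andP[/negbTE jp /negbTE jq].
  by rewrite rot_entry //= jp jq; ring.
rewrite !rot_entry //= !eqxx qp (As q p).
rewrite (_ : rw k ^+ 4 = (rc k ^+ 2 + rs k ^+ 2) ^+ 2); last by rewrite rot_csw -exprM.
ring.
Qed.

End one_rotation.

Section good_rotation.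
Variable F : realFieldType.

Lemma discrete_IVT (g : nat -> F) m (L : F) : 0 < g 0%N -> g m <= 0 ->
  (forall k, (k < m)%N -> `|g k.+1 - g k| <= L) -> exists2 k, (k <= m)%N & `|g k| <= L.
Proof.
move=> g0 gm gL.
have ex : exists k, g k <= 0 by exists m.
have km : (ex_minn ex <= m)%N by case: ex_minnP => k _; apply.
move: km; case: ex_minnP => -[|k] gk kmin km; first by rewrite leNgt g0 in gk.
exists k.+1 => //; have gk' : 0 < g k by rewrite ltNge; apply/negP => /kmin; rewrite ltnn.
apply: le_trans (gL k km); rewrite ler0_norm // ler0_norm; lra.
Qed.

Definition cosT (x : F) := (1 - x ^+ 2) / (1 + x ^+ 2).
Definition sinT (x : F) := 2 * x / (1 + x ^+ 2).

Lemma cs_lip (t u d : F) : 0 <= t <= 1 -> 0 <= u <= 1 -> `|t - u| <= d ->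
  `|(cosT t ^+ 2 - sinT t ^+ 2) - (cosT u ^+ 2 - sinT u ^+ 2)| <= 8 * d /\
  `|cosT t * sinT t - cosT u * sinT u| <= 4 * d.
Proof.
move=> /andP[t0 t1] /andP[u0 u1] tu; pose c := cosT; pose s := sinT.
rewrite -/c -/s.
have pos x : 0 < 1 + x ^+ 2 :> F by have := sqr_ge0 x; lra.
have nz x : 1 + x ^+ 2 != 0 :> F by rewrite gt_eqF.
have cs1 x : c x ^+ 2 + s x ^+ 2 = 1 by rewrite /c /s /cosT /sinT; field; exact: nz.
have c1 x : `|c x| <= 1.
  rewrite -(@ler_pXn2r _ 2) ?nnegrE // expr1n -normrX ger0_norm ?sqr_ge0 //.
  by have := cs1 x; have := sqr_ge0 (s x); lra.
have s1 x : `|s x| <= 1.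
  rewrite -(@ler_pXn2r _ 2) ?nnegrE // expr1n -normrX ger0_norm ?sqr_ge0 //.
  by have := cs1 x; have := sqr_ge0 (c x); lra.
have d0 : 0 <= d by apply: le_trans tu.
have P : 0 < (1 + t ^+ 2) * (1 + u ^+ 2) by rewrite mulr_gt0.
have cL : `|c t - c u| <= 2 * d.
  have -> : c t - c u = 2 * (u - t) * ((t + u) / ((1 + t ^+ 2) * (1 + u ^+ 2))).
    by rewrite /c /cosT; field; rewrite !nz.
  have f1 : `|(t + u) / ((1 + t ^+ 2) * (1 + u ^+ 2))| <= 1.
    rewrite ger0_norm; last by rewrite divr_ge0 ?addr_ge0 // ltW.
    rewrite ler_pdivrMr // mul1r; nra.
  rewrite 2!normrM (distrC u) (@ger0_norm _ 2) //.
  apply: (@le_trans _ _ (2 * `|t - u| * 1)); last by rewrite mulr1 ler_wpM2l.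
  by apply: ler_wpM2l; rewrite ?mulr_ge0.
have sL : `|s t - s u| <= 2 * d.
  have -> : s t - s u = 2 * (t - u) * ((1 - t * u) / ((1 + t ^+ 2) * (1 + u ^+ 2))).
    by rewrite /s /sinT; field; rewrite !nz.
  have f1 : `|(1 - t * u) / ((1 + t ^+ 2) * (1 + u ^+ 2))| <= 1.
    rewrite ger0_norm; last by rewrite divr_ge0 ?subr_ge0 ?(ltW P) //; nra.
    rewrite ler_pdivrMr // mul1r; nra.
  rewrite 2!normrM (@ger0_norm _ 2) //.
  apply: (@le_trans _ _ (2 * `|t - u| * 1)); last by rewrite mulr1 ler_wpM2l.
  by apply: ler_wpM2l; rewrite ?mulr_ge0.
have m (x y v z : F) : `|x| <= v -> `|y| <= z -> `|x * y| <= v * z.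
  by move=> h1 h2; rewrite normrM ler_pM.
have cs2 : `|c t + c u| <= 2 by apply: le_trans (ler_normD _ _) _; have := c1 t; have := c1 u; lra.
have ss2 : `|s t + s u| <= 2 by apply: le_trans (ler_normD _ _) _; have := s1 t; have := s1 u; lra.
split.
  have -> : (c t ^+ 2 - s t ^+ 2) - (c u ^+ 2 - s u ^+ 2) =
    (c t - c u) * (c t + c u) - (s t - s u) * (s t + s u) by ring.
  apply: le_trans (ler_normB _ _) _; have := m _ _ _ _ cL cs2; have := m _ _ _ _ sL ss2; lra.
have -> : c t * s t - c u * s u = c t * (s t - s u) + (c t - c u) * s u by ring.
apply: le_trans (ler_normD _ _) _.
have := m _ _ _ _ (c1 t) sL; have := m _ _ _ _ cL (s1 u); lra.
Qed.

End good_rotation.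

(** As the half-angle tangent runs from 0 to 1, the angle runs from 0 to a right angle and the entry
    (p,q) goes to its opposite. It changes by at most half its initial size per step of the grid, so
    some grid angle leaves it within half. *)
Lemma okk_ex A (E : int) p q : 0 < E -> bad a n A E p q ->
  `|A p p| <= a%:Z * E -> `|A q q| <= a%:Z * E ->
  exists2 k, (k <= a ^ 12)%N & okk a A p q k.
Proof.
move=> E0 /and4P[p0 pq qn bE] App Aqq.
pose m := (a ^ 12)%N.
have m0 : (0 < m)%N by rewrite expn_gt0; plia.
have mR0 : 0 < m%:R :> rat by rewrite ltr0n.
pose al := A p q; pose be := A q q - A p p.
have beE : `|be| <= 2 * a%:Z * E by rewrite /be; plia.
have al0 : al != 0 by apply: contraTneq bE => al0; rewrite -/al al0 normr0 mul0r -leNgt ltW.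
pose c (k : nat) : rat := cosT (k%:R / m%:R).
pose s (k : nat) : rat := sinT (k%:R / m%:R).
pose g k : rat := Num.sg al%:~R * ((c k ^+ 2 - s k ^+ 2) * al%:~R + c k * s k * be%:~R).
have sg2 : Num.sg (al%:~R : rat) ^+ 2 = 1 by rewrite sqr_sg intr_eq0 al0.
have sgal : Num.sg (al%:~R : rat) * al%:~R = `|al%:~R| by rewrite [RHS]normrEsg.
have al_gt0 : 0 < `|al%:~R : rat| by rewrite normr_gt0 intr_eq0.
have c0 : c 0%N = 1 by rewrite /c mul0r /cosT; field.
have s0 : s 0%N = 0 by rewrite /s mul0r /sinT; field.
have cm : c m = 0 by rewrite /c divff ?gt_eqF // /cosT expr1n subrr mul0r.
have sm : s m = 1 by rewrite /s divff ?gt_eqF // /sinT; field.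
have [|||k km gk] := @discrete_IVT rat g m (`|al%:~R| / 2).
- by have -> : g 0%N = `|al%:~R| by rewrite /g c0 s0 -sgal; ring.
- have -> : g m = - `|al%:~R| by rewrite /g cm sm -sgal; ring.
  by rewrite oppr_le0 ltW.
(* A step changes [g] by at most [(8 |al| + 4 |be|) / m]. Since [|be| <= 2 a E] and [E < |al| a^9],
   this is at most [|al| / 2] for [m = a^12], thanks to [a^3 >= 64 a]. *)
- move=> k km.
  have t1 j : (j <= m)%N -> 0 <= (j%:R / m%:R : rat) <= 1.
    by move=> jm; rewrite divr_ge0 ?ler0n //= ler_pdivrMr // mul1r ler_nat.
  have [|L1 L2] := @cs_lip rat (k.+1%:R / m%:R) (k%:R / m%:R) (m%:R^-1) (t1 _ km) (t1 _ (ltnW km)).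
    by rewrite -mulrBl -natrB // subSnn mul1r ger0_norm // invr_ge0 ltW.
  have -> : g k.+1 - g k = Num.sg (al%:~R : rat) * (((c k.+1 ^+ 2 - s k.+1 ^+ 2) - (c k ^+ 2 - s k ^+ 2)) * al%:~R
     + (c k.+1 * s k.+1 - c k * s k) * be%:~R) by rewrite /g; ring.
  rewrite normrM normr_sg intr_eq0 al0 mul1r.
  apply: le_trans (ler_normD _ _) _; rewrite !normrM.
  have h1 : `|(c k.+1 ^+ 2 - s k.+1 ^+ 2) - (c k ^+ 2 - s k ^+ 2)| * `|al%:~R| <= 8 / m%:R * `|al%:~R|.
    by apply: ler_wpM2r.
  have h2 : `|c k.+1 * s k.+1 - c k * s k| * `|be%:~R| <= 4 / m%:R * `|be%:~R|.
    by apply: ler_wpM2r.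
  apply: le_trans (lerD h1 h2) _.
  rewrite -(ler_pM2l mR0) mulrDr !mulrA [m%:R * 8]mulrC [m%:R * 4]mulrC !mulfK ?gt_eqF //.
  rewrite -!intr_norm -!pmulrn.
  have bE' : E * 8 * 8 * a%:Z <= `|al| * m%:Z.
    have -> : m%:Z = (a ^ 9)%N%:Z * (a ^ 3)%N%:Z by rewrite -PoszM -expnD.
    rewrite mulrA; have a3 : a%:Z * 64 <= (a ^ 3)%N%:Z.
      rewrite !expnS expn0 muln1; pnia.
    apply: (@le_trans _ _ (E * (a ^ 3)%N%:Z)); first by pnia.
    by apply: ler_wpM2r => //; exact: ltW.
  have m64 : 64 <= m%:Z.
    have -> : m = (a ^ 10 * a ^ 2)%N by rewrite -expnD.
    have : (0 < a ^ 10)%N by rewrite expn_gt0; plia.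
    rewrite !expnS expn0 muln1; pnia.
  have main : 16 * `|al| + 8 * `|be| <= m%:Z * `|al| by pnia.
  have : (16 * `|al| + 8 * `|be|)%:~R <= (m%:Z * `|al|)%:~R :> rat by rewrite ler_int.
  rewrite rmorphD !rmorphM /= -!pmulrn => h; lra.
exists k => //.
have ek : (m%:R ^+ 2 + k%:R ^+ 2 : rat) != 0.
  rewrite gt_eqF // ltr_pwDl ?sqr_ge0 // exprn_gt0 //.
have e24 : (a ^ 24)%N%:Z = m%:Z * m%:Z by rewrite -PoszM -expnD.
have e1 : (rc k)%:~R = m%:R ^+ 2 - k%:R ^+ 2 :> rat.
  have -> : rc k = m%:Z * m%:Z - k%:Z * k%:Z by rewrite /rc e24.
  by rewrite rmorphB !rmorphM !expr2.
have e2 : (rw k)%:~R = m%:R ^+ 2 + k%:R ^+ 2 :> rat.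
  have -> : rw k = m%:Z * m%:Z + k%:Z * k%:Z by rewrite /rw e24.
  by rewrite rmorphD !rmorphM !expr2.
have e3 : (rs k)%:~R = 2 * m%:R * k%:R :> rat.
  by rewrite /rs rmorphD !rmorphM /= -!pmulrn -/m; ring.
have mnz : m%:R != 0 :> rat by rewrite gt_eqF.
have ck : (rc k)%:~R = c k * (rw k)%:~R by rewrite e1 e2 /c /cosT; field; rewrite mnz.
have sk : (rs k)%:~R = s k * (rw k)%:~R by rewrite e3 e2 /s /sinT; field; rewrite mnz.
rewrite /okk -/al -/be -(ler_int rat) !intr_norm.
move: gk; rewrite /g normrM normr_sg intr_eq0 al0 mul1r.
set G := _ + _ => gk.
move: (rc k) (rs k) (rw k) ck sk {e1 e2 e3} => C S W ck sk.
have -> : (((C * C - S * S) * al + C * S * be) * 2)%:~R = W%:~R ^+ 2 * G * 2 :> rat.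
  by rewrite !rmorphM rmorphD !rmorphM rmorphB !rmorphM /= ck sk /G; ring.
have -> : (W * W * al)%:~R = W%:~R ^+ 2 * al%:~R :> rat by rewrite !rmorphM expr2.
rewrite [X in X <= _]normrM [X in X * _ <= _]normrM [leRHS]normrM -mulrA; apply: ler_wpM2l => //.
rewrite (@ger0_norm _ 2) //; lra.
Qed.

(** * The potential of the Jacobi iteration *)

Section jac_invariant.
Variables (A0 : nat -> nat -> int) (E0 : int).
Hypotheses (A0s : symA A0) (E00 : 0 < E0) (A0E0 : is_max n1 A0 E0).

Definition frob' (A : nat -> nat -> int) : int := frob A - A 0%N 0%N ^+ 2.

Lemma frob'_ge A i j : (i < n1)%N -> (j < n1)%N -> (0 < i + j)%N -> A i j ^+ 2 <= frob' A.
Proof.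
move=> iN jN ij; rewrite /frob' /frob pair_big /=.
rewrite (bigD1 (Ordinal (ltn0Sn n), Ordinal (ltn0Sn n))) //= addrAC subrr add0r.
rewrite (bigD1 (Ordinal iN, Ordinal jN)) /=; last first.
  by rewrite -pair_eqE /pair_eq -!val_eqE /=; plia.
by rewrite lerDl sumr_ge0 // => x _; exact: sqr_ge0.
Qed.

Lemma frob'_le A M : 0 <= M ->
  (forall i j, (i < n1)%N -> (j < n1)%N -> (0 < i + j)%N -> `|A i j| <= M) ->
  frob' A <= n1%:Z ^+ 2 * M ^+ 2.
Proof.
move=> M0 Amax; rewrite /frob' /frob pair_big /=.
rewrite (bigD1 (Ordinal (ltn0Sn n), Ordinal (ltn0Sn n))) //= addrAC subrr add0r.
apply: (@le_trans _ _ (\sum_(x : 'I_n1 * 'I_n1) M ^+ 2)); last first.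
  by rewrite sumr_const card_prod !card_ord -mulr_natl natrM expr2 !natz lexx.
rewrite big_mkcond /=; apply: ler_sum => -[i j] _ /=; case: ifP => h; last exact: sqr_ge0.
rewrite -[leLHS]ger0_norm ?sqr_ge0 // normrX ler_pXn2r ?nnegrE //.
by apply: Amax => //; move: h; rewrite -pair_eqE /pair_eq -!val_eqE /=; plia.
Qed.

Lemma frob'0_le : frob' A0 <= n1%:Z ^+ 2 * E0 ^+ 2.
Proof. by have [_ Amax _] := A0E0; apply: frob'_le => //; exact: ltW. Qed.

(** The potential is the sum of the squared diagonal entries other than (0,0), relative to [E^2]:
    every rotation raises it by at least [a^-18], while the Frobenius norm without the entry (0,0),
    which bounds it, is conserved. *)
Definition jinv (r : nat) (A : nat -> nat -> int) (E : int) :=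
  [/\ 0 < E, symA A, frob' A * E0 ^+ 2 = frob' A0 * E ^+ 2, A 0%N 0%N * E0 = A0 0%N 0%N * E &
     (forall p q, ~~ bad a n A E p q) \/
     r%:Z * E ^+ 2 <= (a ^ 18)%N%:Z * (diagsq A - A 0%N 0%N ^+ 2)].

(** The conserved norm starts at no more than [n.+1] times the scale, and [n.+1 < a]. *)
Lemma jinv_entry r A E i j : jinv r A E -> (i < n1)%N -> (j < n1)%N -> (0 < i + j)%N ->
  `|A i j| <= a%:Z * E.
Proof.
case=> E1 _ Fr _ _ iN jN ij.
rewrite -(@ler_pXn2r _ 2) ?nnegrE ?mulr_ge0 // ?(ltW E1) // -normrX ger0_norm ?sqr_ge0 //.
have E2 : 0 < E0 ^+ 2 by rewrite exprn_gt0.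
rewrite -(ler_pM2r E2); apply: le_trans (_ : frob' A * E0 ^+ 2 <= _).
  by rewrite ler_wpM2r ?frob'_ge // ltW.
rewrite Fr; apply: le_trans (_ : n1%:Z ^+ 2 * E0 ^+ 2 * E ^+ 2 <= _).
  by rewrite ler_wpM2r ?frob'0_le // sqr_ge0.
rewrite exprMn mulrAC; apply: ler_wpM2r; first exact: ltW.
apply: ler_wpM2r; first exact: sqr_ge0.
by rewrite ler_pXn2r ?nnegrE //; plia.
Qed.

Lemma jac_jinv r A E : jac a n A0 E0 r A E -> jinv r A E.
Proof.
elim=> {r A E} [|r A E jA [E1 As Fr A00 D] nb|r A E p q k jA IH bpq [km gk]].
- split=> //; right; rewrite mul0r mulr_ge0 // /diagsq big_ord_recl /= addrAC subrr add0r.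
  by rewrite sumr_ge0 // => i _; exact: sqr_ge0.
- by split=> //; left.
have /and4P[p0 pq qn bE] := bpq.
have [E1 As Fr A00 D] := IH.
have pn : (p < n1)%N by plia.
have w0 := rw_gt0 k.
have okk1 : okk a A p q k.
  by apply: gk; apply: (okk_ex E1 bpq); (apply: (jinv_entry IH) => //; plia).
have r00 : rot a n A p q k 0%N 0%N = A 0%N 0%N * rw k ^+ 2 by apply: rot00.
have fr' : frob' (rot a n A p q k) = rw k ^+ 4 * frob' A.
  by rewrite /frob' frob_rot // r00 exprMn -exprM; ring.
split.
- by rewrite !mulr_gt0.
- by apply: rot_sym.
- rewrite fr' !exprMn -mulrA Fr; ring.
- rewrite r00 mulrAC A00; ring.
(* By [okk] the new entry contributes at most a quarter of the old square, so the potential gains at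
   least [3/2] times the square of the entry, and the entry exceeds [E / a^9]. *)
right; case: D => [/(_ p q)|D]; first by rewrite bpq.
rewrite diagsq_rot // r00.
move: okk1; rewrite /okk; set h := ((_ - _) * A p q + _) => okk1; set al := A p q in bE h okk1 *.
have h2 : 4 * h ^+ 2 <= rw k ^+ 4 * al ^+ 2.
  have : (`|h * 2|) ^+ 2 <= (`|rw k * rw k * al|) ^+ 2.
    by rewrite ler_pXn2r ?nnegrE //; exact: okk1.
  rewrite -!normrX !ger0_norm ?sqr_ge0 //.
  by rewrite (_ : (h * 2) ^+ 2 = 4 * h ^+ 2) 1?(_ : (_ * al) ^+ 2 = rw k ^+ 4 * al ^+ 2) //; ring.
have al2 : E ^+ 2 <= (a ^ 18)%N%:Z * al ^+ 2.
  have : E ^+ 2 <= (`|al| * (a ^ 9)%N%:Z) ^+ 2 by rewrite ler_pXn2r ?nnegrE ?mulr_ge0 ?(ltW E1) // ltW.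
  rewrite exprMn -normrX ger0_norm ?sqr_ge0 // mulrC.
  by rewrite (_ : (a ^ 9)%N%:Z ^+ 2 = (a ^ 18)%N%:Z) // expr2 -PoszM -expnD.
have w4 : 0 <= rw k ^+ 4 by rewrite exprn_ge0 // ltW.
have -> : (E * rw k * rw k) ^+ 2 = rw k ^+ 4 * E ^+ 2 by ring.
have a18 : 0 <= (a ^ 18)%N%:Z by [].
have -> : rw k ^+ 4 * (diagsq A + 2 * al ^+ 2) - 2 * h ^+ 2 - (A 0%N 0%N * rw k ^+ 2) ^+ 2 =
  rw k ^+ 4 * (diagsq A - A 0%N 0%N ^+ 2) + (rw k ^+ 4 * (2 * al ^+ 2) - 2 * h ^+ 2) by ring.
have -> : r.+1%:Z = r%:Z + 1 by plia.
have m1 := ler_wpM2l w4 D; have m2 := ler_wpM2l w4 al2; have m3 := ler_wpM2l a18 h2.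
have m4 : 0 <= (a ^ 18)%N%:Z * (rw k ^+ 4 * al ^+ 2).
  by rewrite mulr_ge0 // mulr_ge0 // sqr_ge0.
move: (a ^ 18)%N%:Z (rw k ^+ 4) (E ^+ 2) (al ^+ 2) (h ^+ 2) (diagsq A) (A 0%N 0%N ^+ 2) r%:Z m1 m2 m3 m4.
move=> c w e l g d z rr m1 m2 m3 m4; lra.
Qed.

(** The potential never exceeds [a^2] and grows by [a^-18], so there are at most [a^20]
    rotations. *)
Lemma jac_end X A E : (8 * a ^ 59 <= X)%N -> jac a n A0 E0 X A E ->
  forall p q, ~~ bad a n A E p q.
Proof.
move=> Xa /jac_jinv[E1 As Fr A00 [//|D]] p q; exfalso.
have dF : diagsq A - A 0%N 0%N ^+ 2 <= frob' A.
  rewrite /diagsq /frob' /frob lerD2r; apply: ler_sum => i _.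
  by rewrite (bigD1 i) //= lerDl; apply: sumr_ge0 => j _; exact: sqr_ge0.
have F1 : frob' A <= a%:Z ^+ 2 * E ^+ 2.
  have E2 : 0 < E0 ^+ 2 by rewrite exprn_gt0.
  rewrite -(ler_pM2r E2) Fr mulrAC; apply: ler_wpM2r; first exact: sqr_ge0.
  apply: le_trans frob'0_le _; apply: ler_wpM2r; first exact: sqr_ge0.
  by rewrite ler_pXn2r ?nnegrE //; plia.
have a18 : 0 <= (a ^ 18)%N%:Z by [].
have := le_trans D (ler_wpM2l a18 (le_trans dF F1)).
rewrite [leRHS]mulrA ler_pM2r ?exprn_gt0 // => XX.
have e20 : (a ^ 18)%N%:Z * a%:Z ^+ 2 = (a ^ 20)%N%:Z.
  by rewrite expr2 -!PoszM (_ : 20 = 18 + 2)%N // expnD.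
rewrite e20 lez_nat in XX.
have : (a ^ 20 <= a ^ 59)%N by rewrite leq_pexp2l //; plia.
have : (0 < a ^ 59)%N by rewrite expn_gt0; plia.
plia.
Qed.

(** The conserved norm is at least the scale, since the scale is attained by an initial entry. If
    all remaining coefficients were at most [E / a], it would be at most [n.+1 / a < 1] times the
    scale. *)
Lemma jac_big r A E : jac a n A0 E0 r A E -> (forall p q, ~~ bad a n A E p q) ->
  exists2 i, (i < n)%N & (E <= a%:Z * `|A i.+1 i.+1|) || (E <= a%:Z * `|A 0%N i.+1|).
Proof.
move=> jA nb; have [E1 As Fr A00 D] := jac_jinv jA.
have [h|h] := boolP [exists i : 'I_n, (E <= a%:Z * `|A i.+1 i.+1|) || (E <= a%:Z * `|A 0%N i.+1|)].
  by have /existsP[i hi] := h; exists i.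
exfalso; have {}h i : (i < n)%N -> a%:Z * `|A i.+1 i.+1| <= E /\ a%:Z * `|A 0%N i.+1| <= E.
  move=> iN; move: h; rewrite negb_exists => /forallP/(_ (Ordinal iN)).
  by rewrite negb_or -!ltNge => /andP[/ltW h1 /ltW h2].
have [_ _ [E00'|[i0 [j0 [i0n j0n ij0 A0e]]]]] := A0E0; first by move: E00; rewrite E00' ltxx.
have F0 : E0 ^+ 2 <= frob' A0.
  by rewrite -A0e -normrX ger0_norm ?sqr_ge0 //; exact: frob'_ge.
have FE : E ^+ 2 <= frob' A.
  have E02 : 0 < E0 ^+ 2 by rewrite exprn_gt0.
  rewrite -(ler_pM2r E02) Fr mulrC; apply: ler_wpM2r => //; exact: sqr_ge0.
have : frob' (fun i j => a%:Z * A i j) <= n1%:Z ^+ 2 * E ^+ 2.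
  apply: frob'_le; first exact: ltW.
  have a9 : a%:Z <= (a ^ 9)%N%:Z by rewrite lez_nat -[X in (X <= _)%N]expn1 leq_pexp2l //; plia.
  have off p q : (0 < p)%N -> (p < q)%N -> (q < n1)%N -> a%:Z * `|A p q| <= E.
    move=> p0 pq qn; have := nb p q; rewrite /bad p0 pq qn /= -leNgt; apply: le_trans.
    by rewrite mulrC; apply: ler_wpM2l.
  move=> i j iN jN ij; rewrite normrM ger0_norm //.
  case: i j iN jN ij => [|i] [|j] iN jN ij //; first by have [] := h j jN.
    by rewrite As; have [] := h i iN.
  case: (ltngtP i j) => [lij|lij|<-]; first exact: off.
    by rewrite As; apply: off.
  by have [] := h i iN.
have -> : frob' (fun i j => a%:Z * A i j) = a%:Z ^+ 2 * frob' A.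
  rewrite /frob' mulrBr /frob mulr_sumr exprMn; congr (_ - _); apply: eq_bigr => i _.
  by rewrite mulr_sumr; apply: eq_bigr => j _; rewrite exprMn.
have E2 : 0 < E ^+ 2 by rewrite exprn_gt0.
have : n1%:Z ^+ 2 < a%:Z ^+ 2 by rewrite ltr_pXn2r ?nnegrE //; plia.
rewrite -(ltr_pM2r E2) => h1 h2; have := lt_le_trans h1 (le_trans (ler_wpM2l (sqr_ge0 _) FE) h2).
by rewrite ltxx.
Qed.

End jac_invariant.
End jacobi_math.

(** * The grid *)

Section cells.
Variables (R : realType) (a : nat).
Hypothesis a8 : (8 <= a)%N.
Local Notation mu := (@lebesgue_measure R).
Local Notation T := (measurableTypeR R).
Local Notation N := (normal_prob (0 : R) 1).
Local Notation J := (a ^ 10)%N.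
Local Notation Z := (Z2pi R).
Local Notation prN := (@prN R).
Local Notation ar := (a%:R : R).

Let a8R : 8 <= ar. Proof. by rewrite ler_nat. Qed.
Let a0R : 0 < ar. Proof. by have := a8R; lra. Qed.

Lemma prN_ub (A : set T) (h c : R) : measurable A -> mu A = h%:E -> 0 <= c ->
  (forall x, A x -> normal_pdf 0 1 x <= c) -> prN A <= c * h.
Proof.
move=> mA Ah c0 Ac; rewrite -lee_fin prNE // EFinM -Ah -integral_cst // /normal_prob.
have mp : measurable_fun A (fun x : T => (normal_pdf 0 1 x : R)%:E).
  by apply: measurable_funTS; exact: measurable_pdf.
apply: ge0_le_integral => //=.
by move=> x _; rewrite lee_fin normal_pdf_ge0.
Qed.

Lemma prN_lb (A : set T) (h c d : R) : measurable A -> mu A = h%:E -> 0 <= c -> 0 <= d ->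
  (forall x, A x -> c <= normal_pdf 0 1 x + d) -> c * h <= prN A + d * h.
Proof.
move=> mA Ah c0 d0 Ac.
have mp : measurable_fun A (fun x : T => (normal_pdf 0 1 x : R)%:E).
  by apply: measurable_funTS; exact: measurable_pdf.
have mc (r : R) : measurable_fun A (fun=> r%:E : \bar R) by exact: measurable_cst.
rewrite -lee_fin (EFinD (prN A)) prNE // !EFinM -Ah -!integral_cst // /normal_prob -ge0_integralD //=; last first.
  by move=> x _; rewrite lee_fin normal_pdf_ge0.
by apply: ge0_le_integral => //=; exact: emeasurable_funD.
Qed.

Lemma prN_split (x y : R) (e : itv_bound R) : x <= y -> (BLeft y <= e)%O ->
  prN [set` Interval (BLeft x) e] = prN `[x, y[%classic + prN [set` Interval (BLeft y) e].
Proof.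
move=> xy ye.
have e1 : [set` Interval (BLeft x) e] = (`[x, y[%classic `|` [set` Interval (BLeft y) e]) :> set R.
  by rewrite -itv_bndbnd_setU // bnd_simp.
apply: EFin_inj; rewrite EFinD !prNE // e1 measureU //.
apply/seteqP; split=> // z /=; rewrite !in_itv /= => -[/andP[_ h1] /andP[h2 _]].
by move: (lt_le_trans h1 h2); rewrite ltxx.
Qed.

Definition xg (j : nat) : R := (tt a j)%:~R / (a ^ 9)%:R.
Definition cell (j : nat) : set T := `[xg j, xg j.+1[%classic.
Definition hh : R := (a ^ 9)%:R^-1.

Lemma p9_gt0 : 0 < (a ^ 9)%:R :> R.
Proof. by rewrite natrX exprn_gt0. Qed.

Lemma hh_gt0 : 0 < hh. Proof. by rewrite invr_gt0 p9_gt0. Qed.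

Lemma xgS j : xg j.+1 = xg j + hh.
Proof.
rewrite /xg /tt (_ : j.+1%:Z - J%:Z = (j%:Z - J%:Z) + 1); last by plia.
by rewrite rmorphD /= mulrDl mul1r.
Qed.

Lemma xg_le j k : (j <= k)%N -> xg j <= xg k.
Proof.
move=> jk; rewrite /xg ler_pM2r ?invr_gt0 ?p9_gt0 // ler_int /tt; plia.
Qed.

Lemma xg0 : xg 0 = - ar.
Proof.
rewrite /xg /tt sub0r rmorphN /= -pmulrn mulNr; congr (- _).
by rewrite (_ : 10 = 1 + 9)%N // expnD natrM expn1 mulfK // gt_eqF // p9_gt0.
Qed.

Lemma xgJJ : xg (J + J) = ar.
Proof.
rewrite /xg /tt PoszD addrK -pmulrn.
by rewrite (_ : 10 = 1 + 9)%N // expnD natrM expn1 mulfK // gt_eqF // p9_gt0.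
Qed.

Lemma xg_bound j : (j <= J + J)%N -> `|xg j| <= ar.
Proof. by move=> jJ; rewrite ler_norml -xg0 -xgJJ !xg_le. Qed.

Lemma xg_bound2 j : (j <= J + J)%N -> xg j ^+ 2 <= ar ^+ 2.
Proof.
by move=> /xg_bound h; rewrite -[leLHS]ger0_norm ?sqr_ge0 // normrX ler_pXn2r ?nnegrE.
Qed.

Definition vg (j : nat) : R := (1 - xg j ^+ 2 / 2 / (a ^ 7)%:R) ^+ (a ^ 7)%N.

Lemma wt_vg j : (wt a j)%:~R = (2 * (a ^ 25)%:R) ^+ (a ^ 7)%N * vg j :> R.
Proof.
rewrite /wt /vg rmorphXn /= -exprMn; congr (_ ^+ _).
rewrite /ut /xg rmorphB rmorphD rmorphM /= -!pmulrn.
have e25 : (a ^ 25)%:R = (a ^ 9)%:R * (a ^ 9)%:R * (a ^ 7)%:R :> R by rewrite -!natrM -!expnD.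
have := p9_gt0; have : 0 < (a ^ 7)%:R :> R by rewrite natrX exprn_gt0.
rewrite e25; move: (a ^ 9)%:R (a ^ 7)%:R => P Q Q0 P0.
by field; rewrite !gt_eqF.
Qed.

Lemma vg_ge0 j : (j <= J + J)%N -> 0 <= vg j <= 1.
Proof.
move=> jJ; have h := xg_bound2 jJ.
have Q0 : 0 < (a ^ 7)%:R :> R by rewrite natrX exprn_gt0.
have u0 : 0 <= xg j ^+ 2 / 2 / (a ^ 7)%:R by rewrite !divr_ge0 ?sqr_ge0.
have u1 : xg j ^+ 2 / 2 / (a ^ 7)%:R <= 1.
  rewrite ler_pdivrMr // mul1r; apply: (@le_trans _ _ (ar ^+ 2)); first by have := sqr_ge0 ar; lra.
  by rewrite natrX; apply: ler_weXn2l => //; have := a8R; lra.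
by rewrite /vg exprn_ge0 ?subr_ge0 //= exprn_ile1 //; lra.
Qed.

(** Two errors: moving from [x] to the grid point costs at most [a * a^-9], and replacing the
    exponential by the power at most [a^4 / (4 a^7)]. *)
Lemma pdf_cell j x : (j < J + J)%N -> cell j x ->
  `|Z * normal_pdf 0 1 x - vg j| <= (ar ^+ 3)^-1.
Proof.
move=> jJ; rewrite /cell /= in_itv /= => /andP[x1 x2].
rewrite pdfE mulrA divff ?gt_eqF ?Z2pi_gt0 // mul1r.
have b1 := xg_bound (ltnW jJ); have b2 := xg_bound jJ.
have xa : `|x| <= ar.
  by move: b1 b2; rewrite !ler_norml => /andP[h1 h2] /andP[h3 h4]; apply/andP; split; lra.
have d1 : `|x - xg j| <= hh by rewrite ger0_norm; rewrite xgS in x2; lra.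
have e1 : `|expR (- (x ^+ 2 / 2)) - expR (- (xg j ^+ 2 / 2))| <= ar * hh.
  apply: le_trans (expR_lip _ _) _; rewrite ?divr_ge0 ?sqr_ge0 //.
  have -> : x ^+ 2 / 2 - xg j ^+ 2 / 2 = ((x + xg j) / 2) * (x - xg j) by field.
  rewrite normrM; apply: ler_pM => //.
  rewrite normrM (@ger0_norm _ 2^-1) //; have := ler_normD x (xg j); lra.
have Q0 : (0 < a ^ 7)%N by rewrite expn_gt0; plia.
have x2' := xg_bound2 (ltnW jJ).
have um : xg j ^+ 2 / 2 <= (a ^ 7)%:R :> R.
  apply: (@le_trans _ _ (ar ^+ 2)); first by have := sqr_ge0 ar; lra.
  by rewrite natrX; apply: ler_weXn2l => //; have := a8R; lra.
have e2 := @expR_pow_approx R (xg j ^+ 2 / 2) (a ^ 7) Q0 _ um.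
have {}e2 : `|expR (- (xg j ^+ 2 / 2)) - vg j| <= (xg j ^+ 2 / 2) ^+ 2 / (a ^ 7)%:R.
  by apply: e2; rewrite divr_ge0 ?sqr_ge0.
have -> : expR (- (x ^+ 2 / 2)) - vg j = (expR (- (x ^+ 2 / 2)) - expR (- (xg j ^+ 2 / 2))) +
  (expR (- (xg j ^+ 2 / 2)) - vg j) by ring.
apply: le_trans (ler_normD _ _) _; apply: le_trans (lerD e1 e2) _.
have A3 : 0 < ar ^+ 3 by rewrite exprn_gt0.
have f1 : ar * hh <= (ar ^+ 3)^-1 / 8.
  rewrite /hh natrX (_ : 9 = 1 + 3 + 5)%N // (exprD ar (1 + 3)) exprD expr1.
  have -> : ar / (ar * ar ^+ 3 * ar ^+ 5) = (ar ^+ 3)^-1 * (ar ^+ 5)^-1 by field; rewrite gt_eqF.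
  apply: ler_wpM2l; first by rewrite invr_ge0 ltW.
  rewrite lef_pV2 ?posrE ?exprn_gt0 //; apply: le_trans a8R _.
  by rewrite -[leLHS]expr1; apply: ler_weXn2l => //; have := a8R; lra.
have f2 : (xg j ^+ 2 / 2) ^+ 2 / (a ^ 7)%:R <= (ar ^+ 3)^-1 / 4.
  rewrite natrX (_ : 7 = 4 + 3)%N // exprD invfM.
  have A4 : 0 < ar ^+ 4 by rewrite exprn_gt0.
  rewrite mulrA [leRHS]mulrC; apply: ler_wpM2r; first by rewrite invr_ge0 ltW.
  rewrite ler_pdivrMr //.
  have -> : (xg j ^+ 2 / 2) ^+ 2 = xg j ^+ 2 * xg j ^+ 2 / 4 by field.
  rewrite [leRHS]mulrC ler_pM2r // (_ : 4 = 2 + 2)%N // exprD; apply: ler_pM => //; exact: sqr_ge0.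
have : 0 < (ar ^+ 3)^-1 by rewrite invr_gt0.
lra.
Qed.

Lemma measurable_cell j : measurable (cell j). Proof. exact: measurable_itv. Qed.

Lemma mu_cell j : mu (cell j) = hh%:E.
Proof.
rewrite /cell lebesgue_measure_itv /= lte_fin xgS ltrDl hh_gt0.
by rewrite -EFinB addrAC subrr add0r.
Qed.

Definition pc (j : nat) : R := prN (cell j).

Lemma pc_ge0 j : 0 <= pc j. Proof. exact: prN_ge0. Qed.

Lemma pc_vg j : (j < J + J)%N -> `|Z * pc j - hh * vg j| <= hh * (ar ^+ 3)^-1.
Proof.
move=> jJ; have Z0 := Z2pi_gt0 R; have d0 : 0 <= (ar ^+ 3)^-1 by rewrite invr_ge0 exprn_ge0 // ltW.
have /andP[v0 _] := vg_ge0 (ltnW jJ).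
have hp x : cell j x -> vg j / Z <= normal_pdf 0 1 x + (ar ^+ 3)^-1 / Z /\
    normal_pdf 0 1 x <= (vg j + (ar ^+ 3)^-1) / Z.
  move=> cx; have := pdf_cell jJ cx; rewrite ler_norml => /andP[h1 h2].
  rewrite ler_pdivlMr // ler_pdivrMr // mulrDl divfK ?gt_eqF //; split; lra.
have u := @prN_ub _ hh ((vg j + (ar ^+ 3)^-1) / Z) (measurable_cell j) (mu_cell j) _ (fun x cx => (hp x cx).2).
have l := @prN_lb _ hh (vg j / Z) ((ar ^+ 3)^-1 / Z) (measurable_cell j) (mu_cell j) _ _ (fun x cx => (hp x cx).1).
have {}u : pc j * Z <= (vg j + (ar ^+ 3)^-1) * hh.
  rewrite -ler_pdivlMr // mulrAC; apply: u; rewrite divr_ge0 ?addr_ge0 //; exact: ltW.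
have {}l : vg j * hh <= pc j * Z + (ar ^+ 3)^-1 * hh.
  rewrite -(ler_pM2r (_ : 0 < Z^-1)) ?invr_gt0 // mulrDl mulfK ?gt_eqF //.
  rewrite mulrAC [X in _ + X]mulrAC; apply: l; rewrite divr_ge0 //; exact: ltW.
rewrite ler_norml; apply/andP; split; lra.
Qed.

Lemma sum_pc k l : (k <= l)%N -> \sum_(k <= j < l) pc j = prN `[xg k, xg l[%classic.
Proof.
elim: l => [|l IH] kl.
  move: kl; rewrite leqn0 => /eqP->; rewrite big_geq // set_itv_ge /prN ?measure0 //.
  by rewrite bnd_simp ltxx.
move: kl; rewrite leq_eqVlt => /orP[/eqP->|kl].
  by rewrite big_geq // set_itv_ge /prN ?measure0 // bnd_simp ltxx.
rewrite big_nat_recr //= IH // /pc /cell -prN_split ?bnd_simp ?xg_le //.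
Qed.

Lemma tail_right : prN `[ar, +oo[%classic <= 2 / ar ^+ 2.
Proof.
apply: (@normal_tail R (- ar) ar) => //; first by rewrite normrN gtr0_norm.
move=> x /=; rewrite in_itv /= andbT => xa; rewrite mulNr lerN2 expr2.
by apply: ler_wpM2l => //; exact: ltW.
Qed.

Lemma tail_left : prN `]-oo, (- ar)[%classic <= 2 / ar ^+ 2.
Proof.
apply: (@normal_tail R ar ar) => //; first by rewrite gtr0_norm.
move=> x /=; rewrite in_itv /= => xa; rewrite expr2 -mulrN.
by apply: ler_wpM2l; exact: ltW.
Qed.

Lemma sum_pc_all : 1 - 4 / ar ^+ 2 <= \sum_(j < J + J) pc j <= 1.
Proof.
rewrite -(big_mkord xpredT pc) sum_pc // xg0 xgJJ.
have e : 1 = prN `]-oo, (- ar)[%classic + (prN `[(- ar), ar[%classic + prN `[ar, +oo[%classic).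
  have aa : - ar <= ar by have := a8R; lra.
  have -> : prN `[(- ar), ar[%classic + prN `[ar, +oo[%classic = prN `[(- ar), +oo[%classic.
    by rewrite -(@prN_split (- ar) ar (BInfty _ false)).
  apply: EFin_inj; rewrite [RHS]EFinD !prNE // -measureU //; last first.
    by apply/seteqP; split=> // z /=; rewrite !in_itv /= andbT => -[h1 h2]; lra.
  by rewrite -(@probability_setT _ _ _ (normal_prob (0:R) 1)); congr (N _); rewrite -itv_bndbnd_setU // set_itvE.
have h1 := tail_left; have h2 := tail_right; have h3 := prN_ge0 `]-oo, (- ar)[%classic.
have h4 := prN_ge0 `[ar, +oo[%classic.
apply/andP; split; lra.
Qed.

Definition qg (j : nat) : R := (wt a j)%:~R / (Wt a)%:~R.

(** Summing the pointwise error over [2 a^10] cells of width [a^-9] gives [2 / a^2]. The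
    normalisation adds 14 = 2 + 3 * 4, from the same sum and the mass [4 / a^2] outside the grid
    times [Z <= 3]; dividing by [W >= 1] does no harm. *)
Lemma tv_cells : (forall j, (j < J + J)%N -> 0 <= qg j) /\ \sum_(j < J + J) qg j = 1 /\
  \sum_(j < J + J) `|pc j - qg j| <= 16 / ar ^+ 2.
Proof.
pose c : R := (2 * (a ^ 25)%:R) ^+ (a ^ 7)%N.
have c0 : 0 < c by rewrite exprn_gt0 // mulr_gt0 // natrX exprn_gt0.
pose S := \sum_(j < J + J) vg j.
have WtE : (Wt a)%:~R = c * S :> R.
  by rewrite /Wt rmorph_sum mulr_sumr; apply: eq_bigr => j _; rewrite /= wt_vg.
pose W := hh * S.
have A2 : 0 < ar ^+ 2 by rewrite exprn_gt0.
have A21 : 64 * (ar ^+ 2)^-1 <= 1.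
  by rewrite ler_pdivrMr // mul1r expr2; have := a8R; nra.
have A2i : 0 < (ar ^+ 2)^-1 by rewrite invr_gt0.
have s1 : \sum_(j < J + J) `|Z * pc j - hh * vg j| <= 2 * (ar ^+ 2)^-1.
  apply: (@le_trans _ _ (\sum_(j < J + J) hh * (ar ^+ 3)^-1)).
    by apply: ler_sum => j _; exact: pc_vg.
  rewrite sumr_const card_ord -[leLHS]mulr_natl natrD.
  have -> : (J%:R : R) = ar * (a ^ 9)%:R by rewrite -natrM -expnS.
  rewrite /hh exprS; have := p9_gt0; move: (a ^ 9)%:R => P P0.
  have -> // : (ar * P + ar * P) * (P^-1 / (ar * ar ^+ 2)) = 2 * (ar ^+ 2)^-1.
  by field; rewrite !gt_eqF.
have /andP[p1 p2] := sum_pc_all.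
have Z2 := Z2pi_ge2 R; have Z3 := Z2pi_le3 R.
have ZW : `|Z * \sum_(j < J + J) pc j - W| <= 2 * (ar ^+ 2)^-1.
  rewrite /W !mulr_sumr -sumrB; apply: le_trans (ler_norm_sum _ _ _) s1.
have ZW2 : `|W - Z| <= 14 * (ar ^+ 2)^-1.
  move: ZW; rewrite !ler_norml => /andP[h1 h2].
  move: p1 p2 h1 h2; move: (\sum_(j < J + J) pc j) => P p1 p2 h1 h2.
  have k1 : Z * (1 - P) <= 3 * (4 * (ar ^+ 2)^-1) by apply: ler_pM; lra.
  have k2 : 0 <= Z * (1 - P) by rewrite mulr_ge0; lra.
  apply/andP; split; lra.
have W1 : 1 <= W by move: ZW2; rewrite ler_norml => /andP[h1 h2]; lra.
have W0 : 0 < W by lra.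
have S0 : S != 0 by apply: contraTneq W0; rewrite /W => ->; rewrite mulr0 ltxx.
have qE j : qg j = hh * vg j / W.
  rewrite /qg WtE wt_vg -/c /W; have := hh_gt0 => h0.
  by field; rewrite S0 !gt_eqF.
split; first (move=> j jJ; rewrite qE; have /andP[v0 _] := vg_ge0 (ltnW jJ);
  by apply: divr_ge0; [apply: mulr_ge0 => //; exact: ltW hh_gt0|exact: ltW W0]).
split; first by rewrite (eq_bigr (fun j : 'I_(J + J) => hh * vg j / W)) // -mulr_suml -mulr_sumr divff ?gt_eqF.
apply: (@le_trans _ _ (\sum_(j < J + J) (`|W - Z| * pc j + `|Z * pc j - hh * vg j|))).
  apply: ler_sum => j _; rewrite qE.
  have -> : pc j - hh * vg j / W = ((W - Z) * pc j + (Z * pc j - hh * vg j)) / W by field; rewrite gt_eqF.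
  rewrite normrM normfV (gtr0_norm W0) ler_pdivrMr //.
  apply: le_trans (ler_normD _ _) _; rewrite normrM (ger0_norm (pc_ge0 j)).
  set t := _ + _; have t0 : 0 <= t by rewrite addr_ge0 // mulr_ge0 // pc_ge0.
  by rewrite -[leLHS]mulr1; apply: ler_wpM2l.
rewrite big_split /= -mulr_sumr.
have := ler_wpM2l (normr_ge0 (W - Z)) p2; rewrite mulr1.
lra.
Qed.

End cells.

(** * Products, boxes and sections under the Gaussian measure *)

Section gaussian_tools.
Variable R : realType.
Local Notation T := (measurableTypeR R).
Local Notation N := (normal_prob (0 : R) 1).
Local Notation prN := (@prN R).
Local Notation gam := (@gaussian R).

Definition prG n (B : set (n.-tuple T)) : R := fine (gam n B).

Lemma prGE n (B : set (n.-tuple T)) : measurable B -> (prG B)%:E = gam n B.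
Proof. by move=> mB; rewrite /prG fineK // fin_num_measure. Qed.

Lemma prG_ge0 n (B : set (n.-tuple T)) : 0 <= prG B.
Proof. exact: fine_ge0. Qed.

Lemma prG_le1 n (B : set (n.-tuple T)) : measurable B -> prG B <= 1.
Proof. by move=> mB; rewrite -lee_fin prGE //; exact: probability_le1. Qed.

Lemma prG_setC n (B : set (n.-tuple T)) : measurable B -> prG (~` B) = 1 - prG B.
Proof.
move=> mB; apply: EFin_inj; rewrite prGE; last exact: measurableC.
by rewrite EFinB prGE // probability_setC.
Qed.

Lemma prG_leU n (B C D : set (n.-tuple T)) : measurable B -> measurable C -> measurable D ->
  B `<=` C `|` D -> prG B <= prG C + prG D.
Proof.
move=> mB mC mD BCD; rewrite -lee_fin EFinD !prGE //.
apply: (@le_trans _ _ (gam n (C `|` D))).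
  by apply: le_measure; rewrite ?inE //; exact: measurableU.
exact: measureU2.
Qed.

Lemma prG_bigU n m (F : nat -> set (n.-tuple T)) : (forall k, measurable (F k)) ->
  (forall j k x, F j x -> F k x -> j = k) ->
  prG (\big[setU/set0]_(i < m) F i) = \sum_(i < m) prG (F i).
Proof.
move=> mF tF; elim: m => [|m IH]; first by rewrite !big_ord0 /prG measure0.
rewrite !big_ord_recr /= -IH.
have mU : measurable (\big[setU/set0]_(i < m) F i) by apply: bigsetU_measurable.
apply: EFin_inj; rewrite EFinD !prGE //; last exact: measurableU.
rewrite measureU //; apply/seteqP; split=> // x []; rewrite -bigcup_mkord => -[k /= km Fk Fm].
by move: km; rewrite (tF _ _ _ Fk Fm) ltnn.
Qed.

Definition hdtl n (C : set T) (D : set (n.-tuple T)) : set (n.+1.-tuple T) :=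
  [set x | C (tnth x ord0) /\ D (behead_tuple x)].

Lemma behead_cons n (x : T) (t : n.-tuple T) : behead_tuple [tuple of x :: t] = t.
Proof. exact: val_inj. Qed.

Lemma tnth_beheadE n (x : n.+1.-tuple T) (i : 'I_n) :
  tnth (behead_tuple x : n.-tuple T) i = tnth x (lift ord0 i).
Proof. by case/tupleP: x => x t; rewrite behead_cons tnthS. Qed.

Lemma measurable_hdtl n (C : set T) (D : set (n.-tuple T)) : measurable C -> measurable D ->
  measurable (hdtl C D).
Proof.
move=> mC mD; apply: measurableI.
  by rewrite -[X in measurable X]setTI; exact: measurable_tnth.
rewrite -[X in measurable X]setTI.
have mb : measurable_fun setT (fun x : n.+1.-tuple T => behead_tuple x : n.-tuple T).
  apply/measurable_fun_tnthP => i.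
  apply: (eq_measurable_fun (fun x : n.+1.-tuple T => tnth x (lift ord0 i))) => [x _|].
    by rewrite /= tnth_beheadE.
  exact: measurable_tnth.
exact: mb.
Qed.

Lemma prG_hdtl n (C : set T) (D : set (n.-tuple T)) : measurable C -> measurable D ->
  prG (hdtl C D) = prN C * prG D.
Proof.
move=> mC mD; rewrite /prG /prN.
have -> : gam n.+1 (hdtl C D) = (N C * gam n D)%E.
  rewrite -product_measure1E //= /distribution /pushforward; congr (_ _).
  by apply/seteqP; split=> -[x t]; rewrite /hdtl /cons_pair /= tnth0 behead_cons.
by rewrite fineM // fin_num_measure.
Qed.

Lemma measurable_box n (C : set T) : measurable C ->
  measurable [set x : n.-tuple T | forall i, C (tnth x i)].
Proof.
move=> mC; rewrite (_ : [set _ | _] = \bigcap_(i in [set: 'I_n])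
    ((fun x : n.-tuple T => tnth x i) @^-1` C)).
  apply: fin_bigcap_measurable => [|i _]; first exact: finite_finset.
  by rewrite -[X in measurable X]setTI; exact: measurable_tnth.
by apply/seteqP; split=> x /= Ax i; [move=> _|]; exact: Ax.
Qed.

Lemma prG_box n (C : set T) : measurable C ->
  prG [set x : n.-tuple T | forall i, C (tnth x i)] = prN C ^+ n.
Proof.
move=> mC; elim: n => [|n IH].
  rewrite expr0 /prG (_ : [set _ | _] = setT) ?probability_setT //.
  by apply/seteqP; split=> // x _ /= [].
rewrite exprS -IH -prG_hdtl //; last exact: measurable_box.
congr prG; apply/seteqP; split=> x /=.
  by move=> Cx; split=> [|i]; rewrite ?tnth_beheadE; exact: Cx.
case=> C0 CS i; case: (unliftP ord0 i) => [j ->|-> //].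
by rewrite -tnth_beheadE; exact: CS.
Qed.

(** A union bound in the form of Bernoulli's inequality for the power [prN C ^+ n]. *)
Lemma prG_notbox n (C : set T) (d : R) : measurable C -> 1 - d <= prN C -> d <= 1 ->
  prG (~` [set x : n.-tuple T | forall i, C (tnth x i)]) <= n%:R * d.
Proof.
move=> mC Cd d1; rewrite prG_setC ?prG_box //; last exact: measurable_box.
have C1 : prN C <= 1 by rewrite -lee_fin prNE //; exact: probability_le1.
have : 1 - n%:R * (1 - prN C) <= prN C ^+ n.
  elim: n => [|n IH]; first by rewrite mul0r subr0 expr0.
  have C0 : 0 <= prN C by lra.
  have := ler_wpM2l C0 IH; rewrite -exprS -natr1.
  have : 0 <= n%:R * (1 - prN C) ^+ 2 by rewrite mulr_ge0 ?sqr_ge0.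
  by lra.
have : n%:R * (1 - prN C) <= n%:R * d by apply: ler_wpM2l => //; lra.
lra.
Qed.

(** Fubini with coordinate [i] innermost: the other coordinates are peeled off from the front until
    [i] is the first. It reduces anticoncentration to one variable. *)
Lemma gaussian_section_le n (i : 'I_n) (B : set (n.-tuple T)) (k : R) : measurable B ->
  (forall x, prN [set v | B (setc x i v)] <= k) -> prG B <= k.
Proof.
elim: n i B => [[]//|n IH] i B mB Bk.
have mI : measurable_fun setT (fun x : n.+1.-tuple T => (\1_B x)%:E : \bar R).
  exact/measurable_EFinP/measurable_indic.
have I0 x : (0 <= (\1_B x)%:E :> \bar R)%E by rewrite lee_fin.
have mc x : measurable [set t : n.-tuple T | B [tuple of x :: t]].
  by rewrite -[X in measurable X]setTI; exact: (@measurable_consx R n x).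
have mI2 : measurable_fun setT ((fun x : n.+1.-tuple T => (\1_B x)%:E : \bar R) \o @cons_pair R n).
  by apply: measurableT_comp => //; exact: measurable_cons_pair.
rewrite -lee_fin prGE // -(setIT B) -integral_indic //.
case: (unliftP ord0 i) => [j ij|ij].
  rewrite integral_gaussianS //.
  apply: (@le_trans _ _ (\int[N]_x k%:E)%E); last first.
    by rewrite integral_cst // [X in (_ * X <= _)%E](_ : _ = 1%E) ?mule1 //; exact: probability_setT.
  apply: ge0_le_integral => //.
  - by move=> x _; apply: integral_ge0.
  - exact: (@measurable_fun_fubini_tonelli_F _ _ _ _ _ (gam n) _ mI2 (fun=> I0 _)).
  - move=> x _; rewrite (_ : (fun t : n.-tuple T => _) = (fun t => (\1_[set t : n.-tuple T | B [tuple of x :: t]] t)%:E)); last first.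
      by apply/funext => t; rewrite !indicE; congr (_%:R%:E); rewrite !mem_setE.
    apply: (@le_trans _ _ (prG [set t : n.-tuple T | B [tuple of x :: t]])%:E).
      by rewrite prGE // integral_indic // setIT.
    rewrite lee_fin; apply: (IH j) => // t.
    have := Bk [tuple of x :: t]; rewrite ij; congr (prN _ <= _).
    by apply/seteqP; split=> v /=; rewrite setc_consS.
rewrite integral_gaussianS_swap //.
apply: (@le_trans _ _ (\int[gam n]_x k%:E)%E); last first.
    by rewrite integral_cst // [X in (_ * X <= _)%E](_ : _ = 1%E) ?mule1 //; exact: probability_setT.
apply: ge0_le_integral => //.
- by move=> x _; apply: integral_ge0.
- exact: (@measurable_fun_fubini_tonelli_G _ _ _ _ _ (normal_prob (0:R) 1) _ mI2 (fun=> I0 _)).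
-- move=> t _.
  have ms : measurable [set v : T | B [tuple of v :: t]].
    rewrite -[X in measurable X]setTI.
    exact: (measurableT_comp (@measurable_cons_pair R n) (@pair2_measurable _ _ _ _ t)).
  rewrite (_ : (fun v : T => _) = (fun v => (\1_[set v : T | B [tuple of v :: t]] v)%:E)); last first.
    by apply/funext => v; rewrite !indicE; congr (_%:R%:E); rewrite !mem_setE.
  apply: (@le_trans _ _ (prN [set v : T | B [tuple of v :: t]])%:E).
    by rewrite prNE // integral_indic // setIT.
  rewrite lee_fin.
  have := Bk [tuple of 0 :: t]; rewrite ij; congr (prN _ <= _).
  by apply/seteqP; split=> v /=; rewrite setc_cons0.
Qed.

End gaussian_tools.

Lemma dcondE a n A E s : dcond a n A E s = if 0 < E * s%:Z + K3 a n A E + 1 then 1 else 0.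
Proof. by []. Qed.

(** * The event counted by the dynamic program *)

Section events.
Variables (R : realType) (a n : nat) (A : nat -> nat -> int) (E : int) (VM : nat).
Hypothesis a8 : (8 <= a)%N.
Hypothesis na : (n + 4 < a)%N.
Hypothesis E0 : 0 < E.
Local Notation T := (measurableTypeR R).
Local Notation J := (a ^ 10)%N.
Local Notation prN := (@prN R).
Local Notation ar := (a%:R : R).
Local Notation Vv := (Vv a A E).
Local Notation dcond := (dcond a n A E).
Local Notation Uf := (Uf a n A E).
Local Notation cell := (@cell R a).
Local Notation xg := (@xg R a).
Local Notation pc := (@pc R a).
Local Notation qg := (@qg R a).

Let a8R : 8 <= ar. Proof. by rewrite ler_nat. Qed.
Let a0R : 0 < ar. Proof. by have := a8R; lra. Qed.

(** The event whose Gaussian probability obeys the recursion of [Uf], with the true cell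
    probabilities in place of the weights. *)
Fixpoint Gev (l s : nat) : set (l.-tuple T) :=
  match l return set (l.-tuple T) with
  | 0 => [set _ | dcond s = 1]
  | l'.+1 => \bigcup_(j in [set k | (k < J + J)%N]) hdtl (cell j) (@Gev l' (s + absz (Vv (n - l') j)))
  end.

Arguments Gev l s : clear implicits.

Lemma cell_uniq j k x : cell j x -> cell k x -> j = k.
Proof.
rewrite /cell /= !in_itv /= => /andP[j1 j2] /andP[k1 k2].
case: (ltngtP j k) => // h; exfalso.
  have := @xg_le R a a8 _ _ h; lra.
have := @xg_le R a a8 _ _ h; lra.
Qed.

Lemma cell_ex x : - ar <= x < ar -> exists2 j, (j < J + J)%N & cell j x.
Proof.
rewrite -(@xg0 R a a8) -(@xgJJ R a a8) => /andP[]; elim: (J + J)%N => [|k IH] x1 x2; first by lra.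
case: (ltP x (xg k)) => h; first by have [j jk cj] := IH x1 h; exists j => //; exact: ltnW.
by exists k => //; rewrite /cell /= in_itv /= h.
Qed.

Lemma measurable_Gev l s : measurable (Gev l s).
Proof.
elim: l s => [|l IH] s /=.
  case: (pselect (dcond s = 1)) => h.
    by rewrite (_ : [set _ | _] = setT) //; apply/seteqP; split.
  by rewrite (_ : [set _ | _] = set0) //; apply/seteqP; split.
rewrite bigcup_mkord; apply: bigsetU_measurable => j _.
by apply: measurable_hdtl => //; exact: measurable_cell.
Qed.

Lemma prG_GevS l s : prG (Gev l.+1 s) =
  \sum_(j < J + J) pc j * prG (Gev l (s + absz (Vv (n - l) j))).
Proof.
have mh j : measurable (hdtl (cell j) (Gev l (s + absz (Vv (n - l) j)))).
  by apply: measurable_hdtl; [exact: measurable_cell|exact: measurable_Gev].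
have -> : Gev l.+1 s = \big[setU/set0]_(j < J + J) hdtl (cell j) (Gev l (s + absz (Vv (n - l) j))%N).
  exact: bigcup_mkord.
rewrite (@prG_bigU R _ _ (fun j => hdtl (cell j) (Gev l (s + absz (Vv (n - l) j))%N)) mh).
  by apply: eq_bigr => j _; rewrite prG_hdtl //; [exact: measurable_cell|exact: measurable_Gev].
by move=> j k x [cj _] [ck _]; exact: cell_uniq cj ck.
Qed.

Lemma Gev_char l s (x : l.-tuple T) (js : nat -> nat) : (l <= n)%N ->
  (forall i : 'I_l, (js i < J + J)%N /\ cell (js i) (tnth x i)) ->
  Gev l s x <-> dcond (s + \sum_(i < l) absz (Vv (n - l + i).+1 (js i)))%N = 1.
Proof.
elim: l s x js => [|l IH] s x js lN cx; first by rewrite big_ord0 addn0.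
have [j0 c0] := cx ord0.
have st : Gev l.+1 s x <-> Gev l (s + absz (Vv (n - l) (js 0%N))) (behead_tuple x).
  split=> [[j /= jJ [cj Gj]]|G]; first by rewrite -(cell_uniq cj c0).
  by exists (js 0%N).
rewrite st (IH _ _ (fun i => js i.+1)); last 2 first.
- exact: ltnW.
- by move=> i; rewrite tnth_beheadE; exact: (cx (lift ord0 i)).
rewrite big_ord_recl /= addn0 addnA (_ : (n - l.+1).+1 = n - l)%N; last by plia.
have -> // : (\sum_(i < l) absz (Vv (n - l.+1 + bump 0 i).+1 (js (bump 0 i))) =
  \sum_(i < l) absz (Vv (n - l + i).+1 (js i.+1)))%N.
by apply: eq_bigr => i _; congr (absz (Vv _ _)); rewrite /bump; plia.
Qed.

(** A hybrid argument: replacing the cell probabilities by the normalised weights in one variable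
    costs their total variation distance. *)
Lemma Gev_Uf l s : `|prG (Gev l s) - (Uf l s)%:~R / (Wt a)%:~R ^+ l| <= l%:R * (16 / ar ^+ 2).
Proof.
have [q0 [q1 qt]] := @tv_cells R a a8.
have A2 : 0 <= 16 / ar ^+ 2 by rewrite divr_ge0 ?sqr_ge0.
elim: l s => [|l IH] s.
  rewrite mul0r expr0 divr1 /=; suff -> : prG (Gev 0 s) = (dcond s)%:~R by rewrite subrr normr0.
  rewrite /prG /= indicE; case: (pselect (dcond s = 1)) => h; first by rewrite mem_set // h.
  by rewrite memNset //; move: h; rewrite dcondE; case: ifP.
rewrite prG_GevS.
pose u j : R := (Uf l (s + absz (Vv (n - l) j)))%:~R / (Wt a)%:~R ^+ l.
pose g j := prG (Gev l (s + absz (Vv (n - l) j))).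
have -> : (Uf l.+1 s)%:~R / (Wt a)%:~R ^+ l.+1 = \sum_(j < J + J) qg j * u j :> R.
  rewrite /= rmorph_sum /= mulr_suml; apply: eq_bigr => j _.
  by rewrite rmorphM /qg /u exprS invfM; ring.
rewrite -sumrB; apply: le_trans (ler_norm_sum _ _ _) _.
apply: (@le_trans _ _ (\sum_(j < J + J) (`|pc j - qg j| + qg j * (l%:R * (16 / ar ^+ 2))))).
  apply: ler_sum => j _; rewrite -/(g j).
  have -> : pc j * g j - qg j * u j = (pc j - qg j) * g j + qg j * (g j - u j) by ring.
  apply: le_trans (ler_normD _ _) _; apply: lerD.
    rewrite normrM ler_piMr // ger0_norm ?prG_ge0 //; apply: prG_le1; exact: measurable_Gev.
  by rewrite normrM ger0_norm ?q0 //; apply: ler_wpM2l; [exact: q0|exact: IH].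
by rewrite big_split /= -mulr_suml q1 mul1r -natr1; lra.
Qed.

(** With [u = 1/a]: if [|l| >= u^2 / 4], the quadratic bound suffices. Otherwise [|m| >= u], and on
    the interval from [-a] to [a] the slope of every chord is at least [u / 2], so the set there has
    diameter at most [4 u^4]; the tails add [4 u^2]. *)
Lemma anticonc1 (l m c : R) : (ar^-1 <= `|l|) || (ar^-1 <= `|m|) ->
  prN [set y : T | `|l * y ^+ 2 + m * y + c| <= (ar ^+ 5)^-1] <= 4 * ar^-1.
Proof.
move=> lm; set d := (ar ^+ 5)^-1; pose u := ar^-1.
have u0 : 0 < u by rewrite invr_gt0.
have u8 : 8 * u <= 1 by rewrite ler_pdivrMr // mul1r.
have dE : d = u ^+ 5 by rewrite /d /u exprVn.
have u2 : u ^+ 2 <= u / 8 by rewrite expr2; nra.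
have u20 : 0 < u ^+ 2 by rewrite exprn_gt0.
have u3 : u ^+ 3 <= u ^+ 2 / 8 by rewrite exprS; nra.
have d0 : 0 <= d by rewrite dE exprn_ge0 // ltW.
have mB : measurable [set y : T | `|l * y ^+ 2 + m * y + c| <= d].
  rewrite -[X in measurable X]setTI.
  apply: (@measurable_fun_le _ _ _ setT (fun y : T => `|l * y ^+ 2 + m * y + c|) (cst d)) => //.
  apply: measurableT_comp => //; apply: continuous_measurable_fun => y.
  by apply: cvgD; [apply: cvgD; (apply: cvgM; [exact: cvg_cst|])|exact: cvg_cst]; [exact: exprn_continuous|exact: cvg_id].
case: (lerP (u ^+ 2 / 4) `|l|) => hl.
  have l0 : 0 < `|l| by lra.
  apply: le_trans (quad_anticonc _ _ _ d0) _; first by rewrite -normr_gt0.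
  apply: ler_wpM2l => //; rewrite [leRHS](_ : _ = Num.sqrt (u ^+ 2)); last first.
    by rewrite sqrtr_sqr ger0_norm // ltW.
  apply: ler_wsqrtr.
  rewrite ler_pdivrMr // dE; apply: le_trans (_ : u ^+ 2 * (u ^+ 2 / 4) <= _); last first.
    by apply: ler_wpM2l => //; exact: ltW.
  rewrite (_ : u ^+ 5 = u ^+ 2 * u ^+ 3); last by rewrite -exprD.
  by apply: ler_wpM2l; [exact: ltW|lra].
have {}lm : u <= `|m| by case/orP: lm => // h; exfalso; rewrite -/u in h; lra.
pose B := [set y : T | `|l * y ^+ 2 + m * y + c| <= d] `&` `[(- ar), ar[%classic.
have mB1 : measurable B by exact: measurableI.
have Bd : prN B <= 2 * (4 * u ^+ 4).
  apply: lin_anticonc => //; first by rewrite mulr_ge0 // exprn_ge0 // ltW.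
  move=> y z [/= hy] + [/= hz]; rewrite !in_itv /= => /andP[y1 y2] /andP[z1 z2].
  have e1 : `|(y - z) * (l * (y + z) + m)| <= 2 * d.
    have -> : (y - z) * (l * (y + z) + m) = (l * y ^+ 2 + m * y + c) - (l * z ^+ 2 + m * z + c) by ring.
    by apply: le_trans (ler_normB _ _) _; lra.
  have e2 : `|l * (y + z)| <= u / 2.
    rewrite normrM; apply: (@le_trans _ _ (u ^+ 2 / 4 * (2 * ar))).
      apply: ler_pM => //; first exact: ltW.
      by rewrite ler_norml; apply/andP; split; lra.
    by rewrite /u le_eqVlt; apply/orP; left; apply/eqP; field; rewrite gt_eqF.
  have e3 : u / 2 <= `|l * (y + z) + m|.
    by have := lerB_normD m (l * (y + z)); rewrite [m + _]addrC; lra.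
  move: e1; rewrite normrM => e1.
  have e4 : `|y - z| * (u / 2) <= 2 * d by apply: le_trans e1; apply: ler_wpM2l.
  rewrite -(ler_pM2r (_ : 0 < u / 2)); last by lra.
  have e5 : 4 * u ^+ 4 * (u / 2) = 2 * u ^+ 5 by field.
  by rewrite e5 -dE.
have t1 := @tail_left R a a8; have t2 := @tail_right R a a8.
have mt1 : measurable (`]-oo, (- ar)[%classic : set T) by exact: measurable_itv.
have mt2 : measurable (`[ar, +oo[%classic : set T) by exact: measurable_itv.
have le3 : prN [set y : T | `|l * y ^+ 2 + m * y + c| <= d] <=
    prN B + (prN `]-oo, (- ar)[%classic + prN `[ar, +oo[%classic).
  rewrite -lee_fin !EFinD !prNE //.
  apply: (@le_trans _ _ (normal_prob 0 1 (B `|` (`]-oo, (- ar)[%classic `|` `[ar, +oo[%classic)))).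
    apply: le_measure; rewrite ?inE //; first by apply: measurableU => //; exact: measurableU.
    move=> y yB; case: (ltP y (- ar)) => h1; first by right; left; rewrite /= in_itv.
    case: (ltP y ar) => h2; last by right; right; rewrite /= in_itv /= h2.
    by left; split=> //; rewrite /= in_itv /= h1.
  apply: le_trans (measureU2 _ _ _) _ => //; first exact: measurableU.
  by apply: leeD => //; apply: measureU2.
have u4 : u ^+ 4 <= u ^+ 3 / 8 by rewrite exprS; have : 0 < u ^+ 3 by [rewrite exprn_gt0]; nra.
have e2 : 2 / ar ^+ 2 = 2 * u ^+ 2 by rewrite /u exprVn.
rewrite e2 in t1 t2; rewrite -/u; lra.
Qed.

End events.

(** * Comparison with the dynamic program *)

Lemma tt_sq a j : (j < a ^ 10 + a ^ 10)%N -> 0 <= tt a j * tt a j <= (a ^ 20)%N%:Z.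
Proof.
move=> jJ; have t3 : `|tt a j| <= (a ^ 10)%N%:Z by rewrite /tt; plia.
rewrite -expr2 sqr_ge0 /= (_ : (a ^ 20)%N%:Z = (a ^ 10)%N%:Z ^+ 2); last by rewrite expr2 -PoszM -expnD.
by rewrite -[leLHS]ger0_norm ?sqr_ge0 // normrX ler_pXn2r ?nnegrE.
Qed.

Lemma Wt_gt0 a : (8 <= a)%N -> 0 < Wt a.
Proof.
move=> a8; have w0 j : (j < a ^ 10 + a ^ 10)%N -> 0 < wt a j.
  move=> jJ; rewrite /wt exprn_gt0 // /ut; have /andP[_ t2] := tt_sq jJ.
  have a25 : (a ^ 20 <= a ^ 25)%N by rewrite leq_pexp2l //; plia.
  have a250 : (0 < a ^ 25)%N by rewrite expn_gt0; plia.
  plia.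
have J0 : (0 < a ^ 10 + a ^ 10)%N by rewrite addn_gt0 expn_gt0; plia.
rewrite /Wt (bigD1 (Ordinal J0)) //= ltr_wpDr //; last exact: w0.
by apply: sumr_ge0 => j _; apply/ltW; exact: w0.
Qed.

(** On the grid [|lambda x^2 + mu x| <= a^3 + 2 a^2 <= a^4], so the shifted value lies between 0 and
    [2 a^4]; scaled by [a^7] this gives the bound [2 a^11] for the table index. *)
Lemma numv_bounds a n (A : nat -> nat -> int) (E : int) : (8 <= a)%N -> 0 < E ->
  (forall i j, (i < n.+1)%N -> (j < n.+1)%N -> (0 < i + j)%N -> `|A i j| <= a%:Z * E) ->
  forall i j, (0 < i <= n)%N -> (j < a ^ 10 + a ^ 10)%N ->
  0 <= numv a A E i j /\ numv a A E i j < den a E * ((a ^ 11 + a ^ 11).+1)%:Z.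
Proof.
move=> a8 E0 Ab i j iN jJ; have t3 : `|tt a j| <= (a ^ 10)%N%:Z by rewrite /tt; plia.
have /andP[t1 t2] := tt_sq jJ.
have Aii : `|A i i| <= a%:Z * E by apply: Ab; plia.
have A0i : `|A 0%N i| <= a%:Z * E by apply: Ab; plia.
rewrite /numv /den.
have p22 : (a ^ 22)%N%:Z = a%:Z * a%:Z * (a ^ 20)%N%:Z by rewrite -!PoszM -mulnA -!expnS.
have p20 : a%:Z * ((a ^ 10)%N%:Z * (a ^ 9)%N%:Z) = (a ^ 20)%N%:Z by rewrite -!PoszM -expnD -expnS.
have B1 : `|A i i * (tt a j * tt a j)| <= a%:Z * E * (a ^ 20)%N%:Z.
  by rewrite normrM; apply: ler_pM => //; rewrite ger0_norm.
have B2 : `|A 0%N i * tt a j * (a ^ 9)%N%:Z| <= E * (a ^ 20)%N%:Z.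
  rewrite !normrM (ger0_norm (_ : 0 <= (a ^ 9)%N%:Z)) // -p20.
  have -> : E * (a%:Z * ((a ^ 10)%N%:Z * (a ^ 9)%N%:Z)) = a%:Z * E * (a ^ 10)%N%:Z * (a ^ 9)%N%:Z by ring.
  by apply: ler_wpM2r => //; apply: ler_pM.
have P0 : 0 < (a ^ 20)%N%:Z by rewrite ltz_nat expn_gt0; plia.
have Q0 : 0 < (a ^ 18)%N%:Z by rewrite ltz_nat expn_gt0; plia.
have S0 : 0 <= (a ^ 7)%N%:Z by [].
have EP : 0 < E * (a ^ 20)%N%:Z by rewrite mulr_gt0.
have aa : (a%:Z + 2) * (E * (a ^ 20)%N%:Z) <= a%:Z * a%:Z * (E * (a ^ 20)%N%:Z).
  by apply: ler_wpM2r; [exact: ltW|pnia].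
have p29 : (a ^ 22)%N%:Z * (a ^ 7)%N%:Z = (a ^ 18)%N%:Z * (a ^ 11)%N%:Z by rewrite -!PoszM -!expnD.
move: B1 B2; rewrite !ler_norml => /andP[b1 b2] /andP[b3 b4].
set S := _ + _ + _; have S1 : 0 <= S <= 2 * (E * (a ^ 22)%N%:Z).
  rewrite /S p22; move: aa b1 b2 b3 b4; move: (A i i * _) (A 0%N i * _ * _) (a ^ 20)%N%:Z => x y P.
  by move=> aa b1 b2 b3 b4; apply/andP; split; lra.
case/andP: S1 => S1 S2; split; first by rewrite mulr_ge0.
apply: le_lt_trans (ler_wpM2r S0 S2) _.
have -> : 2 * (E * (a ^ 22)%N%:Z) * (a ^ 7)%N%:Z = E * (a ^ 18)%N%:Z * (2 * (a ^ 11)%N%:Z).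
  by rewrite -mulrA -(mulrA E) p29; ring.
rewrite ltr_pM2l ?mulr_gt0 //; plia.
Qed.

Lemma VvE a A E i j : Vv a A E i j = (numv a A E i j %/ den a E)%Z.
Proof. by []. Qed.

Lemma xgE (R : realType) a j : xg R a j = (tt a j)%:~R / (a ^ 9)%:R.
Proof. by []. Qed.

Section compare.
Variables (R : realType) (a n : nat) (A : nat -> nat -> int) (E : int).
Hypothesis a8 : (8 <= a)%N.
Hypothesis na : (n + 4 < a)%N.
Hypothesis E0 : 0 < E.
Hypothesis As : symA A.
Hypothesis Ab : forall i j, (i < n.+1)%N -> (j < n.+1)%N -> (0 < i + j)%N -> `|A i j| <= a%:Z * E.
Hypothesis nobad : forall p q, ~~ bad a n A E p q.
Local Notation T := (measurableTypeR R).
Local Notation J := (a ^ 10)%N.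
Local Notation prN := (@prN R).
Local Notation ar := (a%:R : R).
Local Notation Er := (E%:~R : R).
Local Notation Vv := (Vv a A E).
Local Notation cell := (@cell R a).
Local Notation xg := (@xg R a).
Local Notation pc := (@pc R a).
Local Notation qg := (@qg R a).
Local Notation Gev l s := (@Gev R a n A E l s).

Let a8R : 8 <= ar. Proof. by rewrite ler_nat. Qed.
Let a0R : 0 < ar. Proof. by have := a8R; lra. Qed.
Let E0R : 0 < Er. Proof. by rewrite ltr0z. Qed.
Let nR : (n%:R : R) <= ar. Proof. by rewrite ler_nat; plia. Qed.

Let hp k : (a ^ k)%N%:Z%:~R = ar ^+ k :> R. Proof. by rewrite -pmulrn natrX. Qed.

(** The homogeneous coordinates [(1, x)], extended by 0 beyond [n]. *)
Definition zv (x : n.-tuple T) (i : nat) : R := if i is i'.+1 then nth 0 x i' else 1.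

Lemma zvS x (i : 'I_n) : zv x i.+1 = tnth x i.
Proof. by rewrite /zv (tnth_nth 0). Qed.

Definition lamR i : R := (A i i)%:~R / Er.
Definition muR i : R := 2 * (A 0%N i)%:~R / Er.
Definition Dg (x : n.-tuple T) : R :=
  (A 0%N 0%N)%:~R / Er + \sum_(i < n) (lamR i.+1 * tnth x i ^+ 2 + muR i.+1 * tnth x i).

Lemma AR_bound i j : (i < n.+1)%N -> (j < n.+1)%N -> (0 < i + j)%N ->
  `|(A i j)%:~R / Er| <= ar.
Proof.
move=> iN jN ij; have := Ab iN jN ij; rewrite -(ler_int R) intr_norm rmorphM /= => h.
by rewrite normrM normfV (gtr0_norm E0R) ler_pdivrMr.
Qed.

Lemma AR_off i j : i != j -> (i < n)%N -> (j < n)%N ->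
  `|(A i.+1 j.+1)%:~R / Er| <= (ar ^+ 9)^-1.
Proof.
have off p q : (0 < p)%N -> (p < q)%N -> (q < n.+1)%N -> `|(A p q)%:~R / Er| <= (ar ^+ 9)^-1.
  move=> p0 pq qn; have := nobad p q; rewrite /bad p0 pq qn /= -leNgt.
  rewrite -(ler_int R) rmorphM /= intr_norm -pmulrn natrX => h.
  by rewrite normrM normfV (gtr0_norm E0R) ler_pdivrMr // mulrC ler_pdivlMr ?exprn_gt0.
move=> ij iN jN; case: (ltngtP i j) ij => // h _; first exact: off.
by rewrite As; exact: off.
Qed.

Lemma Vv_approx i j : (0 < i <= n)%N -> (j < J + J)%N ->
  `|(absz (Vv i j))%:R / ar ^+ 7 - ar ^+ 4 - (lamR i * xg j ^+ 2 + muR i * xg j)| <= (ar ^+ 7)^-1.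
Proof.
move=> iN jJ; have [b1 b2] := numv_bounds a8 E0 Ab iN jJ.
have d0 : 0 < den a E by rewrite /den mulr_gt0 // ltz_nat expn_gt0; plia.
have dR : 0 < (den a E)%:~R :> R by rewrite ltr0z.
have V0 : 0 <= Vv i j by rewrite VvE divz_ge0.
have e1 : (absz (Vv i j))%:R = (Vv i j)%:~R :> R by rewrite -[in RHS](gez0_abs V0).
have m1 : (Vv i j)%:~R * (den a E)%:~R <= (numv a A E i j)%:~R :> R.
  by rewrite -intrM ler_int VvE lez_floor // gt_eqF.
have m2 : (numv a A E i j)%:~R < ((Vv i j)%:~R + 1) * (den a E)%:~R :> R.
  by rewrite -[1]/(1%:~R) -intrD -intrM ltr_int VvE ltz_ceil.
have A7 : 0 < ar ^+ 7 by rewrite exprn_gt0.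
have nE : (numv a A E i j)%:~R / (den a E)%:~R =
    ar ^+ 7 * (lamR i * xg j ^+ 2 + muR i * xg j + ar ^+ 4) :> R.
  rewrite xgE /numv /den /lamR /muR natrX; move: (tt a j) => t.
  move: (hp 9%N) (hp 22%N) (hp 7%N) (hp 18%N).
  move: (a ^ 9)%N%:Z (a ^ 22)%N%:Z (a ^ 7)%N%:Z (a ^ 18)%N%:Z => p9 p22 p7 p18 h9 h22 h7 h18.
  rewrite !(rmorphM, rmorphD) /= h9 h22 h7 h18.
  by field; rewrite !gt_eqF.
rewrite e1; move: m1 m2; rewrite -ler_pdivlMr // -ltr_pdivrMr // nE.
move: (_ * _ + _) => g m1 m2.
have -> : (Vv i j)%:~R / ar ^+ 7 - ar ^+ 4 - g = ((Vv i j)%:~R - ar ^+ 7 * (g + ar ^+ 4)) / ar ^+ 7.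
  by field; rewrite gt_eqF.
rewrite normrM (gtr0_norm (_ : 0 < (ar ^+ 7)^-1)) ?invr_gt0 // ler_piMl ?invr_ge0 ?(ltW A7) //.
rewrite ler_norml; apply/andP; split; lra.
Qed.

Lemma dconvE s : dcond a n A E s = 1 <->
  0 <= (s%:R - n%:R * ar ^+ 11) / ar ^+ 7 + (A 0%N 0%N)%:~R / Er.
Proof.
have A7 : 0 < ar ^+ 7 by rewrite exprn_gt0.
have -> : (s%:R - n%:R * ar ^+ 11) / ar ^+ 7 + (A 0%N 0%N)%:~R / Er =
    (E * s%:Z + K3 a n A E)%:~R / (Er * ar ^+ 7).
  rewrite /K3; move: (hp 7%N) (hp 11%N); move: (a ^ 7)%N%:Z (a ^ 11)%N%:Z => p7 p11 h7 h11.
  rewrite !(rmorphM, rmorphD, rmorphN) /= h7 h11 -!pmulrn.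
  by field; rewrite !gt_eqF.
rewrite pmulr_lge0 ?invr_gt0 ?mulr_gt0 // ler0z /dcond.
by case: ifP => h; split=> //; plia.
Qed.

Let u := ar^-1.
Let u0 : 0 < u. Proof. by rewrite invr_gt0. Qed.
Let u8 : 8 * u <= 1. Proof. by rewrite ler_pdivrMr // mul1r. Qed.

(** At most [n^2 <= a^2] off-diagonal terms, each of size at most [a^-9 * a * a]. *)
Lemma qform_Dg x : (forall i, - ar <= tnth x i < ar) ->
  `|qform n.+1 A (zv x) / Er - Dg x| <= (ar ^+ 5)^-1.
Proof.
move=> bx.
pose off := \sum_(i < n) \sum_(j < n | j != i) (A i.+1 j.+1)%:~R / Er * tnth x i * tnth x j.
have -> : qform n.+1 A (zv x) / Er - Dg x = off.
  have -> : qform n.+1 A (zv x) = (A 0%N 0%N)%:~R + \sum_(i < n) (A 0%N i.+1)%:~R * tnth x i +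
    \sum_(i < n) ((A 0%N i.+1)%:~R * tnth x i + ((A i.+1 i.+1)%:~R * tnth x i * tnth x i +
      \sum_(j < n | j != i) (A i.+1 j.+1)%:~R * tnth x i * tnth x j)).
    rewrite /qform big_ord_recl big_ord_recl /= !mulr1; congr (_ + _ + _).
      by apply: eq_bigr => i _; rewrite mulr1 (tnth_nth 0).
    apply: eq_bigr => i _; rewrite big_ord_recl /= mulr1 (As _ 0%N); congr (_ + _).
      by rewrite (tnth_nth 0).
    rewrite (bigD1 i) //=; congr (_ + _); first by rewrite (tnth_nth 0).
    by apply: eq_bigr => j _; rewrite !(tnth_nth 0).
  rewrite /Dg /off !big_split /=.
  have e1 : \sum_(i < n) muR i.+1 * tnth x i =
    (\sum_(i < n) (A 0%N i.+1)%:~R * tnth x i) / Er + (\sum_(i < n) (A 0%N i.+1)%:~R * tnth x i) / Er.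
    by rewrite !mulr_suml -big_split; apply: eq_bigr => i _ /=; rewrite /muR; ring.
  have e2 : \sum_(i < n) lamR i.+1 * tnth x i ^+ 2 =
    (\sum_(i < n) (A i.+1 i.+1)%:~R * tnth x i * tnth x i) / Er.
    by rewrite mulr_suml; apply: eq_bigr => i _ /=; rewrite /lamR; ring.
  have e3 : \sum_(i < n) \sum_(j < n | j != i) (A i.+1 j.+1)%:~R / Er * tnth x i * tnth x j =
    (\sum_(i < n) \sum_(j < n | j != i) (A i.+1 j.+1)%:~R * tnth x i * tnth x j) / Er.
    by rewrite mulr_suml; apply: eq_bigr => i _ /=; rewrite mulr_suml; apply: eq_bigr => j _; ring.
  rewrite e1 e2 e3; ring.
have xa i : `|tnth x i| <= ar by have /andP[h1 h2] := bx i; rewrite ler_norml h1 ltW.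
apply: (@le_trans _ _ (\sum_(i < n) \sum_(j < n) (ar ^+ 9)^-1 * ar * ar)).
  apply: le_trans (ler_norm_sum _ _ _) _; apply: ler_sum => i _.
  apply: le_trans (ler_norm_sum _ _ _) _; rewrite [leLHS]big_mkcond; apply: ler_sum => j _.
  have t0 : 0 <= (ar ^+ 9)^-1 * ar * ar by rewrite !mulr_ge0 ?invr_ge0 ?exprn_ge0 // ltW.
  case: ifP => // ij; rewrite !normrM; apply: ler_pM => //; apply: ler_pM => //.
  by rewrite -normrM; apply: AR_off => //; rewrite eq_sym.
rewrite !sumr_const !card_ord -[leLHS]mulr_natl -[X in _ * X <= _]mulr_natl.
have -> : (ar ^+ 5)^-1 = ar * (ar * ((ar ^+ 9)^-1 * ar * ar)) by field; rewrite gt_eqF.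
have t0 : 0 <= (ar ^+ 9)^-1 * ar * ar by rewrite !mulr_ge0 ?invr_ge0 ?exprn_ge0 // ltW.
by apply: ler_pM => //; first [exact: mulr_ge0|exact: ler_wpM2r].
Qed.

(** The slope of a chord is at most [2 a^2 + 2 a <= 4 a^2], and the width of a cell is [a^-9]. *)
Lemma cell_approx i j (y : T) : (0 < i <= n)%N -> (j < J + J)%N -> cell j y -> - ar <= y < ar ->
  `|(lamR i * xg j ^+ 2 + muR i * xg j) - (lamR i * y ^+ 2 + muR i * y)| <= 4 * (ar ^+ 7)^-1.
Proof.
move=> iN jJ; rewrite /cell /= in_itv /= (@xgS R a a8) => /andP[y1 y2] /andP[y3 y4].
have xa := @xg_bound R a a8 j (ltnW jJ).
case/andP: (iN) => i1 i2.
have l1 : `|lamR i| <= ar by apply: (@AR_bound i i i2 i2); rewrite addn_gt0 i1.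
have m1 : `|muR i| <= 2 * ar.
  rewrite /muR -mulrA normrM ger0_norm //; apply: ler_wpM2l => //; exact: (@AR_bound 0%N i _ i2).
have -> : lamR i * xg j ^+ 2 + muR i * xg j - (lamR i * y ^+ 2 + muR i * y) =
  (lamR i * (xg j + y) + muR i) * (xg j - y) by ring.
have ya : `|y| <= ar by rewrite ler_norml y3 ltW.
have d1 : `|xg j - y| <= hh R a by rewrite ler_norml; apply/andP; split; have := @hh_gt0 R a a8; lra.
have -> : 4 * (ar ^+ 7)^-1 = (4 * ar ^+ 2) * hh R a by rewrite /hh natrX; field; rewrite gt_eqF.
rewrite normrM; apply: ler_pM => //.
apply: le_trans (ler_normD _ _) _; rewrite normrM.
have : `|lamR i| * `|xg j + y| <= ar * (2 * ar).
  by apply: ler_pM => //; apply: le_trans (ler_normD _ _) _; lra.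
have := a8R; rewrite expr2; nra.
Qed.

(** [D'] is the value that the program assigns to the grid point below [x]. Each variable
    contributes [a^-7] from rounding down and [4 a^-7] from the move to the grid, and
    [5 n <= a^2]. *)
Lemma Gev_Dg x : (forall i, - ar <= tnth x i < ar) ->
  exists2 D' : R, Gev n 0%N x <-> 0 <= D' & `|D' - Dg x| <= (ar ^+ 5)^-1.
Proof.
move=> bx.
have /choice[f hf] : forall i : 'I_n, exists j, (j < J + J)%N /\ cell j (tnth x i).
  by move=> i; have [j h1 h2] := cell_ex a8 (bx i); exists j.
pose js k := oapp f 0%N (insub k).
have jsE (i : 'I_n) : js i = f i by rewrite /js valK.
have hjs (i : 'I_n) : (js i < J + J)%N /\ cell (js i) (tnth x i) by rewrite jsE.
exists (((0 + \sum_(i < n) absz (Vv (n - n + i).+1 (js i)))%N%:R - n%:R * ar ^+ 11) / ar ^+ 7 +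
    (A 0%N 0%N)%:~R / Er).
  by rewrite -dconvE; apply: Gev_char.
have -> : ((0 + \sum_(i < n) absz (Vv (n - n + i).+1 (js i)))%N%:R - n%:R * ar ^+ 11) / ar ^+ 7 +
    (A 0%N 0%N)%:~R / Er - Dg x =
  \sum_(i < n) ((absz (Vv i.+1 (js i)))%:R / ar ^+ 7 - ar ^+ 4 - (lamR i.+1 * tnth x i ^+ 2 + muR i.+1 * tnth x i)).
  rewrite /Dg !sumrB sumr_const card_ord -[ar ^+ 4 *+ n]mulr_natl add0n natr_sum -mulr_suml.
  under eq_bigr => i _ do rewrite subnn add0n.
  by field; rewrite !gt_eqF.
apply: le_trans (ler_norm_sum _ _ _) _.
apply: (@le_trans _ _ (\sum_(i < n) 5 * (ar ^+ 7)^-1)).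
  apply: ler_sum => i _; have [h1 h2] := hjs i; have iN : (0 < i.+1 <= n)%N by rewrite ltn_ord.
  have v1 := Vv_approx iN h1; have v2 := cell_approx iN h1 h2 (bx i).
  apply: le_trans (ler_distD (lamR i.+1 * xg (js i) ^+ 2 + muR i.+1 * xg (js i)) _ _) _; lra.
rewrite sumr_const card_ord -[leLHS]mulr_natl.
have -> : (ar ^+ 5)^-1 = ar ^+ 2 * (ar ^+ 7)^-1 by field; rewrite gt_eqF.
rewrite mulrA; apply: ler_wpM2r; first by rewrite invr_ge0 exprn_ge0 // ltW.
have := nR; have := a8R; rewrite expr2; nra.
Qed.

Lemma measurable_zv i : measurable_fun setT (fun x : n.-tuple T => zv x i : T).
Proof.
case: i => [|i]; first exact: measurable_cst.
case: (ltnP i n) => h; last first.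
  apply: (eq_measurable_fun (fun=> 0 : T)) => // x _.
  by rewrite /zv nth_default // size_tuple.
by apply: (eq_measurable_fun (fun x : n.-tuple T => tnth x (Ordinal h))) => [x _|];
  [rewrite -(zvS x (Ordinal h))|exact: measurable_tnth].
Qed.

Lemma measurable_qform (B : nat -> nat -> int) :
  measurable [set x : n.-tuple T | 0 <= qform n.+1 B (zv x)].
Proof.
have m : measurable_fun setT (fun x : n.-tuple T => qform n.+1 B (zv x) : T).
  apply: measurable_sum => i; apply: measurable_sum => j.
  by apply: measurable_funM; [apply: measurable_funM => //|]; exact: measurable_zv.
rewrite -[X in measurable X]setTI; apply: (@measurable_fun_le _ _ _ setT (cst 0) _) => //.
Qed.

Lemma measurable_Dg : measurable_fun setT (fun x : n.-tuple T => Dg x : T).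
Proof.
apply: measurable_funD => //; apply: measurable_sum => i; apply: measurable_funD.
  by apply: measurable_funM => //; apply: measurable_funX; exact: measurable_tnth.
by apply: measurable_funM => //; exact: measurable_tnth.
Qed.

Let ball5 : set (n.-tuple T) := [set x | `|Dg x| <= (ar ^+ 5)^-1].

Lemma measurable_ball5 : measurable ball5.
Proof.
rewrite -[X in measurable X]setTI.
apply: (@measurable_fun_le _ _ _ setT (fun x : n.-tuple T => `|Dg x|) (cst _)) => //.
by apply: measurableT_comp => //; exact: measurable_Dg.
Qed.

Lemma Dg_anticonc i : (i < n)%N ->
  (E <= a%:Z * `|A i.+1 i.+1|) || (E <= a%:Z * `|A 0%N i.+1|) -> prG ball5 <= 4 * u.
Proof.
move=> iN big; apply: (@gaussian_section_le R n (Ordinal iN)); first exact: measurable_ball5.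
move=> x; pose i0 := Ordinal iN.
pose c := (A 0%N 0%N)%:~R / Er + \sum_(j < n | j != i0) (lamR j.+1 * tnth x j ^+ 2 + muR j.+1 * tnth x j).
rewrite (_ : [set v | _] = [set y : T | `|lamR i.+1 * y ^+ 2 + muR i.+1 * y + c| <= (ar ^+ 5)^-1]).
  apply: anticonc1 => //; apply/orP; case/orP: big => big; [left|right];
    move: big; rewrite -(ler_int R) rmorphM /= intr_norm -pmulrn => big.
    by rewrite normrM normfV (gtr0_norm E0R) ler_pdivlMr // ler_pdivrMl.
  rewrite /muR -mulrA normrM ger0_norm // normrM normfV (gtr0_norm E0R).
  have : ar^-1 <= `|(A 0%N i.+1)%:~R| / Er by rewrite ler_pdivlMr // ler_pdivrMl.
  by have := u0; rewrite /u; lra.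
have e v : Dg (setc x i0 v) = lamR i.+1 * v ^+ 2 + muR i.+1 * v + c.
  rewrite /Dg (bigD1 i0) //= !tnth_setc eqxx /c.
  rewrite (eq_bigr (fun j : 'I_n => lamR j.+1 * tnth x j ^+ 2 + muR j.+1 * tnth x j)); last first.
    by move=> j ji; rewrite tnth_setc (negbTE ji).
  by ring.
by apply/seteqP; split=> v /=; rewrite /ball5 /= e.
Qed.

Lemma prN_box : 1 - 4 * u ^+ 2 <= prN `[(- ar), ar[%classic.
Proof.
have /andP[h _] := @sum_pc_all R a a8; move: h.
by rewrite -(big_mkord xpredT pc) sum_pc // xg0 // xgJJ // /u exprVn.
Qed.

(** Inside the cube, both the full form and the rounded one are within [a^-5] of [Dg], so all signs
    agree unless [|Dg| <= a^-5]. That exception costs [4 u], and leaving the cube costs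
    [n * 4 u^2 <= 4 u]. *)
Lemma compare i : (i < n)%N ->
  (E <= a%:Z * `|A i.+1 i.+1|) || (E <= a%:Z * `|A 0%N i.+1|) ->
  `|prG [set x : n.-tuple T | 0 <= qform n.+1 A (zv x)] - prG (Gev n 0%N)| <= 8 * u.
Proof.
move=> iN big.
pose box : set (n.-tuple T) := [set x | forall i, `[(- ar), ar[%classic (tnth x i)].
have mb : measurable box by apply: measurable_box; exact: measurable_itv.
have mC := measurableC mb; have mB := measurable_ball5.
have mG : measurable (Gev n 0%N) by exact: measurable_Gev.
have mF := measurable_qform A.
have mU : measurable (~` box `|` ball5) by exact: measurableU.
have key x : box x -> ~ ball5 x -> (0 <= qform n.+1 A (zv x)) <-> Gev n 0%N x.
  move=> bx; rewrite /ball5 /= => nb.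
  have bx' j : - ar <= tnth x j < ar by have := bx j; rewrite /= in_itv.
  have [D' GD d1] := Gev_Dg bx'; have d2 := qform_Dg bx'.
  have -> : (0 <= qform n.+1 A (zv x)) = (0 <= qform n.+1 A (zv x) / Er) by rewrite pmulr_lge0 ?invr_gt0.
  rewrite GD; move: nb d1 d2; move: (qform _ _ _ / _) (Dg x) => q d nb.
  rewrite !ler_norml => /andP[d1 d2] /andP[d3 d4].
  have {}nb : d < - (ar ^+ 5)^-1 \/ (ar ^+ 5)^-1 < d.
    case: (ltP d (- (ar ^+ 5)^-1)) => h1; first by left.
    case: (ltP (ar ^+ 5)^-1 d) => h2; first by right.
    by case: nb; rewrite ler_norml h1 h2.
  by case: nb => nb; split=> h; lra.
have pU : prG (~` box `|` ball5) <= 8 * u.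
  apply: le_trans (prG_leU mU mC mB _) _ => //.
  have h1 := @prG_notbox R n `[(- ar), ar[%classic (4 * u ^+ 2) (measurable_itv _) prN_box.
  have {}h1 : prG (~` box) <= n%:R * (4 * u ^+ 2).
    by apply: h1; have := u8; have := u0; rewrite expr2; nra.
  have h2 := Dg_anticonc iN big.
  have : n%:R * (4 * u ^+ 2) <= ar * (4 * u ^+ 2) by apply: ler_wpM2r => //; rewrite mulr_ge0 // sqr_ge0.
  rewrite (_ : ar * (4 * u ^+ 2) = 4 * u); first lra.
  by rewrite /u; field; rewrite gt_eqF.
have l1 : prG [set x : n.-tuple T | 0 <= qform n.+1 A (zv x)] <= prG (Gev n 0%N) + 8 * u.
  apply: le_trans (prG_leU mF mG mU _) _; last by rewrite lerD2l.
  move=> x Fx; case: (pselect (box x)) => bx; last by right; left.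
  by case: (pselect (ball5 x)) => b5; [right; right|left; apply/(key x bx b5)].
have l2 : prG (Gev n 0%N) <= prG [set x : n.-tuple T | 0 <= qform n.+1 A (zv x)] + 8 * u.
  apply: le_trans (prG_leU mG mF mU _) _; last by rewrite lerD2l.
  move=> x Fx; case: (pselect (box x)) => bx; last by right; left.
  by case: (pselect (ball5 x)) => b5; [right; right|left; apply/(key x bx b5)].
rewrite ler_norml; apply/andP; split; lra.
Qed.

(** The errors are [16 u] for the program against its event, [18 u^2] for the half-line against the
    tail of weights, and [16 u + 17 u^2] for the position of the threshold. As [u^2 <= u / 8], they
    add up to less than [37 u]. *)
Lemma theta_cell th : (th <= J + J)%N -> (Wt a) ^+ n * TW a th <= Uf a n A E n 0 * Wt a ->
  th = 0%N \/ Uf a n A E n 0 * Wt a < (Wt a) ^+ n * TW a th.-1 ->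
  `|prN `[xg th, +oo[%classic - prG (Gev n 0%N)| <= 37 * u.
Proof.
move=> thJ t1 t2.
have [q0 [q1 qt]] := @tv_cells R a a8.
have u2 : 16 / ar ^+ 2 = 16 * u ^+ 2 by rewrite /u exprVn.
have Wt0 := Wt_gt0 a8.
have WR : 0 < (Wt a)%:~R :> R by rewrite ltr0z.
have Wn : 0 < (Wt a)%:~R ^+ n :> R by rewrite exprn_gt0.
pose tq k := \sum_(k <= j < J + J) qg j.
have tqE k : tq k = (TW a k)%:~R / (Wt a)%:~R.
  by rewrite /tq /TW rmorph_sum /= mulr_suml.
pose phi : R := (Uf a n A E n 0)%:~R / (Wt a)%:~R ^+ n.
have c1 k : ((Wt a) ^+ n * TW a k)%:~R = tq k * ((Wt a)%:~R * (Wt a)%:~R ^+ n) :> R.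
  by rewrite tqE rmorphM rmorphXn /=; field; rewrite gt_eqF.
have c2 : (Uf a n A E n 0 * Wt a)%:~R = phi * ((Wt a)%:~R * (Wt a)%:~R ^+ n) :> R.
  by rewrite /phi rmorphM /=; field; rewrite gt_eqF.
have WW : 0 < (Wt a)%:~R * (Wt a)%:~R ^+ n :> R by rewrite mulr_gt0.
have {}t1 : tq th <= phi by move: t1; rewrite -(ler_int R) c1 c2 ler_pM2r.
have {}t2 : th = 0%N \/ phi < tq th.-1.
  by case: t2 => t2; [left|right; move: t2; rewrite -(ltr_int R) c1 c2 ltr_pM2r].
have GU := @Gev_Uf R a n A E a8 n 0%N; rewrite -/phi u2 in GU.
have n16 : n%:R * (16 * u ^+ 2) <= 16 * u.
  apply: (@le_trans _ _ (ar * (16 * u ^+ 2))).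
    by apply: ler_wpM2r => //; rewrite mulr_ge0 // sqr_ge0.
  by rewrite le_eqVlt; apply/orP; left; apply/eqP; rewrite /u; field; rewrite gt_eqF.
have psum k : (k <= J + J)%N -> \sum_(k <= j < J + J) `|pc j - qg j| <= 16 * u ^+ 2.
  move=> kJ; rewrite -u2; apply: le_trans qt; rewrite -(big_mkord xpredT (fun j => `|pc j - qg j|)).
  by rewrite [leRHS](big_cat_nat (leq0n k) kJ) /= lerDr; apply: sumr_ge0 => j _.
have pq : `|prN `[xg th, +oo[%classic - tq th| <= 18 * u ^+ 2.
  have -> : prN `[xg th, +oo[%classic = \sum_(th <= j < J + J) pc j + prN `[ar, +oo[%classic.
    rewrite (sum_pc R a8 thJ) -(@xgJJ R a a8) -(@prN_split R (xg th) (xg (J + J)) (BInfty _ false)) //.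
    by apply: (@xg_le R a a8).
  have t3 := @tail_right R a a8; have t4 := @prN_ge0 R `[ar, +oo[%classic.
  rewrite (_ : 2 / ar ^+ 2 = 2 * u ^+ 2) in t3; last by rewrite /u exprVn.
  rewrite addrAC /tq -sumrB; apply: le_trans (ler_normD _ _) _.
  rewrite (ger0_norm t4); have := le_trans (ler_norm_sum _ _ _) (psum _ thJ); lra.
(* For a positive threshold, [phi] lies below the next larger tail, and the gap is the weight of one
   cell. For threshold 0 the tail is 1, which [phi] may exceed only by its own error [16 u]. *)
have tt1 : phi - tq th <= 16 * u + 17 * u ^+ 2.
  case: t2 => [th0|t2].
    have -> : tq th = 1 by rewrite th0 /tq big_mkord.
    have g1 : prG (Gev n 0%N) <= 1 by apply: prG_le1; exact: measurable_Gev.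
    by move: GU; rewrite ler_norml => /andP[h1 h2]; have := sqr_ge0 u; lra.
  case: th thJ t1 t2 {pq} => [|k] thJ t1 t2.
    by have := sqr_ge0 u; have := u0; rewrite /= in t2; lra.
  have kk : tq k = qg k + tq k.+1 by rewrite /tq big_ltn.
  have p1 : `|pc k - qg k| <= 16 * u ^+ 2.
    by apply: le_trans (psum k (ltnW thJ)); rewrite big_ltn // lerDl sumr_ge0.
  have p2 : pc k <= hh R a.
    rewrite -[leRHS]mul1r; apply: prN_ub => //; [exact: measurable_cell|exact: mu_cell|].
    by move=> x _; exact: pdf_le1.
  have p3 : hh R a <= u ^+ 2.
    rewrite /hh natrX /u exprVn lef_pV2 ?posrE ?exprn_gt0 //.
    by apply: ler_weXn2l => //; have := a8R; lra.
  by move: p1 t2; rewrite /= kk ler_norml => /andP[h1 h2]; have := u0; lra.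
have uu : u ^+ 2 <= u / 8 by rewrite expr2; have := u8; have := u0; nra.
move: GU pq; rewrite !ler_norml => /andP[h1 h2] /andP[h3 h4].
apply/andP; split; have := u0; have := sqr_ge0 u; lra.
Qed.

End compare.

(** * The law of the form along the iteration *)

Section law.
Variables (R : realType) (a n : nat).
Hypothesis a8 : (8 <= a)%N.
Hypothesis na : (n + 4 < a)%N.
Local Notation T := (measurableTypeR R).
Local Notation zv := (@zv R n).

Lemma rotQE p q k i j : (rotQ a p q k i j)%:~R =
  rotG p q (rc a k)%:~R (rs a k)%:~R (rw a k)%:~R i j :> R.
Proof. by rewrite /rotQ /rotG; do !case: ifP => // _; rewrite ?rmorphN. Qed.

(* A Jacobi rotation acts on the variables as a rotation up to the scalar [rw a k]. *)
Lemma prG_rot A p q k : (0 < p)%N -> (p < q)%N -> (q < n.+1)%N ->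
  prG [set x : n.-tuple T | 0 <= qform n.+1 (rot a n A p q k) (zv x)] =
  prG [set x : n.-tuple T | 0 <= qform n.+1 A (zv x)].
Proof.
move=> p0 pq qn.
have w0 : 0 < (rw a k)%:~R :> R by rewrite ltr0z /rw; have : (0 < a ^ 24)%N by [rewrite expn_gt0; plia]; plia.
have wn : (rw a k)%:~R != 0 :> R by rewrite gt_eqF.
have csw : (rc a k)%:~R ^+ 2 + (rs a k)%:~R ^+ 2 = (rw a k)%:~R ^+ 2 :> R.
  by rewrite -!rmorphXn -rmorphD rot_csw.
have cw : 0 < (rc a k + rw a k)%:~R :> R.
  rewrite ltr0z /rc /rw addrACA addNr addr0.
  have : (0 < a ^ 24)%N by [rewrite expn_gt0; plia]; plia.
have pn : (p.-1 < n)%N by plia.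
have qn' : (q.-1 < n)%N by plia.
pose P := Ordinal pn; pose Q := Ordinal qn'.
have PQ : P != Q by rewrite -val_eqE /=; plia.
pose c : R := (rc a k)%:~R / (rw a k)%:~R; pose s : R := (rs a k)%:~R / (rw a k)%:~R.
have cs1 : c ^+ 2 + s ^+ 2 = 1.
  by rewrite /c /s !expr_div_n -mulrDl csw divff // expf_neq0.
have c1 : 1 + c != 0.
  have -> : 1 + c = (rc a k + rw a k)%:~R / (rw a k)%:~R by rewrite rmorphD /= mulrDl divff // addrC.
  by rewrite mulf_neq0 ?invr_neq0 // gt_eqF.
have mA : measurable [set x : n.-tuple T | 0 <= qform n.+1 A (zv x)] by exact: measurable_qform.
rewrite /prG -(gaussian_rotate PQ cs1 c1 mA); congr (fine (_ _)).
apply/seteqP; suff E x : (0 <= qform n.+1 (rot a n A p q k) (zv x)) =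
  (0 <= qform n.+1 A (zv (rotate P Q c s x))) by split=> x /=; rewrite E.
have -> : qform n.+1 (rot a n A p q k) (zv x) =
    qform n.+1 A (fun l => \sum_(i < n.+1) (rotQ a p q k l i)%:~R * zv x i).
  exact: qform_mm.
(* The integer matrix acts on [(1, x)] as [rw] times the rotation of [x], the leading 1 included, so
   the sign of the form is unaffected by the scalar. *)
rewrite (@eq_qform R n.+1 A _ (fun i => (rw a k)%:~R * zv (rotate P Q c s x) i)).
  by rewrite qform_scale pmulr_rge0 // exprn_gt0.
move=> i iN; under eq_bigr => j _ do rewrite rotQE.
rewrite rotG_row //; [|plia|plia].
have pE : p = P.+1 by rewrite /= prednK.
have qE : q = Q.+1 by rewrite /= prednK //; plia.
have zp : zv x p = tnth x P by rewrite [in LHS]pE zvS.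
have zq : zv x q = tnth x Q by rewrite [in LHS]qE zvS.
have wc : (rw a k)%:~R * c = (rc a k)%:~R by rewrite mulrC divfK.
have ws : (rw a k)%:~R * s = (rs a k)%:~R by rewrite mulrC divfK.
case: i iN => [|i] iN; first by rewrite !ifF //; plia.
have zi : i.+1 = (Ordinal (iN : (i < n)%N)).+1 by [].
rewrite {3 4}zi !zvS /rotate !tnth_setc zp zq -!val_eqE /=.
have -> : (i.+1 == p) = (i == p.-1) by plia.
have -> : (i.+1 == q) = (i == q.-1) by plia.
have QP : (q.-1 == p.-1) = false by plia.
case: (eqVneq i p.-1) => ip.
  rewrite (_ : (i == q.-1) = false); last by rewrite ip eq_sym QP.
  by rewrite -wc -ws; ring.
by case: (eqVneq i q.-1) => iq //; rewrite -wc -ws; ring.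
Qed.

Lemma prG_jac A0 E0 r A E : jac a n A0 E0 r A E ->
  prG [set x : n.-tuple T | 0 <= qform n.+1 A (zv x)] =
  prG [set x : n.-tuple T | 0 <= qform n.+1 A0 (zv x)].
Proof.
elim=> // {r A E} r A E p q k _ IH /and4P[p0 pq qn _] _.
by rewrite prG_rot.
Qed.

End law.

(** * The input list as a symmetric form *)

Lemma nth_allpairs (S T U : Type) (x0 : S) (y0 : T) (z0 : U) (f : S -> T -> U) s t i j :
  (i < size s)%N -> (j < size t)%N ->
  nth z0 [seq f x y | x <- s, y <- t] (i * size t + j) = f (nth x0 s i) (nth y0 t j).
Proof.
elim: s i => // x s IH [|i] /= si tj; rewrite nth_cat size_map.
  by rewrite mul0n add0n tj (nth_map y0).
by rewrite mulSn -addnA ltnNge leq_addr /= addnC addnK IH.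
Qed.

Section input.
Variables (R : realType) (n : nat) (p : quadpoly n) (eps : rat).
Local Notation inp := (fun i => nth 0 (input_seq p eps) i).

Lemma inp_lin (i : 'I_n) : inp (4 + i)%N = lin p i.
Proof.
rewrite /input_seq nth_cat /= addKn nth_cat size_map size_enum_ord ltn_ord.
by rewrite (nth_map i) ?size_enum_ord // nth_ord_enum.
Qed.

Lemma inp_quad (i j : 'I_n) : inp (4 + n + i * n + j)%N = if (i <= j)%N then quad p i j else 0.
Proof.
rewrite /input_seq nth_cat /= -!addnA addKn nth_cat size_map size_enum_ord ltnNge leq_addr /= addKn.
have := @nth_allpairs _ _ _ i j 0 (fun i j : 'I_n => if (i <= j)%N then quad p i j else 0)
  (enum 'I_n) (enum 'I_n) i j; rewrite !size_enum_ord !nth_ord_enum => -> //.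
Qed.

Lemma qform_G0 (g : nat -> int) (x : n.-tuple R) : qform n.+1 (G0 n g) (zv x) =
  2 * (\sum_(i < n) \sum_(j < n) (g (4 + n + i * n + j)%N)%:~R * tnth x i * tnth x j +
       \sum_(i < n) (g (4 + i)%N)%:~R * tnth x i + (g 3%N)%:~R).
Proof.
pose q (i j : 'I_n) : R := (g (4 + n + i * n + j)%N)%:~R * tnth x i * tnth x j.
have e3 : \sum_(i < n) \sum_(j < n) q i j = \sum_(i < n) \sum_(j < n) q j i by rewrite exchange_big.
have -> : qform n.+1 (G0 n g) (zv x) = (g 3%N + g 3%N)%:~R +
    \sum_(i < n) (g (4 + i)%N)%:~R * tnth x i + \sum_(i < n) ((g (4 + i)%N)%:~R * tnth x i +
    (\sum_(j < n) q i j + \sum_(j < n) q j i)).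
  rewrite /qform big_ord_recl big_ord_recl /= !mulr1; congr (_ + _ + _).
    by apply: eq_bigr => i _; rewrite mulr1 (tnth_nth 0).
  apply: eq_bigr => i _; rewrite big_ord_recl /= mulr1 -big_split; congr (_ + _).
    by rewrite (tnth_nth 0).
  by apply: eq_bigr => j _; rewrite /q !(tnth_nth 0) /= rmorphD /=; ring.
rewrite !big_split /= -e3 rmorphD /=; ring.
Qed.

Lemma qform_input (x : n.-tuple R) : qform n.+1 (G0 n inp) (zv x) = 2 * qeval p x.
Proof.
have e1 : \sum_(i < n) (lin p i)%:~R * tnth x i = \sum_(i < n) (inp (4 + i)%N)%:~R * tnth x i.
  by apply: eq_bigr => i _; rewrite inp_lin.
pose q (i j : 'I_n) : R := (inp (4 + n + i * n + j)%N)%:~R * tnth x i * tnth x j.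
have e2 : \sum_(i < n) \sum_(j < n | (i <= j)%N) (quad p i j)%:~R * tnth x i * tnth x j =
    \sum_(i < n) \sum_(j < n) q i j.
  apply: eq_bigr => i _; rewrite big_mkcond; apply: eq_bigr => j _.
  by rewrite /q inp_quad; case: ifP => //; rewrite !mul0r.
by rewrite /qeval e1 e2 qform_G0.
Qed.

End input.

(** * The algorithm *)

(** The rotations rescale [rE], so register 51 preserves the initial scale; it tells at the end
    whether the polynomial was constant. *)
Definition cmain : cmd :=
  copy ;; setr rN (HG kIN (HC 0)) ;; setr rN1 (HAdd (V rN) (HC 1)) ;;
  rowinit kROW (V XR) ;; rowinit kRN (V rN) ;; fill2 kA (V rN1) bodyA ;; findE ;; setr 51 (V rE) ;;
  CLoop rR jstep ;; setK3 ;; fill kUJ (HC 0) rJ J2 bodyUJ rVAL ;;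
  fill kU (HC 0) rSS (V XR) bodyC rVAL ;; CFor rL (V rN) level ;;
  setr rCNT (HG kU (HG kROW (V rN))) ;; totals ;; calcC2 ;; theta.

Lemma symA_G0 n inp : symA (G0 n inp).
Proof. by move=> [|i] [|j] //=; rewrite addrC. Qed.

(** For scale 0 the later commands still run within the same time bound, as [sem] is total; their
    results are then simply not described. *)
Lemma mainP X a n inp s : (8 <= a)%N -> (n + 4 < a)%N -> X = (a ^ 60)%N ->
  s XR 0 = X%:Z -> PWs a s -> (forall i : nat, mem_of s i = inp i) -> inp 0%N = n%:Z ->
  let s1 := sem X cmain s in
  [/\ s1 kPW = s kPW, s1 kIN 3 = inp 3%N, is_max n.+1 (G0 n inp) (s1 51%N 0) &
      0 < s1 51%N 0 -> exists A E th, [/\ jac a n (G0 n inp) (s1 51%N 0) X A E,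
        s1 rTH 0 = th%:Z, (th <= a ^ 10 + a ^ 10)%N,
        Wt a ^+ n * TW a th <= Uf a n A E n 0 * Wt a &
        th = 0%N \/ Uf a n A E n 0 * Wt a < Wt a ^+ n * TW a th.-1]].
Proof.
move=> a8 na Xa sX Ps sin inp0; cbv zeta.
(* The exponent 60 leaves room above every bound in use; the largest multiplier, [rw * rw], is at
   most [4 a^48]. *)
have powX i : (i < 60)%N -> (8 * a ^ i <= X)%N.
  move=> i60; apply: (@leq_trans (a * a ^ 59)); last by rewrite Xa -expnS.
  by apply: leq_mul => //; rewrite leq_pexp2l //; plia.
have X1 := powX 1%N isT; have X2 := powX 2%N isT; rewrite expn1 in X1.
have nX : (n.+1 < X)%N by plia.
have X0 : (0 < X)%N by plia.
have nnX : (4 + n + n * n < X)%N.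
  have : (n * n <= a ^ 2)%N by rewrite expnS expn1; apply: leq_mul; plia.
  have : (a <= a ^ 2)%N by rewrite expnS expn1 leq_pmull; plia.
  plia.
have fr c t k : k \notin writes c -> sem X c t k = t k by exact: frame.
rewrite /cmain; do 16! rewrite sem_seq.
pose s1 := sem X copy s; rewrite -/s1.
have in1 i : (i < X)%N -> s1 kIN i%:Z = inp i by apply: copyP.
pose s2 := sem X (setr rN (HG kIN (HC 0))) s1; rewrite -/s2.
have n2 : s2 rN 0 = n%:Z.
  by rewrite /s2 setrV; change (s1 kIN 0%N%:Z = n%:Z); rewrite in1.
pose s3 := sem X (setr rN1 (HAdd (V rN) (HC 1))) s2; rewrite -/s3.
have n3 : s3 rN1 0 = n.+1%:Z by rewrite /s3 setrV hevalD hevalV hevalC n2; plia.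
pose s4 := sem X (rowinit kROW (V XR)) s3; rewrite -/s4.
have X3 : s3 XR 0 = X%:Z by rewrite /s3 fr // /s2 fr // /s1 fr.
have rows4 : rows X s4 by move=> i iX; apply: rowinitP.
pose s5 := sem X (rowinit kRN (V rN)) s4; rewrite -/s5.
have X4 : s4 XR 0 = X%:Z by rewrite /s4 fr.
have n4 : s4 rN 0 = n%:Z by rewrite /s4 fr // /s3 fr.
have rn5 i : (i < X)%N -> s5 kRN i%:Z = (i * n)%N%:Z by move=> iX; apply: rowinitP.
pose s6 := sem X (fill2 kA (V rN1) bodyA) s5; rewrite -/s6.
have A6 : matrep X s6 kA n.+1 (G0 n inp).
  apply: fillAP => //.
  - by move=> i iX; rewrite /s5 fr // rows4.
  - by move=> i iX; rewrite /s5 fr // /s4 fr // /s3 fr // /s2 fr // in1.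
  - by rewrite /s5 fr.
  - by rewrite /s5 fr // /s4 fr.
pose s7 := sem X findE s6; rewrite -/s7.
have rows6 : rows X s6 by move=> i iX; rewrite /s6 fr // /s5 fr // rows4.
have n6 : s6 rN1 0 = n.+1%:Z by rewrite /s6 fr // /s5 fr // /s4 fr.
have max7 : is_max n.+1 (G0 n inp) (s7 rE 0) by apply: findEP => //; plia.
pose s8 := sem X (setr 51 (V rE)) s7; rewrite -/s8.
have e8 : s8 51%N 0 = s7 rE 0 by rewrite /s8 setrV hevalV.
have A8 : matrep X s8 kA n.+1 (G0 n inp) by move=> i j iN jN; rewrite /s8 fr // /s7 fr // A6.
have rows8 : rows X s8 by move=> i iX; rewrite /s8 fr // /s7 fr // rows6.
have n8 : s8 rN1 0 = n.+1%:Z by rewrite /s8 fr // /s7 fr.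
have N8 : s8 rN 0 = n%:Z by rewrite /s8 fr // /s7 fr // /s6 fr // /s5 fr.
have E8 : s8 rE 0 = s7 rE 0 by rewrite /s8 fr.
have P8 : s8 kPW = s kPW.
  by rewrite /s8 fr // /s7 fr // /s6 fr // /s5 fr // /s4 fr // /s3 fr // /s2 fr // /s1 fr.
have i8 : s8 kIN 3 = inp 3%N.
  rewrite /s8 fr // /s7 fr // /s6 fr // /s5 fr // /s4 fr // /s3 fr // /s2 fr //.
  by apply: (in1 3%N); plia.
have XX8 : s8 XR 0 = X%:Z by rewrite /s8 fr // /s7 fr // /s6 fr // /s5 fr.
have Ps8 : PWs a s8 by move=> k hk; rewrite P8 Ps.
have [A [E [jA A9 E9]]] := jacobiP a8 powX na Ps8 rows8 A8 n8 E8.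
clearbody s8 s7; clear s1 s2 s3 s4 s5 s6 in1 n2 n3 X3 rows4 X4 n4 rn5 A6 rows6 n6.
pose s9 := sem X (CLoop rR jstep) s8; rewrite -/s9 in A9 E9 *.
pose s10 := sem X setK3 s9; rewrite -/s10.
pose s11 := sem X (fill kUJ (HC 0) rJ J2 bodyUJ rVAL) s10; rewrite -/s11.
pose s12 := sem X (fill kU (HC 0) rSS (V XR) bodyC rVAL) s11; rewrite -/s12.
pose s13 := sem X (CFor rL (V rN) level) s12; rewrite -/s13.
pose s14 := sem X (setr rCNT (HG kU (HG kROW (V rN)))) s13; rewrite -/s14.
pose s15 := sem X totals s14; rewrite -/s15.
pose s16 := sem X calcC2 s15; rewrite -/s16.
have f9 k : k \notin writes (CLoop rR jstep) -> s9 k = s8 k by exact: fr.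
have f10 k : k \notin writes setK3 -> s10 k = s9 k by exact: fr.
have f11 k : k \notin writes (fill kUJ (HC 0) rJ J2 bodyUJ rVAL) -> s11 k = s10 k by exact: fr.
have f12 k : k \notin writes (fill kU (HC 0) rSS (V XR) bodyC rVAL) -> s12 k = s11 k by exact: fr.
have f13 k : k \notin writes (CFor rL (V rN) level) -> s13 k = s12 k by exact: fr.
have f14 k : k \notin writes (setr rCNT (HG kU (HG kROW (V rN)))) -> s14 k = s13 k by exact: fr.
have f15 k : k \notin writes totals -> s15 k = s14 k by exact: fr.
have f16 k : k \notin writes calcC2 -> s16 k = s15 k by exact: fr.
have f17 k : k \notin writes theta -> sem X theta s16 k = s16 k by exact: fr.
have p11 : s11 kPW = s8 kPW by rewrite f11 // f10 // f9.
have p17 : sem X theta s16 kPW = s8 kPW by rewrite f17 // f16 // f15 // f14 // f13 // f12.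
have e17 : sem X theta s16 51%N 0 = s7 rE 0.
  by rewrite f17 // f16 // f15 // f14 // f13 // f12 // f11 // f10 // f9 // e8.
split; first by rewrite p17.
- by rewrite f17 // f16 // f15 // f14 // f13 // f12 // f11 // f10 // f9.
- by rewrite e17.
move=> E00; rewrite e17 in E00 *.
have [E0 As _ _ _] := jac_jinv a8 na (@symA_G0 n inp) E00 max7 jA.
have Ab i j : (i < n.+1)%N -> (j < n.+1)%N -> (0 < i + j)%N -> `|A i j| <= a%:Z * E.
  exact: (jinv_entry a8 na E00 max7 (jac_jinv a8 na (@symA_G0 n inp) E00 max7 jA)).
pose VM := (a ^ 11 + a ^ 11)%N.
have nb := numv_bounds a8 E0 Ab.
have VMX : (n.+1 * VM.+1 < X)%N.
  have h12 := powX 12%N isT; have a11 : (0 < a ^ 11)%N by rewrite expn_gt0; plia.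
  apply: leq_trans h12; rewrite (expnS a 11).
  apply: (@leq_ltn_trans (a * (3 * a ^ 11))%N); first by apply: leq_mul; rewrite /VM; plia.
  by rewrite mulnCA ltn_mul2r muln_gt0 a11 andbT; plia.
have Ps9 : PWs a s9 by move=> k hk; rewrite f9 // Ps8.
have A90 : s9 kA 0 = A 0%N 0%N by have := A9 0%N 0%N isT isT; rewrite mul0n addn0.
have N9 : s9 rN 0 = n%:Z by rewrite f9.
have [k10 d10] := setK3P a8 powX na E0 VMX Ps9 A90 N9 E9.
rewrite -/s10 in k10 d10.
have Ps10 : PWs a s10 by move=> k hk; rewrite f10 // Ps9.
have JJX : (a ^ 10 + a ^ 10 <= X)%N by have := powX 10%N isT; plia.
have [||||||uj11 _] := @fillP X kUJ (HC 0) rJ J2 bodyUJ rVAL s10 (a ^ 10 + a ^ 10) 0 (ut a) => //.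
- move=> s' fs; split; last by rewrite hevalC.
  by apply: J2P => k hk; rewrite fs // Ps10.
- move=> i s' iJ fs _ si; apply: (bodyUJP a8 powX na E0 VMX) => //.
  by move=> k hk; rewrite fs // Ps10.
rewrite -/s11 in uj11.
have ctx11 : dpctx X a n A E s11.
  split.
  - by rewrite f11 // f10 // f9.
  - by move=> k hk; rewrite f11 // Ps10.
  - by move=> i iX; rewrite f11 // f10 // f9 // rows8.
  - by move=> i j iN jN; rewrite f11 // f10 // A9.
  - by rewrite f11 // f10.
  - by rewrite f11 // f10.
  - by rewrite f11.
  - by move=> j jJ; rewrite -uj11 // add0r.
have [||||||u12 _] := @fillP X kU (HC 0) rSS (V XR) bodyC rVAL s11 X 0 (dcond a n A E) => //.
- move=> s' fs; split; last by rewrite hevalC.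
  by rewrite hevalV fs // (dXR ctx11).
- move=> i s' iX fs _ si; apply: (bodyCP (a := a) (n := n) (A := A) (E := E)) => //.
    by rewrite fs // (dE ctx11).
  by rewrite fs // f11.
rewrite -/s12 in u12.
have fctx t c : dpctx X a n A E t ->
    all (fun k => k \notin writes c) [:: XR; kPW; kROW; kA; rN; rE; rDEN; kUJ] -> dpctx X a n A E (sem X c t).
  by move=> ct /allP h; apply: (dpctx_frame ct) => k hk; apply: fr; exact: h.
have ctx12 : dpctx X a n A E s12 by apply: fctx.
have U12 k : (k < X)%N -> s12 kU k%:Z = dcond a n A E k by move=> kX; rewrite -u12 // add0r.
have u13 := Uf_loop a8 powX na nb E0 VMX ctx12 U12.
have ctx13 : dpctx X a n A E s13 by apply: fctx.
have ctx14 : dpctx X a n A E s14 by apply: fctx.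
have ctx15 : dpctx X a n A E s15 by apply: fctx.
have ctx16 : dpctx X a n A E s16 by apply: fctx.
have c14 : s14 rCNT 0 = Uf a n A E n 0.
  rewrite /s14 setrV; change (s13 kU (s13 kROW (s13 rN 0)) = Uf a n A E n 0).
  rewrite (dN ctx13) (drows ctx13); last by plia.
  rewrite -[(n * X)%N]addn0; apply: u13; rewrite add0n.
  by apply: leq_ltn_trans VMX; apply: leq_mul; exact: leqnSn.
have t15 : s15 rTOT 0 = Wt a ^+ n by exact: (totalsP a8 powX na E0 VMX ctx14).
have c15 : s15 rCNT 0 = Uf a n A E n 0 by rewrite f15.
have c16 : s16 rC2 0 = Uf a n A E n 0 * Wt a by exact: (calcC2P a8 powX na E0 VMX ctx15 c15).
have t16 : s16 rTOT 0 = Wt a ^+ n by rewrite f16.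
have W0 := Wt_gt0 a8.
have U0 l k : 0 <= Uf a n A E l k.
  elim: l k => [|l IH] k /=; first by rewrite /dcond; case: ifP.
  apply: sumr_ge0 => j _; apply: mulr_ge0 => //.
  apply/ltW; rewrite /wt exprn_gt0 // /ut; have /andP[_ h2] := tt_sq (ltn_ord j).
  have a25 : (a ^ 20 <= a ^ 25)%N by rewrite leq_pexp2l //; plia.
  have a250 : (0 < a ^ 25)%N by rewrite expn_gt0; plia.
  plia.
have [||th [h1 h2 h3 h4]] := thetaP a8 powX na E0 VMX ctx16 t16 c16.
- by rewrite exprn_gt0.
- by rewrite mulr_ge0 // ltW.
by exists A, E, th.
Qed.

(** * The complete program, its branches and its output *)

Fixpoint pows (k : nat) : cmd :=
  if k is k'.+1 then pows k' ;; mul 63 (PW k') (V XR) ;; CSet kPW (HC k%:Z) (V 63)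
  else CSet kPW (HC 0) (HC 1).

Lemma powsP a K s : s XR 0 = a%:Z ->
  forall k, (k <= K)%N -> sem a (pows K) s kPW k%:Z = (a ^ k)%N%:Z.
Proof.
move=> sX; elim: K => [|K IH] k.
  by rewrite leqn0 => /eqP->; rewrite /= /put !eqxx.
have X1 : sem a (pows K) s XR 0 = a%:Z.
  by rewrite frame //; elim: K {IH} => // K IH; rewrite /= mem_cat negb_or IH.
have -> : sem a (pows K.+1) s =
  put (sem a (mul 63 (PW K) (V XR)) (sem a (pows K) s)) kPW K.+1%:Z
      (sem a (mul 63 (PW K) (V XR)) (sem a (pows K) s) 63%N 0) by [].
move: (sem a (pows K) s) IH X1 => t IH X1.
have hz v : heval (put t 1 0 v) (V XR) = a%:Z by exact: X1.
rewrite leq_eqVlt => /orP[/eqP->|kK].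
  rewrite put_same mulP ?hz //; change (t kPW K%:Z * a%:Z = (a ^ K.+1)%N%:Z).
  by rewrite IH // expnS mulnC PoszM.
rewrite /put eqxx (_ : (k%:Z == K.+1%:Z) = false); last by plia.
by rewrite frame // IH.
Qed.

Definition runs (P : program) (s s' : state) (T : nat) :=
  exists2 t, exec P (mem_of s) t (mem_of s') & (t <= T)%N.

Lemma runs_seq P Q s1 s2 s3 T1 T2 : runs P s1 s2 T1 -> runs Q s2 s3 T2 ->
  runs (Seq P Q) s1 s3 (T1 + T2).
Proof.
by move=> [t1 e1 l1] [t2 e2 l2]; exists (t1 + t2)%N; [exact: ExecSeq e1 e2|exact: leq_add].
Qed.

Definition rst (k : nat) (e : hexp) : program := Store (addrE k (cexp (HC 0))) (cexp e).
Definition crst (k : nat) (e : hexp) : nat := (cost (addrE k (cexp (HC 0))) + cost (cexp e)).+1.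

Lemma runs_st k e s : (k < 64)%N -> hok e -> runs (rst k e) s (put s k 0 (heval s e)) (crst k e).
Proof.
move=> k64 he; exists (crst k e) => //.
have := ExecStore (addrE k (cexp (HC 0))) (cexp e) (mem_of s).
by rewrite eval_addrE (eval_cexp _ he) [Defs.eval _ (cexp _)]/= upd_mem_of.
Qed.

Definition rout (z : int) (e : hexp) : program := Store (Const z) (cexp e).
Definition crout (e : hexp) : nat := (1 + cost (cexp e)).+1.

Lemma runs_out z e s : hok e -> runs (rout z e) s (put s (cls z) (idx z) (heval s e)) (crout e).
Proof.
move=> he; exists (crout e) => //.
have <- : upd (mem_of s) z (heval s e) = mem_of (put s (cls z) (idx z) (heval s e)).
  by rewrite -upd_mem_of ?cls_lt // addr_cls_idx.
by have := ExecStore (Const z) (cexp e) (mem_of s); rewrite (eval_cexp _ he).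
Qed.

Lemma runs_compile X c s : wf c -> s XR 0 = X%:Z -> runs (compile c) s (sem X c s) (steps X c).
Proof. by move=> h1 h2; have [t e l] := compile_exec h1 h2; exists t. Qed.

Lemma runs_ifT e P Q s s' T : hok e -> 0 < heval s e -> runs P s s' T ->
  runs (IfPos (cexp e) P Q) s s' (cost (cexp e) + T).+1.
Proof.
move=> he h [t et l]; exists (cost (cexp e) + t).+1; last by rewrite ltnS leq_add2l.
by apply: ExecIfT => //; rewrite eval_cexp.
Qed.

Lemma runs_ifF e P Q s s' T : hok e -> heval s e <= 0 -> runs Q s s' T ->
  runs (IfPos (cexp e) P Q) s s' (cost (cexp e) + T).+1.
Proof.
move=> he h [t et l]; exists (cost (cexp e) + t).+1; last by rewrite ltnS leq_add2l.
by apply: ExecIfF => //; rewrite eval_cexp.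
Qed.

(** Subtracting the numerator of [eps] from its denominator until nothing positive is left, register
    30 counts the ceiling of [1 / eps]. This loop precedes the choice of [X], hence a genuine while
    loop. *)
Definition wbody : program :=
  Seq (rst 50 (HSub (V 50) (HI (HC 1)))) (rst 30 (HAdd (V 30) (HC 1))).
Definition cwhile : nat :=
  (cost (cexp (V 50)) + (crst 50 (HSub (V 50) (HI (HC 1))) + crst 30 (HAdd (V 30) (HC 1)))).+1.

Lemma runs_while num m s v c : s 50%N 0 = v -> s 30%N 0 = c%:Z -> mem_of s 1 = num -> 0 < num ->
  v <= m%:Z * num -> exists k s', [/\ runs (WhilePos (cexp (V 50)) wbody) s s' (k.+1 * cwhile)%N,
    s' 30%N 0 = (c + k)%N%:Z, v <= k%:Z * num, k = 0%N \/ k.-1%:Z * num < v &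
    forall j i, (j \notin [:: 50; 30]%N) || (i != 0) -> s' j i = s j i].
Proof.
elim: m s v c => [|m IH] s v c sv sc s1 num0 vm.
  exists 0%N, s; rewrite addn0; split=> //; last by left.
  exists (cost (cexp (V 50))).+1; last by rewrite mul1n /cwhile ltnS leq_addr.
  by apply: ExecWhileF; rewrite eval_cexp // hevalV sv; rewrite mul0r in vm.
case: (lerP v 0) => v0.
  exists 0%N, s; rewrite addn0 mul0r; split=> //; last by left.
  exists (cost (cexp (V 50))).+1; last by rewrite mul1n /cwhile ltnS leq_addr.
  by apply: ExecWhileF; rewrite eval_cexp // hevalV sv.
pose t1 := put s 50 0 (v - num); pose t2 := put t1 30 0 (c.+1)%:Z.
have b1 : runs (rst 50 (HSub (V 50) (HI (HC 1)))) s t1 (crst 50 (HSub (V 50) (HI (HC 1)))).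
  have := @runs_st 50 (HSub (V 50) (HI (HC 1))) s isT isT.
  have -> : heval s (HSub (V 50) (HI (HC 1))) = v - num by rewrite -s1 -sv.
  by [].
have b2 : runs (rst 30 (HAdd (V 30) (HC 1))) t1 t2 (crst 30 (HAdd (V 30) (HC 1))).
  have := @runs_st 30 (HAdd (V 30) (HC 1)) t1 isT isT.
  have -> : heval t1 (HAdd (V 30) (HC 1)) = (c.+1)%:Z.
    by rewrite (_ : heval _ _ = s 30%N 0 + 1) // sc; plia.
  by [].
have [tb eb lb] := runs_seq b1 b2.
have vm' : v - num <= m%:Z * num.
  by move: vm; rewrite (_ : m.+1%:Z = m%:Z + 1); [rewrite mulrDl mul1r; lra|plia].
have [k [s' [[t et lt] sk vk kv fr]]] := IH t2 (v - num) c.+1 erefl erefl s1 num0 vm'.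
exists k.+1, s'; split.
- exists (cost (cexp (V 50)) + tb + t).+1.
    apply: ExecWhileT eb et; first by rewrite eval_cexp // hevalV sv.
  move: lb lt; rewrite /cwhile; move: (cost _) (crst 50 _ + _)%N => x y lb lt.
  rewrite mulSn; lia.
- by rewrite sk addnS addSn.
- by rewrite (_ : k.+1%:Z = k%:Z + 1); [rewrite mulrDl mul1r; lra|plia].
- right; rewrite succnK; case: kv => [->|kv]; first by rewrite mul0r.
  case: k {et lt sk vk} kv => [|k] /= kv; first by rewrite mul0r.
  by rewrite (_ : k.+1%:Z = k%:Z + 1); [rewrite mulrDl mul1r; lra|plia].
- move=> j i hj; rewrite fr // /t2 /t1 /put; move: hj; rewrite !inE.
  case: (eqVneq j 30%N) => [->|j30] /=; first by move=> /negbTE->.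
  by case: (eqVneq j 50%N) => [->|j50] //= /negbTE->.
Qed.

(** Register [XR] holds first [a = n + N + 8], with [N] the ceiling of [1 / eps], as loop bound for
    tabulating the powers of [a], and then [a ^ 60]. The branches for [N = 1] and for a constant
    polynomial output no variable at all. *)
Definition prog : program :=
  Seq (rst 50 (HI (HC 2))) (Seq (WhilePos (cexp (V 50)) wbody)
  (IfPos (cexp (HSub (V 30) (HC 1)))
    (Seq (rst 0 (HAdd (HAdd (HI (HC 0)) (V 30)) (HC 8))) (Seq (compile (pows 60))
     (Seq (rst 0 (PW 60)) (Seq (compile cmain)
      (IfPos (cexp (V 51))
        (Seq (rout 1 (HSub (PW 10) (V rTH))) (Seq (rout 2 (PW 9)) (Seq (rout 0 (HC 1))
          (Seq (rout 3 (HC 0)) (rout 4 (HC 1))))))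
        (Seq (rout 1 (HG kIN (HC 3))) (Seq (rout 2 (HC 1)) (rout 0 (HC 0)))))))))
    (Seq (rout 1 (HC 0)) (Seq (rout 2 (HC 1)) (rout 0 (HC 0)))))).

Lemma time_poly (c0 : nat) : exists C D, forall N a, (N <= a)%N ->
  (c0 * N.+1 + steps a (pows 60) + steps (a ^ 60) cmain <= C * a.+1 ^ D)%N.
Proof.
have [C1 [d1 h1]] := steps_poly (pows 60).
have [C2 [d2 h2]] := steps_poly cmain.
exists (c0 + C1 + C2)%N, (1 + d1 + 60 * d2)%N => N a Na.
have e1 i : (0 < a.+1 ^ i)%N by rewrite expn_gt0.
rewrite !mulnDl; apply: leq_add; first apply: leq_add.
- rewrite leq_mul2l; apply/orP; right; apply: (@leq_trans (a.+1 ^ 1)); first by rewrite expn1.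
  by rewrite leq_pexp2l // -addnA leq_addr.
- apply: leq_trans (h1 a) _; rewrite leq_mul2l; apply/orP; right.
  by rewrite leq_pexp2l // addnC addnA leq_addl.
- apply: leq_trans (h2 _) _; rewrite leq_mul2l; apply/orP; right.
  apply: (@leq_trans ((a.+1 ^ 60) ^ d2)); first by case: (d2) => [|d] //; rewrite leq_exp2r // ltn_exp2r.
  by rewrite -expnM leq_pexp2l // leq_addl.
Qed.

(** The three exits: [eps >= 1], a constant polynomial, and the general case with
    [q(y) = y - xg th]. *)
Definition outcome n (inp : nat -> int) N (s : state) : Prop :=
  let a := (n + N + 8)%N in
  [\/ [/\ N = 1%N, mem_of s 0 = 0, mem_of s 1 = 0 & mem_of s 2 = 1],
      [/\ (1 < N)%N, is_max n.+1 (G0 n inp) 0, mem_of s 0 = 0, mem_of s 1 = inp 3%N & mem_of s 2 = 1] |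
      exists E0 A E th, [/\ (1 < N)%N, is_max n.+1 (G0 n inp) E0 /\ 0 < E0,
        [/\ jac a n (G0 n inp) E0 (a ^ 60) A E, (th <= a ^ 10 + a ^ 10)%N,
            Wt a ^+ n * TW a th <= Uf a n A E n 0 * Wt a &
            th = 0%N \/ Uf a n A E n 0 * Wt a < Wt a ^+ n * TW a th.-1],
        [/\ mem_of s 0 = 1, mem_of s 1 = (a ^ 10)%N%:Z - th%:Z & mem_of s 2 = (a ^ 9)%N%:Z] &
        mem_of s 3 = 0 /\ mem_of s 4 = 1] ].

Lemma prog_run : exists c0, forall n (p : quadpoly n) eps, 0 < eps ->
  exists N s t, [/\ exec prog (input_memory p eps) t (mem_of s),
    (t <= c0 * N.+1 + steps (n + N + 8) (pows 60) + steps ((n + N + 8) ^ 60) cmain)%N,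
    denq eps <= N%:Z * numq eps, N.-1%:Z * numq eps < denq eps &
    outcome n (fun i => nth 0 (input_seq p eps) i) N s].
Proof.
(* The cost of all straight-line code, hidden behind an equation so that it is not computed. *)
have [rest restE] : exists r, r = (crst 50 (HI (HC 2)) + cost (cexp (HSub (V 30) (HC 1))) +
  crst 0 (HAdd (HAdd (HI (HC 0)) (V 30)) (HC 8)) + crst 0 (PW 60) + cost (cexp (V 51)) +
  crout (HSub (PW 10) (V rTH)) + crout (PW 9) + crout (HC 1) + crout (HC 0) + crout (HC 1) +
  crout (HG kIN (HC 3)) + crout (HC 1) + crout (HC 0) + crout (HC 0) + 10)%N by eexists.
exists (cwhile + rest)%N => n p eps eps0.
pose inp i := nth 0 (input_seq p eps) i.
pose s0 : state := fun k i => input_memory p eps (addr k i).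
have m0 : mem_of s0 = input_memory p eps.
  by apply/funext => z; rewrite /mem_of /s0 addr_cls_idx.
(* Negative addresses are initially 0, so all registers start at 0; the counter in register 30
   relies on it. *)
have z0 k i : 0 <= i -> s0 k i = 0.
  move=> i0; have : addr k i < 0 by rewrite /addr; plia.
  by rewrite /s0; case: (addr k i).
have num0 : 0 < numq eps by rewrite numq_gt0.
have den0 : 0 < denq eps by exact: denq_gt0.
pose s1 := put s0 50 0 (denq eps).
have r1 : runs (rst 50 (HI (HC 2))) s0 s1 (crst 50 (HI (HC 2))).
  have := @runs_st 50 (HI (HC 2)) s0 isT isT.
  by rewrite (_ : heval s0 (HI (HC 2)) = denq eps) //; change (mem_of s0 2 = denq eps); rewrite m0.
have n1 : mem_of s1 1 = numq eps by change (mem_of s0 1 = numq eps); rewrite m0.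
have dm : denq eps <= `|denq eps|%N%:Z * numq eps.
  by rewrite gez0_abs ?(ltW den0) // ler_peMr // ltW.
have [k [s2 [r2 k2 kv1 kv2 fr2]]] := @runs_while (numq eps) `|denq eps|%N s1 (denq eps) 0 erefl (z0 30%N 0 isT) n1 num0 dm.
rewrite add0n in k2; exists k.
have k0 : (0 < k)%N by case: (k) kv1 => //; rewrite mul0r leNgt den0.
have kv3 : k.-1%:Z * numq eps < denq eps by case: kv2 => // h; rewrite h in k0.
have rW := leq_pmulr rest (ltn0Sn k); have cW : (k.+1 * cwhile = cwhile * k.+1)%N by rewrite mulnC.
have ev30 : heval s2 (HSub (V 30) (HC 1)) = k%:Z - 1 by change (s2 30%N 0 - 1 = k%:Z - 1); rewrite k2.
case: (leqP k 1) => kk.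
  have k1 : k = 1%N by plia.
  pose sA := put (put (put s2 (cls 1) (idx 1) 0) (cls 2) (idx 2) 1) (cls 0) (idx 0) 0.
  have rA := runs_seq (@runs_out 1 (HC 0) s2 isT) (runs_seq (@runs_out 2 (HC 1) _ isT) (@runs_out 0 (HC 0) _ isT)).
  have ev : heval s2 (HSub (V 30) (HC 1)) <= 0 by rewrite ev30 k1.
  have [t et lt] := runs_seq r1 (runs_seq r2 (runs_ifF (e := HSub (V 30) (HC 1)) (Seq (rst 0 (HAdd (HAdd (HI (HC 0)) (V 30)) (HC 8))) (Seq (compile (pows 60))
     (Seq (rst 0 (PW 60)) (Seq (compile cmain)
      (IfPos (cexp (V 51))
        (Seq (rout 1 (HSub (PW 10) (V rTH))) (Seq (rout 2 (PW 9)) (Seq (rout 0 (HC 1))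
          (Seq (rout 3 (HC 0)) (rout 4 (HC 1))))))
        (Seq (rout 1 (HG kIN (HC 3))) (Seq (rout 2 (HC 1)) (rout 0 (HC 0))))))))) isT ev rA)).
  exists sA, t; split; [abstract (by rewrite -m0)| |exact: kv1|exact: kv3|].
    apply: leq_trans lt _; rewrite mulnDl cW; move: rW; rewrite {1}restE.
    move: (rest * _)%N (cwhile * _)%N (steps _ (pows _)) (steps _ cmain) (cost _) => w1 w2 w3 w4 w5; abstract (clear -w1; lia).
  abstract (by constructor 1).
pose a := (n + k + 8)%N.
have a8 : (8 <= a)%N by rewrite /a; plia.
have na : (n + 4 < a)%N by rewrite /a; plia.
have low2 j i : i < 0 -> s2 j i = s0 j i.
  move=> i0; have i00 : i != 0 by plia.
  rewrite fr2; last by rewrite i00 orbT.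
  by rewrite /s1 /put; case: eqP => [->|_]; rewrite /= ?(negbTE i00).
pose s3 := put s2 0 0 a%:Z.
have r3 : runs (rst 0 (HAdd (HAdd (HI (HC 0)) (V 30)) (HC 8))) s2 s3 (crst 0 (HAdd (HAdd (HI (HC 0)) (V 30)) (HC 8))).
  have := @runs_st 0 (HAdd (HAdd (HI (HC 0)) (V 30)) (HC 8)) s2 isT isT.
  rewrite (_ : heval s2 _ = a%:Z) //.
  change (mem_of s2 0 + s2 30%N 0 + 8 = a%:Z).
  have e0 : mem_of s2 0 = n%:Z.
    have -> : mem_of s2 0 = s0 (cls 0) (idx 0) by apply: low2.
    by change (mem_of s0 0 = n%:Z); rewrite m0.
  by rewrite e0 k2 /a !PoszD.
have X3 : s3 XR 0 = a%:Z by [].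
pose s4 := sem a (pows 60) s3.
have P4 : forall i, (i <= 60)%N -> s4 kPW i%:Z = (a ^ i)%N%:Z by abstract (exact: (powsP X3)).
have r4 : runs (compile (pows 60)) s3 s4 (steps a (pows 60)) by abstract (exact: (@runs_compile a (pows 60) s3 isT X3)).
(* The input cells have negative array indices, so they survive the computation of the powers. *)
have ci K : const_idx (fun z : int => 0 <= z) (pows K) by elim: K => //= K ->.
have low4 j i : ~~ (0 <= i) -> s4 j i = s3 j i by move=> hi; exact: (frame_idx a s3 _ (ci 60%N) hi).
clearbody s4.
pose s5 := put s4 0 0 (a ^ 60)%N%:Z.
have r5 : runs (rst 0 (PW 60)) s4 s5 (crst 0 (PW 60)).
  have := @runs_st 0 (PW 60) s4 isT isT.
  rewrite (_ : heval s4 _ = (a ^ 60)%N%:Z) //.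
  by change (s4 kPW 60%N%:Z = (a ^ 60)%N%:Z); rewrite P4.
have X5 : s5 XR 0 = (a ^ 60)%N%:Z by abstract done.
have P5 : PWs a s5 by abstract (move=> i hi; change (s4 kPW i%:Z = (a ^ i)%N%:Z); exact: P4).
have in5 (i : nat) : mem_of s5 i = inp i.
  have i0 : idx i < 0 by rewrite /idx; plia.
  have i00 : idx i != 0 by plia.
  have nz : ~~ (0 <= idx i) by rewrite -ltNge.
  have e5 : mem_of s5 i = s4 (cls i) (idx i).
    by rewrite /mem_of /s5 /put; case: eqP => // ->; rewrite /= (negbTE i00).
  rewrite e5 (low4 _ _ nz).
  have -> : s3 (cls i) (idx i) = s2 (cls i) (idx i).
    by rewrite /s3 /put; case: eqP => // ->; rewrite /= (negbTE i00).
  rewrite low2; last exact: i0.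
  by change (mem_of s0 i = inp i); rewrite m0.
have [pw6 i6 max6 imp6] := @mainP (a ^ 60) a n inp s5 a8 na erefl X5 P5 in5 erefl.
pose s6 := sem (a ^ 60) cmain s5; rewrite -/s6 in pw6 i6 max6 imp6.
have r6 : runs (compile cmain) s5 s6 (steps (a ^ 60) cmain) by abstract (exact: (@runs_compile _ cmain s5 isT X5)).
clearbody s6.
have ev : 0 < heval s2 (HSub (V 30) (HC 1)) by rewrite ev30; plia.
case: (lerP (s6 51%N 0) 0) => e6.
  pose sA := put (put (put s6 (cls 1) (idx 1) (inp 3%N)) (cls 2) (idx 2) 1) (cls 0) (idx 0) 0.
  have rA := runs_seq (@runs_out 1 (HG kIN (HC 3)) s6 isT) (runs_seq (@runs_out 2 (HC 1) _ isT) (@runs_out 0 (HC 0) _ isT)).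
  have e3 : heval s6 (HG kIN (HC 3)) = inp 3%N by abstract (exact: i6).
  rewrite e3 in rA.
  have [t et lt] := runs_seq r1 (runs_seq r2 (runs_ifT (e := HSub (V 30) (HC 1)) (Seq (rout 1 (HC 0)) (Seq (rout 2 (HC 1)) (rout 0 (HC 0))))
    isT ev (runs_seq r3 (runs_seq r4 (runs_seq r5 (runs_seq r6 (runs_ifF (e := V 51) (Seq (rout 1 (HSub (PW 10) (V rTH))) (Seq (rout 2 (PW 9)) (Seq (rout 0 (HC 1))
          (Seq (rout 3 (HC 0)) (rout 4 (HC 1)))))) isT e6 rA))))))).
  exists sA, t; split; [abstract (by rewrite -m0)| |exact: kv1|exact: kv3|].
    apply: leq_trans lt _; rewrite mulnDl cW -/a; move: rW; rewrite {1}restE.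
    move: (rest * _)%N (cwhile * _)%N (steps _ (pows _)) (steps _ cmain) => w1 w2 w3 w4; abstract (clear -w1; lia).
  have e7 : s6 51%N 0 = 0 by have [h1 _ _] := max6; apply/eqP; rewrite eq_le e6 h1.
  rewrite e7 in max6; constructor 2; split; [exact: kk|exact: max6|abstract done|abstract done|abstract done].
pose sA := put (put (put (put (put s6 (cls 1) (idx 1) (s6 kPW 10 - s6 rTH 0)) (cls 2) (idx 2) (s6 kPW 9))
  (cls 0) (idx 0) 1) (cls 3) (idx 3) 0) (cls 4) (idx 4) 1.
have rA : runs (Seq (rout 1 (HSub (PW 10) (V rTH))) (Seq (rout 2 (PW 9)) (Seq (rout 0 (HC 1))
    (Seq (rout 3 (HC 0)) (rout 4 (HC 1)))))) s6 sA (crout (HSub (PW 10) (V rTH)) + (crout (PW 9) + (crout (HC 1) +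
    (crout (HC 0) + crout (HC 1))))).
  exact: (runs_seq (@runs_out 1 (HSub (PW 10) (V rTH)) s6 isT) (runs_seq (@runs_out 2 (PW 9) _ isT)
    (runs_seq (@runs_out 0 (HC 1) _ isT) (runs_seq (@runs_out 3 (HC 0) _ isT) (@runs_out 4 (HC 1) _ isT))))).
have [t et lt] := runs_seq r1 (runs_seq r2 (runs_ifT (e := HSub (V 30) (HC 1)) (Seq (rout 1 (HC 0)) (Seq (rout 2 (HC 1)) (rout 0 (HC 0))))
    isT ev (runs_seq r3 (runs_seq r4 (runs_seq r5 (runs_seq r6 (runs_ifT (e := V 51)
    (Seq (rout 1 (HG kIN (HC 3))) (Seq (rout 2 (HC 1)) (rout 0 (HC 0)))) isT e6 rA))))))).
exists sA, t; split; [abstract (by rewrite -m0)| |exact: kv1|exact: kv3|].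
  apply: leq_trans lt _; rewrite mulnDl cW -/a; move: rW; rewrite {1}restE.
  move: (rest * _)%N (cwhile * _)%N (steps _ (pows _)) (steps _ cmain) => w1 w2 w3 w4; abstract (clear -w1; lia).
have [A [E [th [h1 h2 h3 h4 h5]]]] := imp6 e6.
constructor 3; exists (s6 51%N 0), A, E, th.
split; [exact: kk|by split|abstract (by split)|split; [abstract done| |]|abstract (by split)].
  abstract (change (s6 kPW 10 - s6 rTH 0 = (a ^ 10)%N%:Z - th%:Z); by rewrite h2 pw6 (P5 10%N)).
abstract (change (s6 kPW 9 = (a ^ 9)%N%:Z); by rewrite pw6 (P5 9%N)).
Qed.

(** * Half-lines and the final estimate *)

Section conclusion.
Variable R : realType.
Local Notation T := (measurableTypeR R).

Lemma halfspaceE n (p : quadpoly n) eps : [set x : n.-tuple T | 0 <= qeval p x] =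
  [set x : n.-tuple T | 0 <= qform n.+1 (G0 n (fun i => nth 0 (input_seq p eps) i)) (zv x)].
Proof. by apply/seteqP; split=> x /=; rewrite qform_input pmulr_rge0. Qed.

Lemma deval0E (q : diagpoly 0) : [set y : 0.-tuple T | 0 <= deval q y] =
  if 0 <= ratr (Defs.dcst q) :> R then setT else set0.
Proof.
by apply/seteqP; split=> y; rewrite /= /deval big_ord0 add0r; case: ifP.
Qed.

Lemma gaussian_diff n K (B : set (n.-tuple T)) (C : set (K.-tuple T)) :
  measurable B -> measurable C ->
  (`|gaussian R n B - gaussian R K C| = (`|prG B - prG C|)%:E)%E.
Proof. by move=> mB mC; rewrite -!prGE. Qed.

Lemma gaussian1_half (c : rat) (x : R) : ratr c = - x ->
  gaussian R 1 [set y : 1.-tuple T | 0 <= deval (DiagPoly (fun=> 0) (fun=> 1) c) y] =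
  normal_prob 0 1 (`[x, +oo[%classic : set T).
Proof.
move=> cx; have -> : normal_prob 0 1 (`[x, +oo[%classic : set T) =
  (\prod_(i < 1) normal_prob 0 1 (`[x, +oo[%classic : set T))%E by rewrite big_ord1.
rewrite -gaussian_box; last by move=> _; exact: measurable_itv.
congr (gaussian R 1 _); apply/seteqP.
suff e (y : 1.-tuple T) : (0 <= deval (DiagPoly (fun=> 0) (fun=> 1) c) y) = (x <= tnth y ord0).
  split=> y /=; rewrite e => h.
    by move=> i; rewrite ord1 in_itv /= h.
  by have := h ord0; rewrite in_itv /= andbT.
by rewrite /deval big_ord1 /= mul0r add0r mul1r cx subr_ge0.
Qed.

End conclusion.

Theorem theorem27 (R : realType) :
  exists (A : program) (ct dt cK dK ce : nat),
  forall (n b : nat) (p : quadpoly n) (eps : rat),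
    0 < eps -> quadpoly_bits_le b p ->
  exists (t : nat) (M : memory) (K : nat) (q : diagpoly K),
    [/\ exec A (input_memory p eps) t M,
        t%:R <= ct%:R * (n%:R + b%:R + eps^-1 + 1) ^+ dt :> rat,
        output M q,
        K%:R <= cK%:R * (ratr eps)^-1 ^+ 4 * ln (2 + (ratr eps)^-1) ^+ dK :> R
      & (`| gaussian R n [set x | (0 <= qeval p x)%R]
          - gaussian R K [set y | (0 <= deval q y)%R] |
          <= (ce%:R * ratr eps)%:E)%E].
Proof.
have [c0 run] := prog_run; have [C [D tp]] := time_poly c0.
(* The factor 11 absorbs [a.+1 = n + N + 9] with [N <= eps^-1 + 1]. As [K <= 1], no logarithm is
   called for. The error is [8 u + 37 u] with [u = 1 / a <= eps], whence 45. *)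
exists prog, (C * 11 ^ D)%N, D, 1%N, 0%N, 45%N => n b p eps eps0 _.
have [N [s [t [ex lt N1 N2 out]]]] := run n p eps eps0.
pose a := (n + N + 8)%N; rewrite -/a in lt.
have num0 : 0 < (numq eps)%:~R :> rat by rewrite ltr0z numq_gt0.
have epsV : eps^-1 = (denq eps)%:~R / (numq eps)%:~R.
  by rewrite -[in LHS](divq_num_den eps) invf_div.
have eN : eps^-1 <= N%:R.
  by rewrite epsV ler_pdivrMr // -[N%:R]/(N%:Z%:~R) -intrM ler_int.
have eN1 : N.-1%:R < eps^-1.
  by rewrite epsV ltr_pdivlMr // -[N.-1%:R]/(N.-1%:Z%:~R) -intrM ltr_int.
have ei0 : 0 < eps^-1 by rewrite invr_gt0.
have Ne : N%:R <= eps^-1 + 1.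
  have : N%:R <= N.-1%:R + 1 :> rat by rewrite natr1 ler_nat; plia.
  by move/le_trans; apply; rewrite lerD2r ltW.
have tB : t%:R <= (C * 11 ^ D)%:R * (n%:R + b%:R + eps^-1 + 1) ^+ D :> rat.
  have Na : (N <= a)%N by rewrite /a; plia.
  apply: (@le_trans _ _ (C * a.+1 ^ D)%N%:R).
    by rewrite ler_nat; apply: leq_trans lt (tp N a Na).
  rewrite !natrM !natrX -mulrA -exprMn; apply: ler_wpM2l => //.
  have b0 : 0 <= b%:R :> rat by []. have n0 : 0 <= n%:R :> rat by [].
  have B0 : 0 <= n%:R + b%:R + eps^-1 + 1 by lra.
  apply: lerXn2r; rewrite ?nnegrE ?mulr_ge0 //.
  have -> : a.+1%:R = n%:R + N%:R + 9 :> rat by rewrite /a -natr1 !natrD; ring.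
  lra.
have er0 : 0 < ratr eps :> R by rewrite ltr0q.
pose inp i := nth 0 (input_seq p eps) i.
have mP : measurable [set x : n.-tuple (measurableTypeR R) | 0 <= qeval p x].
  by rewrite (halfspaceE R p eps); exact: measurable_qform.
have N0 : (0 < N)%N.
  by case: (N) eN => //; rewrite leNgt ei0.
have K1 : (1 < N)%N -> 1 <= (ratr eps)^-1 :> R.
  move=> h; rewrite -fmorphV -(rmorph1 (@ratr R)) ler_rat; apply: ltW; apply: le_lt_trans eN1.
  by rewrite (_ : 1 = 1%:R) // ler_nat; plia.
have kb0 : (0 : R) <= 1%N%:R * (ratr eps)^-1 ^+ 4 * ln (2 + (ratr eps)^-1) ^+ 0.
  by rewrite expr0 mulr1 mul1r exprn_ge0 // invr_ge0 ltW.
case: out => [[NE c0' c1 c2]|[NE mx c0' c1 c2]|[E0 [A [E [th [NE [mx E00] [jA thJ t1 t2] [c0' c1 c2] [c3 c4]]]]]]].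
(* Here [eps >= 1], and two probabilities never differ by more than 1. One variable could violate
   the bound on [K], since [eps^-4] may be below 1. *)
- pose q : diagpoly 0 := DiagPoly (fun=> 0) (fun=> 0) ((mem_of s 1)%:~R / (mem_of s 2)%:~R).
  exists t, (mem_of s), 0%N, q; split=> //.
    by split=> //; [split; [rewrite c2|]|case].
  have mq : measurable [set y : 0.-tuple (measurableTypeR R) | 0 <= deval q y].
    by rewrite deval0E; case: ifP.
  rewrite gaussian_diff // lee_fin.
  have e1 : 1 <= ratr eps :> R.
    by rewrite -(rmorph1 (@ratr R)) ler_rat; move: eN; rewrite NE invf_le1.
  have := prG_le1 mP; have := prG_le1 mq; have := prG_ge0 [set y : 0.-tuple (measurableTypeR R) | 0 <= deval q y].
  have := prG_ge0 [set x : n.-tuple (measurableTypeR R) | 0 <= qeval p x].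
  by move=> h1 h2 h3 h4; rewrite ler_norml; apply/andP; split; clear -h1 h2 h3 h4 e1; lra.
(* Scale 0: the polynomial is its constant term, which is returned as it is, and the two
   probabilities are equal. *)
- pose q : diagpoly 0 := DiagPoly (fun=> 0) (fun=> 0) ((mem_of s 1)%:~R / (mem_of s 2)%:~R).
  exists t, (mem_of s), 0%N, q; split=> //.
    by split=> //; [split; [rewrite c2|]|case].
  have z0 i j : (i < n.+1)%N -> (j < n.+1)%N -> (0 < i + j)%N -> G0 n inp i j = 0.
    by move=> iN jN ij; have [_ h _] := mx; apply/eqP; rewrite -normr_le0; exact: h.
  have pE (x : n.-tuple (measurableTypeR R)) : qeval p x = (inp 3%N)%:~R.
    have := qform_input p eps x; rewrite /qform pair_big /= (bigD1 (ord0, ord0)) //= big1.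
      rewrite addr0 !mulr1 -/inp rmorphD /=; lra.
    move=> [i j] /=; rewrite -pair_eqE /pair_eq -!val_eqE /= => ij.
    by rewrite z0 ?mul0r //; move: ij; case: (i : nat); case: (j : nat).
  have dq : ratr (Defs.dcst q) = (inp 3%N)%:~R :> R by rewrite /q /= c1 c2 divr1 ratr_int.
  have -> : [set x : n.-tuple R | 0 <= qeval p x] = if 0 <= (inp 3%N)%:~R :> R then setT else set0.
    by apply/seteqP; split=> x /=; rewrite pE; case: ifP.
  have -> : [set y : 0.-tuple R | 0 <= deval q y] = if 0 <= (inp 3%N)%:~R :> R then setT else set0.
    by rewrite -dq -deval0E.
  have e0 : 0 <= 45%:R * ratr eps :> R by rewrite mulr_ge0 // ltW.
  have e1 (B : set (n.-tuple (measurableTypeR R))) (B' : set (0.-tuple (measurableTypeR R))) :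
      gaussian R n B = gaussian R 0 B' -> measurable B' ->
      (`|gaussian R n B - gaussian R 0 B'| <= (45%:R * ratr eps)%:E)%E.
    by move=> -> mB'; rewrite subee ?fin_num_measure // abse0 lee_fin.
  by case: ifP => _; apply: e1 => //; [rewrite !probability_setT|rewrite !measure0].
pose q : diagpoly 1 := DiagPoly (fun=> 0) (fun=> 1) ((mem_of s 1)%:~R / (mem_of s 2)%:~R).
have a8 : (8 <= a)%N by rewrite /a leq_addl.
have na : (n + 4 < a)%N.
  by rewrite /a -addnA ltn_add2l; apply: (@leq_trans 8) => //; exact: leq_addl.
have a90 : (0 < a ^ 9)%N by rewrite expn_gt0 (leq_trans _ a8).
exists t, (mem_of s), 1%N, q; split=> //.
- split=> //; first by split; [rewrite c2 ltz_nat|].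
  by move=> i; rewrite ord1.
- by rewrite expr0 mulr1 mul1r exprn_ege1 // K1.
have jA' := jac_jinv a8 na (@symA_G0 n inp) E00 mx jA.
have [E1 As _ _ _] := jA'.
have Ab i j := @jinv_entry a n a8 na _ _ E00 mx _ A E i j jA'.
have X59 : (8 * a ^ 59 <= a ^ 60)%N by rewrite (expnS a 59); apply: leq_mul.
have nb := jac_end a8 na (@symA_G0 n inp) E00 mx X59 jA.
have [i iN big] := jac_big a8 na (@symA_G0 n inp) E00 mx jA nb.
have cmp := @compare R a n A E a8 na E1 As Ab nb i iN big.
have thc := @theta_cell R a n A E a8 na E1 th thJ t1 t2.
have law := @prG_jac R a n a8 na _ _ _ _ _ jA.
have cx : ratr (Defs.dcst q) = - xg R a th :> R.
  rewrite /q /= c1 c2 fmorph_div /= ?rmorph_int ?ratr_int /xg /tt -mulNr; congr (_ / _).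
  by rewrite -rmorphN opprB.
have g1 := gaussian1_half cx.
have mq : measurable [set y : 1.-tuple (measurableTypeR R) | 0 <= deval q y].
  have -> : [set y : 1.-tuple (measurableTypeR R) | 0 <= deval q y] =
    [set y : 1.-tuple (measurableTypeR R) | forall i, `[xg R a th, +oo[%classic (tnth y i)].
    apply/seteqP; split=> y /=; rewrite /deval big_ord1 /= mul0r add0r mul1r cx subr_ge0.
      by move=> h i'; rewrite ord1 in_itv /= h.
    by move=> /(_ ord0); rewrite in_itv /= andbT.
  by apply: measurable_box; exact: measurable_itv.
rewrite gaussian_diff // lee_fin.
have -> : prG [set y : 1.-tuple (measurableTypeR R) | 0 <= deval q y] = prN `[xg R a th, +oo[%classic.
  by rewrite /prG /prN g1.
rewrite (halfspaceE R p eps) -law.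
(* Since [a >= N >= 1 / eps], every error expressed in [1 / a] is an error in [eps]. *)
have ue : (a%:R)^-1 <= ratr eps :> R.
  have -> : (a%:R)^-1 = ratr (a%:R)^-1 :> R by rewrite fmorphV rmorph_nat.
  have a0 : 0 < a%:R :> rat by rewrite ltr0n (leq_trans _ a8).
  have Na : (N <= a)%N by rewrite /a -addnA; apply: leq_trans (leq_addl n _); exact: leq_addr.
  by rewrite ler_rat -[leRHS]invrK lef_pV2 ?posrE // (le_trans eN) // ler_nat.
move: cmp thc; rewrite !ler_norml => /andP[h1 h2] /andP[h3 h4].
apply/andP; split; clear -h1 h2 h3 h4 ue; lra.
Qed.
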